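(* Let $(x^k)_{k\in\mathbb N}$ be the sequence generated by the asynchronous block-coordinate forward-backward algorithm described in the context, and suppose that $$\delta:=\max_{i\in[m]}\Big(L_i\gamma_i+2\gamma_i\tau L_{\mathrm{res}}\frac{p_{\max}}{\sqrt{p_{\min}}}\Big)<2 .$$ Then the following hold. (i) The sequence $(x^k)_{k\in\mathbb N}$ converges weakly $\mathsf P$-a.s. to a random variable that takes values in $\operatorname{argmin}F$. (ii) $\mathsf E[F(x^k)]-F^*=o(1/k)$. Furthermore, for every integer $k\ge 1$, $$\mathsf E[F(x^k)]-F^*\le\frac1k\left(\frac{\operatorname{dist}_W^2(x^0,\operatorname{argmin}F)}{2}+C\,(F(x^0)-F^* )\right),$$ where $$C=\frac{\max\{1,(2-\delta)^{-1}\}}{p_{\min}}-1+\tau\,\frac{1}{\sqrt{p_{\min}}\,(2-\delta)}\Big(1+\frac{p_{\max}}{\sqrt{p_{\min}}}\Big).$$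
   Context: Let $m\ge1$ and $[m]=\{1,\dots,m\}$. $H_1,\dots,H_m$ are separable real Hilbert spaces and $H=\bigoplus_{i=1}^m H_i$ is their direct sum, with elements $x=(x_1,\dots,x_m)$ and inner product $\langle x,y\rangle=\sum_{i=1}^m\langle x_i,y_i\rangle$; $\|\cdot\|$ is the norm of $H$ and $|\cdot|$ the norm of each $H_i$. Objective: $F=f+g$ with $g(x)=\sum_{i=1}^m g_i(x_i)$, where (1) $f:H\to\mathbb R$ is convex and differentiable, and $\nabla_i f(x)\in H_i$ denotes the $i$-th component of $\nabla f(x)$; (2) each $g_i:H_i\to\,]-\infty,+\infty]$ is proper, convex and lower semicontinuous; (3) there are constants $L_{\mathrm{res}}>0$ and $L_1,\dots,L_m$ such that for all $x\in H$ and $i\in[m]$ the map $H_i\ni u\mapsto\nabla f(x_1,\dots,x_{i-1},u,x_{i+1},\dots,x_m)\in H$ is Lipschitz continuous with constant $L_{\mathrm{res}}$ and the map $H_i\ni u\mapsto\nabla_i f(x_1,\dots,x_{i-1},u,x_{i+1},\dots,x_m)\in H_i$ is Lipschitz continuous with constant $L_i$; moreover $\max_i L_i\le L_{\mathrm{res}}$; (4) $F$ attains its minimum $F^*=\min F$ on $H$. For proper convex lower semicontinuous $\varphi$, $\operatorname{prox}_\varphi(x)=\operatorname{argmin}_y\{\varphi(y)+\tfrac12\|y-x\|^2\}$ (with the norm of the space on which $\varphi$ is defined). Algorithm: $(i_k)_{k\in\mathbb N}$ are i.i.d. random variables on a probability space $(\Omega,\mathfrak A,\mathsf P)$ with values in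 $[m]$, with $p_i=\mathsf P(i_k=i)>0$ for each $i\in[m]$; $p_{\max}=\max_i p_i$, $p_{\min}=\min_i p_i$. $\tau\in\mathbb N$ (possibly $0$), and $d^k=(d^k_1,\dots,d^k_m)\in\mathbb N^m$, $k\in\mathbb N$, are deterministic delay vectors (independent of the block selection process $(i_k)_{k\in\mathbb N}$) with $\max_i d^k_i\le\min\{k,\tau\}$. The stepsizes are $\gamma_i>0$, $i\in[m]$, and $x^0\in H$ is a constant random variable (deterministic). For $k=0,1,2,\dots$, set $x^{k-d^k}=(x_1^{k-d^k_1},\dots,x_m^{k-d^k_m})$ and $$x_i^{k+1}=\begin{cases}\operatorname{prox}_{\gamma_{i}g_{i}}\big(x^k_{i}-\gamma_{i}\nabla_{i}f(x^{k-d^k})\big)&\text{if }i=i_k,\\ x_i^k&\text{if }i\ne i_k.\end{cases}$$ Weighted norm: $\|x\|_W^2=\sum_{i=1}^m\frac{1}{\gamma_ip_i}|x_i|^2$, and $\operatorname{dist}_W(x,S)=\inf_{z\in S}\|x-z\|_W$.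
   Formalization: Part (ii) is stated under the additional assumption F(x^0) < +∞; otherwise, with at least two blocks, E[F(x^k)] = +∞ for all k and the o(1/k) claim fails. Part (i) holds for every x^0 in H. *)

(* Defs.v *)
From HB Require Import structures.
From mathcomp Require Import all_boot all_order all_algebra.
From mathcomp Require Import all_classical all_reals all_analysis.
From mathcomp Require Import ring lra.

Set Implicit Arguments.
Unset Strict Implicit.
Unset Printing Implicit Defensive.

Import Order.TTheory GRing.Theory Num.Theory.
Import numFieldNormedType.Exports.

Local Open Scope classical_set_scope.
Local Open Scope ring_scope.

HB.mixin Record CompleteNormedModule_isHilbert (R : realType) V
    & CompleteNormedModule R V := {
  inner : V -> V -> R ;
  innerC : forall x y, inner x y = inner y x ;
  innerDl : forall x y z, inner (x + y) z = inner x z + inner y z ;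
  innerZl : forall (a : R) x y, inner (a *: x) y = a * inner x y ;
  inner_normE : forall x, inner x x = `|x| ^+ 2
}.

#[short(type="hilbertType")]
HB.structure Definition Hilbert (R : realType) :=
  {V of CompleteNormedModule R V & CompleteNormedModule_isHilbert R V}.

Definition separable (T : topologicalType) : Prop :=
  exists2 D : set T, countable D & dense D.

Definition weakly_cvg (R : realType) (V : hilbertType R) (u : nat -> V) (l : V)
  : Prop := forall v : V, inner (u k) v @[k --> \oo] --> inner l v.

Section inner_theory.
Context (R : realType) (V : hilbertType R).
Implicit Types x y : V.

Lemma inner_ge0 x : 0 <= inner x x.
Proof. by rewrite inner_normE exprn_ge0. Qed.

Lemma inner0l y : inner (0 : V) y = 0.
Proof. by rewrite -(scale0r (0 : V)) innerZl mul0r. Qed.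

End inner_theory.

(* An alias, so as not to inherit the product topology of dependent functions;
   the Hilbert structure declared below is that of the l2 direct sum. *)
Definition dsum (R : realType) (n : nat) (H : 'I_n -> hilbertType R) : Type :=
  forall i, H i.

Section dsum_lmodule.
Context (R : realType) (n : nat) (H : 'I_n -> hilbertType R).
Implicit Types x y z : dsum H.

HB.instance Definition _ := gen_eqMixin (dsum H).
HB.instance Definition _ := gen_choiceMixin (dsum H).

Let dadd x y : dsum H := fun i => x i + y i.
Let dopp x : dsum H := fun i => - x i.
Let dzero : dsum H := fun=> 0.
Let dscale (a : R) x : dsum H := fun i => a *: x i.

Let daddA : associative dadd.
Proof. by move=> x y z; apply: functional_extensionality_dep => i; exact: addrA. Qed.
Let daddC : commutative dadd.
Proof. by move=> x y; apply: functional_extensionality_dep => i; exact: addrC. Qed.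
Let dadd0 : left_id dzero dadd.
Proof. by move=> x; apply: functional_extensionality_dep => i; exact: add0r. Qed.
Let daddN : left_inverse dzero dopp dadd.
Proof. by move=> x; apply: functional_extensionality_dep => i; exact: addNr. Qed.

HB.instance Definition _ := GRing.isZmodule.Build (dsum H) daddA daddC dadd0 daddN.

Let dscaleA a b x : dscale a (dscale b x) = dscale (a * b) x.
Proof. by apply: functional_extensionality_dep => i; exact: scalerA. Qed.
Let dscale1 : left_id 1 dscale.
Proof. by move=> x; apply: functional_extensionality_dep => i; exact: scale1r. Qed.
Let dscaleDr : right_distributive dscale +%R.
Proof. by move=> a x y; apply: functional_extensionality_dep => i; exact: scalerDr. Qed.
Let dscaleDl x : {morph dscale^~ x : a b / a + b}.
Proof. by move=> a b; apply: functional_extensionality_dep => i; exact: scalerDl. Qed.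

HB.instance Definition _ := GRing.Zmodule_isLmodule.Build R (dsum H)
  dscaleA dscale1 dscaleDr dscaleDl.

End dsum_lmodule.

Section dsum_hilbert.
Context (R : realType) (n : nat) (H : 'I_n -> hilbertType R).
Implicit Types x y z : dsum H.

Definition dsum_inner x y : R := \sum_i inner (x i) (y i).
Definition dsum_norm x : R := Num.sqrt (\sum_i `|x i| ^+ 2).

Lemma dsum_normE x : dsum_norm x ^+ 2 = dsum_inner x x.
Proof.
rewrite sqr_sqrtr; last by apply: sumr_ge0 => i _; exact: exprn_ge0.
by apply: eq_bigr => i _; rewrite inner_normE.
Qed.

Let dinnerC x y : dsum_inner x y = dsum_inner y x.
Proof. by apply: eq_bigr => i _; exact: innerC. Qed.
Let dinnerDl x y z : dsum_inner (x + y) z = dsum_inner x z + dsum_inner y z.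
Proof. by rewrite -big_split; apply: eq_bigr => i _; exact: innerDl. Qed.
Let dinnerZl a x y : dsum_inner (a *: x) y = a * dsum_inner x y.
Proof. by rewrite mulr_sumr; apply: eq_bigr => i _; exact: innerZl. Qed.

Lemma dsum_norm_ge0 x : 0 <= dsum_norm x. Proof. exact: sqrtr_ge0. Qed.

Let dnorm0_eq0 x : dsum_norm x = 0 -> x = 0.
Proof.
move=> x0; apply: functional_extensionality_dep => i; apply/eqP.
rewrite -normr_eq0 -sqrf_eq0; apply/eqP.
have /eqP := dsum_normE x; rewrite x0 expr0n/= eq_sym psumr_eq0.
  by move=> /allP/(_ i (mem_index_enum i)) /eqP; rewrite inner_normE.
by move=> j _; exact: inner_ge0.
Qed.

Let dnormZ a x : dsum_norm (a *: x) = `|a| * dsum_norm x.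
Proof.
rewrite /dsum_norm -sqrtr_sqr -sqrtrM ?sqr_ge0// mulr_sumr; congr Num.sqrt.
by apply: eq_bigr => i _; rewrite [(a *: x) i]/(a *: x i) normrZ exprMn real_normK ?num_real.
Qed.

Let dcauchy_schwarz x y : dsum_inner x y <= dsum_norm x * dsum_norm y.
Proof.
have [->|x0] := eqVneq x 0.
  rewrite /dsum_inner big1 ?mulr_ge0 ?dsum_norm_ge0// => i _; exact: inner0l.
have [->|y0] := eqVneq y 0.
  rewrite dinnerC /dsum_inner big1 ?mulr_ge0 ?dsum_norm_ge0// => i _; exact: inner0l.
have nx : 0 < dsum_norm x.
  by rewrite lt_neqAle dsum_norm_ge0 andbT; apply: contra_neq x0 => /esym/dnorm0_eq0.
have ny : 0 < dsum_norm y.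
  by rewrite lt_neqAle dsum_norm_ge0 andbT; apply: contra_neq y0 => /esym/dnorm0_eq0.
have : 0 <= dsum_inner (dsum_norm y *: x + (- dsum_norm x) *: y)
                       (dsum_norm y *: x + (- dsum_norm x) *: y).
  by rewrite -dsum_normE exprn_ge0// dsum_norm_ge0.
rewrite dinnerDl !(dinnerZl, dinnerC _ (_ + _), dinnerDl) -!dsum_normE (dinnerC y x).
set a := dsum_norm x; set b := dsum_norm y; set c := dsum_inner x y.
have -> : b * (b * a ^+ 2 + - a * c) + - a * (b * c + - a * b ^+ 2) =
  (2 * (a * b)) * (a * b - c).
  by ring.
by rewrite pmulr_rge0 ?subr_ge0// !mulr_gt0.
Qed.

Let dler_normD x y : dsum_norm (x + y) <= dsum_norm x + dsum_norm y.
Proof.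
rewrite -(@ler_pXn2r _ 2)// ?nnegrE ?addr_ge0 ?dsum_norm_ge0//.
rewrite dsum_normE dinnerDl !(dinnerC _ (_ + _)) !dinnerDl -!dsum_normE (dinnerC y x).
have := dcauchy_schwarz x y; lra.
Qed.

HB.instance Definition _ := Lmodule_isNormed.Build R (dsum H)
  dler_normD dnormZ dnorm0_eq0.

Lemma normr_coord_le x i : `|x i| <= `|x|.
Proof.
rewrite -[`|x|]/(dsum_norm x) -(ger0_norm (normr_ge0 (x i))) -sqrtr_sqr ler_sqrt.
  by rewrite (bigD1 i)//= lerDl sumr_ge0// => j _; exact: exprn_ge0.
by rewrite sumr_ge0// => j _; exact: exprn_ge0.
Qed.

Lemma normr_le_sum_coord x : `|x| <= \sum_i `|x i|.
Proof.
rewrite -(@ler_pXn2r _ 2)// ?nnegrE// ?sumr_ge0//.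
rewrite -[`|x|]/(dsum_norm x) sqr_sqrtr; last by apply: sumr_ge0 => i _; exact: exprn_ge0.
rewrite expr2 mulr_suml; apply: ler_sum => i _.
by rewrite expr2 ler_wpM2l// (bigD1 i)//= lerDl sumr_ge0.
Qed.

Let dcomplete (F : set_system (dsum H)) : ProperFilter F -> cauchy F -> cvg F.
Proof.
move=> FF Fc; have Fci i : cvg ((fun x : dsum H => x i) @ F).
  apply: cauchy_cvg; apply: cauchy_exP => e e0.
  have [x Fx] := (cauchyP F).1 Fc e e0.
  exists (x i).
  apply: (@filterS _ F _ (ball x e) [set y : dsum H | ball (x i) e (y i)]) Fx => y /=.
  rewrite -!ball_normE/= => xy.
  by apply: le_lt_trans _ xy; rewrite -[x i - y i]/((x - y) i); exact: normr_coord_le.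
pose l : dsum H := fun i => lim ((fun x : dsum H => x i) @ F).
apply/cvg_ex; exists l; apply/cvgrPdist_lt => e e0.
have e1 : 0 < e / n.+1%:R by rewrite divr_gt0.
have : F [set x : dsum H | forall i, `|l i - x i| < e / n.+1%:R].
  by apply: filter_forall => i; move/cvgrPdist_lt : (Fci i); exact.
apply: filterS => x lx; apply: le_lt_trans (normr_le_sum_coord (l - x)) _.
apply: (@le_lt_trans _ _ (\sum_(i < n) e / n.+1%:R)).
  by apply: ler_sum => i _; exact/ltW/lx.
rewrite sumr_const card_ord -[ltLHS]mulr_natr -mulrA gtr_pMr// mulrC.
by rewrite ltr_pdivrMr// mul1r ltr_nat.
Qed.

HB.instance Definition _ := Uniform_isComplete.Build (dsum H) dcomplete.

Let dinner_normE x : dsum_inner x x = `|x| ^+ 2.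
Proof. by rewrite -dsum_normE. Qed.

HB.instance Definition _ := CompleteNormedModule_isHilbert.Build R (dsum H)
  dinnerC dinnerDl dinnerZl dinner_normE.

End dsum_hilbert.

(* The vector representing the differential of f at x; it exists and is unique
   whenever f is differentiable at x, by the Riesz theorem. *)
Definition gradient (R : realType) (V : hilbertType R) (f : V -> R) (x : V)
  : V := xget 0 [set v | forall h, 'd f x h = inner v h].

Section convex_optimization.
Context (R : realType).
Local Open Scope ereal_scope.

Definition argmin (T : Type) (phi : T -> \bar R) : set T :=
  [set x | forall y, phi x <= phi y].

Definition proper_function (T : Type) (phi : T -> \bar R) : Prop :=
  (forall x, -oo < phi x) /\ exists x, phi x < +oo.

(* Only meant for functions avoiding -oo, so that the right-hand side is never
   of the form +oo - oo. *)
Definition econvex (V : lmodType R) (phi : V -> \bar R) : Prop :=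
  forall (x y : V) (t : R), (0 <= t <= 1)%R ->
    phi (t *: x + (1 - t) *: y)%R <= t%:E * phi x + (1 - t)%:E * phi y.

(* The argmin is a singleton when phi is proper, convex and lower
   semicontinuous. *)
Definition prox (V : hilbertType R) (phi : V -> \bar R) (x : V) : V :=
  xget 0%R (argmin (fun y => phi y + (2^-1 * `|y - x| ^+ 2)%:E)).

End convex_optimization.

Section block_structure.
Context (R : realType) (n : nat) (H : 'I_n -> hilbertType R).

Definition objective (f : dsum H -> R) (g : forall i, H i -> \bar R)
  (x : dsum H) : \bar R := ((f x)%:E + \sum_(i < n) g i (x i))%E.

Definition set_block (x : dsum H) (i : 'I_n) (u : H i) : dsum H :=
  @dfwith 'I_n (fun j => H j : Type) x i u.

Definition delayed (x : nat -> dsum H) (k : nat) (d : 'I_n -> nat) : dsum H :=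
  fun j => x (k - d j)%N j.

Definition normW (gamma p : 'I_n -> R) (x : dsum H) : R :=
  Num.sqrt (\sum_(i < n) (gamma i * p i)^-1 * `|x i| ^+ 2).

Definition distW (gamma p : 'I_n -> R) (x : dsum H) (S : set (dsum H)) : R :=
  inf [set normW gamma p (x - z) | z in S].

End block_structure.

Arguments set_block {R n H} x i u.

Definition max_ord (R : realType) (n : nat) (a : 'I_n.+1 -> R) : R :=
  \big[Num.max/a ord0]_(i < n.+1) a i.

Definition min_ord (R : realType) (n : nat) (a : 'I_n.+1 -> R) : R :=
  \big[Num.min/a ord0]_(i < n.+1) a i.

HB.instance Definition _ (n : nat) := isPointed.Build 'I_n.+1 ord0.

HB.instance Definition _ (n : nat) := @isMeasurable.Build
  default_measure_display 'I_n.+1 discrete_measurable discrete_measurable0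
  discrete_measurableC discrete_measurableU.

Definition borelType (T : ptopologicalType) := g_sigma_algebraType (@open T).

Definition mutually_independent d (Omega : measurableType d) (R : realType)
    (P : probability Omega R) d' (E : measurableType d')
    (X : nat -> {RV P >-> E}) : Prop :=
  forall (s : seq nat) (A : nat -> set E), uniq s ->
    (forall k, measurable (A k)) ->
    P (\bigcap_(k in [set` s]) (X k @^-1` A k)) =
    (\prod_(k <- s) P (X k @^-1` A k))%E.

(* Main.v *)
Require Import Defs.
From mathcomp Require Import all_boot all_order all_algebra.
From mathcomp Require Import all_classical all_reals all_analysis.
From mathcomp Require Import measurable_realfun ring lra.

(** Write x for the current iterate, D_i for the displacement that the proximal
    step proposes in block i, and E_k for the mean over the next selected block,
    which is a finite sum with weights p_i. Two one-step inequalities carry the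
    proof.

    The first is a descent inequality for the objective. The block descent lemma
    and the proximal inequality give a decrease of order |D_i|^2, spoilt by the
    use of a delayed gradient. The delayed point is joined to the current one by
    at most tau single-block moves, so the gradient error is at most Lres times
    the sum of the last tau increments (delayed_chain), and Young's inequality
    turns it into squared increments. Adding to the objective the weighted sum
    [lag] of the last squared increments, whose weights drop by one at each step,
    makes the error telescope: the corrected objective Phi decreases in mean
    (step_objective, Phi_step).

    The second bounds the squared weighted distance to a minimiser z
    (step_distance). The weights 1/(gamma_i p_i) cancel the selection
    probabilities, so the mean decrease is that of a full forward-backward step:
    it controls the gap F(x) - F(z), up to a term that the decrease of Phi pays
    for and up to squared increments. With the right multiple of Phi - F(z) and
    of the lag added (potential_arith), this yields an energy V with

      E_k V_{k+1} <= V_k - 2 (Phi_k - F(z)),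

    see energy_step. Everything follows from this inequality.

    Rate: summing expectations bounds the series of E Phi_k - F(z), whose terms
    do not increase. A bounded series of nonincreasing terms has terms o(1/k),
    and its k-th term is at most 1/k times the bound. The constant C is half the
    multiple of Phi_0 - F(z) in V_0, less 1 because the initial term is left out
    of the sum (rate_bound, rate_little_o).

    Weak convergence: V is a nonnegative supermartingale, so it converges almost
    surely (supermartingale_cvg, by counting upcrossings), while Phi_k - F(z)
    tends to 0 because its expectations are summable. Hence the weighted distance
    of the iterates to z converges, simultaneously for all z in a countable dense
    set of minimisers. Since the objective may be infinite at the starting point,
    this is carried out from a time K on and on the event that the objective is
    finite at time K; these events exhaust the probability space, because each
    block is eventually selected. The rest is pathwise
    (weak_limit_of_unique_hull): the closed convex hulls of the tails of a bounded
    sequence have a common point, lower semicontinuity makes every such point a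
    minimiser, and convergence of the distances leaves room for only one, along
    any subsequence.

    A quantity known at time k is a function of the first k selected blocks, hence
    takes finitely many values, and conditional expectations reduce to finite sums
    (Ex_select). *)

Set Implicit Arguments.
Unset Strict Implicit.
Unset Printing Implicit Defensive.

Import Order.TTheory GRing.Theory Num.Theory.
Import numFieldNormedType.Exports.

Local Open Scope classical_set_scope.
Local Open Scope ring_scope.

(** * Hilbert spaces: Cauchy-Schwarz and nested convex sets *)

Lemma sqr_abs (R : realDomainType) (a : R) : `|a| ^+ 2 = a ^+ 2.
Proof. by rewrite real_normK ?num_real. Qed.

Section inner_product.
Context (R : realType) (V : hilbertType R).
Implicit Types x y z : V.

Lemma innerDr x y z : inner x (y + z) = inner x y + inner x z.
Proof. by rewrite innerC innerDl !(innerC x). Qed.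

Lemma innerZr (a : R) x y : inner x (a *: y) = a * inner x y.
Proof. by rewrite innerC innerZl innerC. Qed.

Lemma innerNl x y : inner (- x) y = - inner x y.
Proof. by rewrite -scaleN1r innerZl mulN1r. Qed.

Lemma innerNr x y : inner x (- y) = - inner x y.
Proof. by rewrite innerC innerNl innerC. Qed.

Lemma innerBl x y z : inner (x - y) z = inner x z - inner y z.
Proof. by rewrite innerDl innerNl. Qed.

Lemma innerBr x y z : inner x (y - z) = inner x y - inner x z.
Proof. by rewrite innerDr innerNr. Qed.

Lemma inner0r x : inner x 0 = 0.
Proof. by rewrite innerC inner0l. Qed.

Lemma sqr_normD x y : `|x + y| ^+ 2 = `|x| ^+ 2 + 2 * inner x y + `|y| ^+ 2.
Proof. by rewrite -!inner_normE innerDl !innerDr (innerC y x); ring. Qed.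

Lemma sqr_normB x y : `|x - y| ^+ 2 = `|x| ^+ 2 - 2 * inner x y + `|y| ^+ 2.
Proof. by rewrite sqr_normD innerNr normrN mulrN. Qed.

Lemma cauchy_schwarz x y : `|inner x y| <= `|x| * `|y|.
Proof.
have [->|x0] := eqVneq x 0; first by rewrite inner0l !normr0 mul0r.
have nx : 0 < `|x| ^+ 2 by rewrite exprn_gt0 // normr_gt0.
have h : 0 <= `|x| ^+ 2 * (`|x| ^+ 2 * `|y| ^+ 2 - inner x y ^+ 2).
  have := exprn_ge0 2 (normr_ge0 (`|x| ^+ 2 *: y - inner x y *: x)).
  rewrite sqr_normB !normrZ innerZl innerZr !exprMn !sqr_abs (innerC y x).
  by congr (_ <= _); ring.
rewrite -(@ler_pXn2r _ 2) ?nnegrE ?mulr_ge0 //.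
rewrite exprMn sqr_abs -subr_ge0.
by rewrite pmulr_rge0 in h.
Qed.

Lemma inner_le_norm x y : inner x y <= `|x| * `|y|.
Proof. exact: le_trans (ler_norm _) (cauchy_schwarz x y). Qed.

Lemma inner_continuous x : continuous (inner x : V -> R).
Proof.
move=> y; apply/cvgrPdist_lt => e e0; near=> z.
rewrite -innerBr; apply: le_lt_trans (cauchy_schwarz _ _) _.
have : `|y - z| < e / (`|x| + 1).
  near: z; apply: cvgr_dist_lt => //; by rewrite divr_gt0 // ltr_wpDl.
rewrite ltr_pdivlMr ?ltr_wpDl //; apply: le_lt_trans.
by rewrite mulrC ler_wpM2l // lerDl.
Unshelve. all: by end_near. Qed.

Lemma cvg_norm_cauchy (u : nat -> V) :
  (forall e : R, 0 < e -> exists N, forall k l, (N <= k)%N -> (k <= l)%N -> `|u k - u l| < e) ->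
  cvg (u @ \oo).
Proof.
move=> uc; apply: cauchy_cvg; apply: cauchy_exP => e e0.
have [N uN] := uc _ e0; exists (u N); exists N => // k /= Nk.
by rewrite -ball_normE /=; apply: uN.
Qed.

Lemma parallelogram x y :
  `|x - y| ^+ 2 = 2 * `|x| ^+ 2 + 2 * `|y| ^+ 2 - 4 * `|2^-1 *: (x + y)| ^+ 2.
Proof.
by rewrite normrZ exprMn sqr_abs sqr_normB sqr_normD; field.
Qed.

(** Points of almost minimal norm in the sets form a Cauchy sequence: by the
    parallelogram identity, two of them are close because their midpoint still
    lies in the larger set. This plays the role of weak compactness below. *)
Lemma nested_closed_convex_inter (C : nat -> set V) (r : R) :
  (forall k, C k !=set0) -> (forall k, closed (C k)) ->
  (forall k x y, C k x -> C k y -> C k (2^-1 *: (x + y))) ->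
  (forall k l, (k <= l)%N -> C l `<=` C k) ->
  C 0%N `<=` [set x | `|x| <= r] ->
  exists x, forall k, C k x.
Proof.
move=> C0 Ccl Cmid Cdec Cr.
pose S k : set R := [set `|x| ^+ 2 | x in C k].
have Slb k : has_inf (S k).
  split; first by have [x Cx] := C0 k; exists (`|x| ^+ 2); exists x.
  by exists 0 => _ [x _ <-]; rewrite exprn_ge0.
pose d k := inf (S k).
have d_ub k : d k <= r ^+ 2.
  have [x Cx] := C0 k; apply: (@le_trans _ _ (`|x| ^+ 2)).
    by apply: ge_inf; [exact: (Slb k).2|exists x].
  by rewrite lerXn2r ?nnegrE// ?(le_trans (normr_ge0 x)) //; apply/Cr/(Cdec 0%N k).
have d_nd : nondecreasing_seq d.
  move=> k l kl; apply: lb_le_inf; first exact: (Slb l).1.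
  by move=> _ [x Cx <-]; apply: ge_inf; [exact: (Slb k).2|exists x => //; exact: Cdec Cx].
have d_le k x : C k x -> d k <= `|x| ^+ 2.
  by move=> Cx; apply: ge_inf; [exact: (Slb k).2|exists x].
have [D dD] : exists D : R, d @ \oo --> D.
  by apply/cvg_ex; apply: nondecreasing_is_cvgn => //; exists (r ^+ 2) => _ [k _ <-].
have dleD k : d k <= D.
  rewrite -(cvg_lim _ dD) //; apply: nondecreasing_cvgn_le => //.
  by apply/cvg_ex; exists D.
have /choice [u uP] : forall k, exists x, C k x /\ `|x| ^+ 2 < d k + k.+1%:R^-1.
  move=> k; have [_ [x Cx <-] xd] := @inf_adherent _ (S k) k.+1%:R^-1 (ltac:(by rewrite invr_gt0)) (Slb k).
  by exists x.
have uc : cvg (u @ \oo).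
  apply: cvg_norm_cauchy => e e0.
  have e8 : 0 < e ^+ 2 / 8 by rewrite divr_gt0 // exprn_gt0.
  have [N1 _ N1P] : \forall k \near \oo, `|D - d k| < e ^+ 2 / 8.
    by apply: cvgr_dist_lt.
  have [N2 _ N2P] := near_infty_natSinv_lt (PosNum e8).
  exists (maxn N1 N2) => k l; rewrite geq_max => /andP[k1 k2] kl.
  have hk : k.+1%:R^-1 < e ^+ 2 / 8 := N2P k k2.
  have hl : l.+1%:R^-1 < e ^+ 2 / 8 := N2P l (leq_trans k2 kl).
  have /= := N1P k k1; rewrite ger0_norm ?subr_ge0 // => hd.
  rewrite -(@ltr_pXn2r _ 2) ?nnegrE //; last exact: ltW.
  rewrite parallelogram.
  have := d_le k _ (Cmid _ _ _ (uP k).1 (Cdec _ _ kl _ (uP l).1)).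
  move: (uP k).2 (uP l).2 (dleD l) hk hl.
  by set ek := k.+1%:R^-1; set el := l.+1%:R^-1; clearbody ek el; lra.
have /cvg_ex [y uy] := uc; exists y => k.
have Cu : \forall l \near \oo, C k (u l).
  by exists k => // l /= kl; apply: (Cdec _ _ kl); exact: (uP l).1.
exact: (closed_cvg (C k) (Ccl k) Cu _ uy).
Qed.

End inner_product.

(** * Lower semicontinuity and the proximity operator *)

Section lsc.
Context (R : realType) (X : topologicalType).
Implicit Types phi psi : X -> \bar R.

Lemma lsc_sublevel_closed phi (a : R) :
  lower_semicontinuous phi -> closed [set x | (phi x <= a%:E)%E].
Proof.
move=> lphi; rewrite (_ : [set _ | _] = ~` [set x | (a%:E < phi x)%E]).
  by apply: open_closedC; move/lower_semicontinuousP : lphi.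
by apply/seteqP; split => x /=; rewrite leNgt => /negP.
Qed.

(** A real number below the sum is the sum of real numbers below the terms;
    this needs both terms to avoid -oo. *)
Lemma lscD phi psi : (forall x, -oo < phi x)%E -> (forall x, -oo < psi x)%E ->
  lower_semicontinuous phi -> lower_semicontinuous psi ->
  lower_semicontinuous (fun x => phi x + psi x)%E.
Proof.
move=> phiN psiN lphi lpsi x a ha.
have [b [c [hb hc abc]]] : exists b c : R,
    [/\ (b%:E < phi x)%E, (c%:E < psi x)%E & a <= b + c].
  move: (phiN x) (psiN x) ha.
  case: (phi x) => [r _| _|//]; case: (psi x) => [s _| _|//] h.
  - exists (r - (r + s - a) / 2), (s - (r + s - a) / 2).
    by rewrite -EFinD !lte_fin in h *; split; lra.
  - by exists (r - 1), (a - r + 1); rewrite ltry lte_fin; split => //; lra.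
  - by exists (a - s + 1), (s - 1); rewrite ltry lte_fin; split => //; lra.
  - by exists a, 0; rewrite !ltry; split => //; lra.
have [U Ux hU] := lphi _ _ hb; have [W Wx hW] := lpsi _ _ hc.
exists (U `&` W); first exact: filterI.
move=> y [/hU h1 /hW h2]; apply: le_lt_trans (lteD h1 h2).
by rewrite -EFinD lee_fin.
Qed.

Lemma lsc_continuous (q : X -> R) : continuous q ->
  lower_semicontinuous (fun x => (q x)%:E).
Proof.
move=> cq x a; rewrite lte_fin => ax.
exists (q @^-1` [set r | a < r]); last by move=> y /=; rewrite lte_fin.
by apply: cq; apply: lt_nbhsr.
Qed.

Lemma lsc_sum (I : Type) (r : seq I) (F : I -> X -> \bar R) :
  (forall i x, -oo < F i x)%E -> (forall i, lower_semicontinuous (F i)) ->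
  lower_semicontinuous (fun x => \sum_(i <- r) F i x)%E.
Proof.
move=> FN lF; elim: r => [|i r IH].
  rewrite (_ : (fun _ => _) = fun=> 0%:E); last by apply/funext => x; rewrite big_nil.
  by apply: lsc_continuous; exact: cst_continuous.
rewrite (_ : (fun _ => _) = fun x => (F i x + \sum_(i <- r) F i x)%E); last first.
  by apply/funext => x; rewrite big_cons.
apply: lscD => // x; elim: r {IH} => [|j r IH]; rewrite ?big_nil ?big_cons //.
by move: (FN j x) IH; case: (F j x); case: (\sum_(_ <- _) _)%E => // *; exact: ltNyr.
Qed.

End lsc.

Lemma lsc_comp (R : realType) (X Y : topologicalType) (phi : Y -> \bar R) (h : X -> Y) :
  continuous h -> lower_semicontinuous phi -> lower_semicontinuous (phi \o h).
Proof.
move=> ch lphi x a /lphi[U Ux hU]; exists (h @^-1` U); first exact: ch.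
by move=> y /hU.
Qed.

Section prox.
Context (R : realType) (V : hilbertType R).
Implicit Types (phi : V -> \bar R) (x y : V).

(** Lower semicontinuity bounds phi below on a ball around a point of its
    domain, and convexity along the segments leaving this point extends the
    bound, with a loss that is linear in the distance. *)
Lemma econvex_minorant phi x : proper_function phi -> econvex phi ->
  lower_semicontinuous phi ->
  exists A B : R, 0 <= B /\ forall y, ((A - B * `|y - x|)%:E <= phi y)%E.
Proof.
move=> [phiN [x1 x1oo]] cphi lphi.
have [c cE] : exists c, phi x1 = c%:E.
  by move: (phiN x1) x1oo; case: (phi x1) => // c _ _; exists c.
have [U /nbhs_ballP[r /= r0 rU] hU] := lphi x1 (c - 1) (ltac:(by rewrite cE lte_fin; lra)).
(* Slope 2 / r rather than 1 / r: the test point is put at half the radius, so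
   that it stays in the open ball. *)
exists (c - 1 - 2 / r * `|x - x1|), (2 / r); split.
  by rewrite divr_ge0 // ltW.
move=> y; apply: (@le_trans _ _ (c - 1 - 2 / r * `|y - x1|)%:E).
  rewrite lee_fin; have := ler_normD (y - x) (x - x1).
  rewrite subrKA => h; have := ler_wpM2l (_ : 0 <= 2 / r) h.
  by rewrite mulrDr => /(_ (ltac:(by rewrite divr_ge0 // ltW))); lra.
have [yr|yr] := ltP `|y - x1| r.
  apply: le_trans (ltW (hU y _)).
    by rewrite lee_fin gerBl mulr_ge0 // divr_ge0 // ltW.
  by apply: rU; rewrite -ball_normE /= distrC.
have s0 : 0 < `|y - x1| := lt_le_trans r0 yr.
set s := `|y - x1| in yr s0 *.
set t := r / (2 * s).
have t0 : 0 < t by rewrite divr_gt0 // mulr_gt0.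
have t1 : t <= 1 by rewrite ler_pdivrMr ?mulr_gt0 // mul1r; lra.
have ts : t * s = r / 2 by rewrite /t; field; rewrite gt_eqF.
have := cphi y x1 t (ltac:(by rewrite (ltW t0) t1)).
have /hU : U (t *: y + (1 - t) *: x1).
  apply: rU; rewrite -ball_normE /= distrC.
  rewrite scalerBl scale1r addrCA addrC addrK -scalerBr normrZ gtr0_norm //.
  by rewrite -/s ts; lra.
move=> h1 /(lt_le_trans h1); rewrite cE.
move: (phiN y); case: (phi y) => [v _| _ _|//]; last exact: leey.
rewrite -!EFinM -EFinD lte_fin lee_fin => h.
have -> : 2 / r * s = t^-1 by rewrite /t; field; rewrite !gt_eqF.
have h2 : - 1 < t * (v - c) by lra.
have : - t^-1 < v - c.
  rewrite -(ltr_pM2l t0) mulrN divff //; last by rewrite gt_eqF.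
lra.
Qed.

Lemma prox_objective_lsc phi x : proper_function phi -> lower_semicontinuous phi ->
  lower_semicontinuous (fun y => phi y + (2^-1 * `|y - x| ^+ 2)%:E)%E.
Proof.
move=> [phiN _] lphi; apply: lscD => // [y|]; first exact: ltNyr.
apply: lsc_continuous => y.
apply: cvgM; first exact: cvg_cst.
apply: (@cvg_comp _ _ _ (fun y => `|y - x|) (fun r => r ^+ 2)); last exact: exprn_continuous.
apply: cvg_norm; apply: cvgB; [exact: cvg_id|exact: cvg_cst].
Qed.

(** The sublevel sets of the proximal objective just above its infimum are
    nested, closed, convex and bounded, so they have a common point. *)
Lemma prox_argmin phi x : proper_function phi -> econvex phi ->
  lower_semicontinuous phi ->
  argmin (fun y => phi y + (2^-1 * `|y - x| ^+ 2)%:E)%E (prox phi x).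
Proof.
move=> pphi cphi lphi; apply: xgetPex.
have lpsi := @prox_objective_lsc phi x pphi lphi.
set psi := (fun y => _) in lpsi *.
have [A [B [B0 AB]]] := econvex_minorant x pphi cphi lphi.
have psi_ge y : ((A - B * `|y - x| + 2^-1 * `|y - x| ^+ 2)%:E <= psi y)%E.
  by rewrite EFinD leeD2r.
have [x1 x1oo] := pphi.2.
pose E : set R := [set r | exists y, psi y = r%:E].
have psiN y : (-oo < psi y)%E by apply: lt_le_trans (psi_ge y); exact: ltNyr.
have EI : has_inf E.
  split.
    exists (fine (psi x1)), x1; rewrite fineK // fin_numElt psiN /=.
    by rewrite lte_add_pinfty // ltry.
  exists (A - 2^-1 * B ^+ 2) => r [y yE].
  have := psi_ge y; rewrite yE lee_fin; apply: le_trans.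
  have := sqr_ge0 (`|y - x| - B); rewrite sqrrB; lra.
pose m := inf E.
have m_le y : (m%:E <= psi y)%E.
  move: (psiN y); case yE : (psi y) => [r| |] // _; last exact: leey.
  by rewrite lee_fin; apply: ge_inf; [exact: EI.2|exists y].
have mm k : (m%:E <= (m + k.+1%:R^-1)%:E)%E by rewrite lee_fin lerDl.
pose C k : set V := [set y | (psi y <= (m + k.+1%:R^-1)%:E)%E].
(* The bound on the norm comes from (|y - x| - B)^2 <= M, which implies |y -
   x| - B <= 1 + M because u <= 1 + u^2. *)
have [|k|k y1 y2|k l kl y|y Cy|y Cy] := @nested_closed_convex_inter _ _ C
    (`|x| + B + 1 + (2 * (m + 1 - A) + B ^+ 2)).
- move=> k; have [r [y yE] yr] := @inf_adherent _ E k.+1%:R^-1 (ltac:(by rewrite invr_gt0)) EI.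
  by exists y; rewrite /C /= yE lee_fin ltW.
- exact: lsc_sublevel_closed.
- rewrite /C /= => h1 h2.
  have := cphi y1 y2 2^-1 (ltac:(lra)).
  have -> : 1 - 2^-1 = 2^-1 :> R by field.
  rewrite -scalerDr; move: h1 h2; rewrite /psi.
  have N1 := pphi.1 y1; have N2 := pphi.1 y2; have N3 := pphi.1 (2^-1 *: (y1 + y2)).
  move: N1 N2 N3.
  case: (phi y1) => // r1 _; case: (phi y2) => // r2 _; case: (phi _) => // r3 _.
  rewrite -?EFinD -?EFinM -?EFinD !lee_fin => h1 h2 h3.
  have := parallelogram (y1 - x) (y2 - x).
  have -> : 2^-1 *: (y1 - x + (y2 - x)) = 2^-1 *: (y1 + y2) - x.
    rewrite addrACA -opprD scalerBr; congr (_ - _).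
    by rewrite -[x + x]mulr2n -[x *+ 2]scaler_nat scalerA mulVf ?scale1r // pnatr_eq0.
  have := sqr_ge0 (`|(y1 - x) - (y2 - x)|).
  move: h1 h2; set ek := k.+1%:R^-1; clearbody ek; lra.
- rewrite /C /= => /le_trans; apply; rewrite lee_fin lerD2l.
  by rewrite lef_pV2 ?posrE // ler_nat ltnS.
- have := le_trans (psi_ge y) Cy; rewrite lee_fin invr1 => h.
  have h2 := ler_normD (y - x) x; rewrite subrK in h2.
  have h3 : (`|y - x| - B) ^+ 2 <= 2 * (m + 1 - A) + B ^+ 2 by rewrite sqrrB; lra.
  have h4 : `|y - x| - B <= 1 + (2 * (m + 1 - A) + B ^+ 2).
    have := sqr_ge0 (`|y - x| - B - 2^-1).
    set u := `|y - x| - B in h3 *; rewrite sqrrB; lra.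
  rewrite /=; lra.
- exists y => z /=; apply: le_trans (m_le z).
  apply/lee_addgt0Pr => e e0.
  have [N _ NP] := near_infty_natSinv_lt (PosNum e0).
  apply: le_trans (Cy N) _; rewrite -EFinD lee_fin lerD2l.
  exact: (ltW (NP N (leqnn _))).
Qed.

Lemma prox_fin_num phi x : proper_function phi -> econvex phi ->
  lower_semicontinuous phi -> phi (prox phi x) \is a fin_num.
Proof.
move=> pphi cphi lphi; have [x1 x1oo] := pphi.2.
have := prox_argmin x pphi cphi lphi x1; rewrite fin_numElt pphi.1 /=.
case: (phi (prox phi x)) => [r _| /=|//]; first exact: ltry.
by rewrite addye // leye_eq; move: x1oo; case: (phi x1).
Qed.

(** Optimality condition: compare the minimiser with the points of the segment
    that joins it to z, and let them tend to the minimiser. *)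
Lemma prox_subgradient phi x z : proper_function phi -> econvex phi ->
  lower_semicontinuous phi ->
  (phi (prox phi x) + (inner (x - prox phi x) (z - prox phi x))%:E <= phi z)%E.
Proof.
move=> pphi cphi lphi; have fq := prox_fin_num x pphi cphi lphi.
have := prox_argmin x pphi cphi lphi; set q := prox phi x in fq *.
move=> qmin; have := pphi.1 z; case zE : (phi z) => [v| |] // _; last exact: leey.
move: fq; case qE : (phi q) => [r| |] // _; rewrite -EFinD lee_fin.
have key t : 0 < t -> t <= 1 -> r + inner (x - q) (z - q) <= v + t / 2 * `|z - q| ^+ 2.
  move=> t0 t1.
  have := qmin (t *: z + (1 - t) *: q); have := cphi z q t (ltac:(by rewrite (ltW t0) t1)).
  rewrite zE qE -!EFinM -EFinD.
  have := pphi.1 (t *: z + (1 - t) *: q); case: (phi (t *: z + (1 - t) *: q)) => // w _.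
  rewrite -?EFinD !lee_fin => h1 h2.
  have E1 : t *: z + (1 - t) *: q - x = t *: (z - q) - (x - q).
    by rewrite scalerBl scale1r scalerBr opprB !addrA; congr (_ - _); rewrite addrAC.
  move: h2; rewrite E1 (sqr_normB (t *: _)) normrZ exprMn sqr_abs innerZl (innerC (z - q)) (distrC q x) => h2.
  have : t * (r + inner (x - q) (z - q)) <= t * (v + t / 2 * `|z - q| ^+ 2) by lra.
  by rewrite ler_pM2l.
have [z0|z0] := leP (`|z - q| ^+ 2) 0.
  by have := key 1 ltr01 (lexx _); lra.
apply/ler_addgt0Pr => e e0.
set t := Num.min 1 (2 * e / `|z - q| ^+ 2).
have t0 : 0 < t by rewrite lt_min ltr01 divr_gt0 // mulr_gt0.
have t1 : t <= 1 by rewrite ge_min lexx.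
have t2 : t * `|z - q| ^+ 2 <= 2 * e by rewrite -ler_pdivlMr // ge_min lexx orbT.
by have := key t t0 t1; lra.
Qed.

End prox.

(** * Gradients of convex functions *)

Section gradient.
Context (R : realType) (V : hilbertType R).
Implicit Types (f : V -> R) (x y : V).

(** The vector representing l minimises |h|^2 / 2 - l h, so it is the proximal
    point of - l at 0. *)
Lemma riesz (l : V -> R) : linear_for *%R l -> continuous l ->
  exists q : V, forall h, l h = inner q h.
Proof.
move=> ll lc.
have lD a b : l (a + b) = l a + l b by have := ll 1 a b; rewrite scale1r mul1r.
have l0 : l 0 = 0 by have := lD 0 0; rewrite addr0; lra.
have lZ c a : l (c *: a) = c * l a by have := ll c a 0; rewrite !addr0 l0 addr0.
have lN a : l (- a) = - l a by rewrite -scaleN1r lZ mulN1r.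
pose phi h := (- l h)%:E.
have pphi : proper_function phi.
  by split=> [h|]; [exact: ltNyr|exists 0; exact: ltry].
have cphi : econvex phi.
  by move=> a b t _; rewrite /phi -!EFinM -EFinD lee_fin lD !lZ; lra.
have lphi : lower_semicontinuous phi.
  by apply: lsc_continuous => h; apply: cvgN; exact: lc.
exists (prox phi 0) => h; set q := prox phi 0.
have key k : l k <= inner q k.
  have := prox_subgradient 0 (q + k) pphi cphi lphi.
  by rewrite -/q /phi -EFinD lee_fin sub0r [q + k]addrC addrK innerNl lD; lra.
have := key h; have := key (- h); rewrite lN innerNr; lra.
Qed.

(** The gradient is defined by a choice that is only meaningful when a
    representing vector exists; the Riesz theorem provides it. *)
Lemma gradientP f x : differentiable f x ->
  forall h, 'd f x h = inner (gradient f x) h.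
Proof.
move=> df; have [q qP] := riesz (linearP ('d f x)) (diff_continuous df).
exact: (@xgetPex _ 0 [set v | forall h, 'd f x h = inner v h] (ex_intro _ q qP)).
Qed.

Lemma convex_functionP f : convex_function [set: V] f ->
  forall x y t, 0 <= t <= 1 -> f (t *: x + (1 - t) *: y) <= t * f x + (1 - t) * f y.
Proof.
move=> cf x y t /andP[t0 t1].
by have := cf (Itv01 t0 t1) x y (mem_set I) (mem_set I).
Qed.

(** The difference quotients of a convex function along a segment are bounded
    by the one over the whole segment. *)
Lemma gradient_le f x y : convex_function [set: V] f -> differentiable f x ->
  f x + inner (gradient f x) (y - x) <= f y.
Proof.
move=> cf df; rewrite -gradientP //; set v := y - x.
have := @diff_derivable _ _ _ f x v df; rewrite /derivable => dv.
have Dv := deriveE v df; rewrite /derive in Dv.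
have {}dv : h^-1 *: ((f \o shift x) (h *: v) - f x) @[h --> 0^'] --> 'd f x v.
  by rewrite -Dv.
rewrite -lerBrDl; apply/ler_addgt0Pr => e e0.
move/cvgrPdist_lt : dv => /(_ e e0)[r /= r0 rP].
(* Inside the neighbourhood where the quotient is close to its limit, and at
   most 1 to stay in the segment. *)
pose h := Num.min (r / 2) 1.
have h0 : 0 < h by rewrite lt_min ltr01 divr_gt0.
have h1 : h <= 1 by rewrite ge_min lexx orbT.
have hr : h < r by apply: le_lt_trans (_ : h <= r / 2) _; [rewrite ge_min lexx|lra].
have := rP h; rewrite /= sub0r normrN gtr0_norm // gt_eqF // => /(_ hr isT).
have := convex_functionP cf y x (_ : 0 <= h <= 1); rewrite (ltW h0) h1 => /(_ isT).
have -> : h *: y + (1 - h) *: x = h *: v + x.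
  by rewrite scalerBl scale1r scalerBr addrA addrAC.
move=> hc; rewrite -[_ *: _]/(_ * _) ltr_norml => /andP[_ h2].
have : h^-1 * (f (h *: v + x) - f x) <= f y - f x.
  by rewrite ler_pdivrMl //; lra.
by lra.
Qed.

(** Cut the segment into N equal pieces and apply the gradient inequality at
    the far end of each piece. Summing gives c / 2 + c / (2 N), and N is
    arbitrary; a single application would only give c. *)
Lemma convex_descent f x e (c : R) : convex_function [set: V] f ->
  (forall y, differentiable f y) ->
  (forall s, 0 <= s <= 1 -> inner (gradient f (x + s *: e) - gradient f x) e <= s * c) ->
  f (x + e) <= f x + inner (gradient f x) e + c / 2.
Proof.
move=> cf df hc; set G := inner (gradient f x) e.
have key N j : (j <= N.+1)%N -> f (x + (j%:R / N.+1%:R) *: e) <=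
    f x + j%:R / N.+1%:R * G + c * j%:R * (j%:R + 1) / (2 * N.+1%:R ^+ 2).
  set M : R := N.+1%:R; have M0 : 0 < M by rewrite ltr0n.
  elim: j => [|j IH] jN; first by rewrite !mul0r scale0r addr0 mulr0 !mul0r !addr0.
  have {}IH := IH (ltnW jN).
  set s := j.+1%:R / M; set s' := j%:R / M in IH.
  have sM : s = s' + M^-1 by rewrite /s -addn1 natrD mulrDl mul1r.
  have s01 : 0 <= s <= 1.
    by rewrite divr_ge0 ?(ltW M0) //= ler_pdivrMr // mul1r ler_nat.
  have := @gradient_le f (x + s *: e) (x + s' *: e) cf (df _).
  have -> : x + s' *: e - (x + s *: e) = - (M^-1 *: e).
    by rewrite opprD addrACA subrr add0r sM scalerDl opprD addrA subrr add0r.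
  rewrite innerNr innerZr => h1.
  have := hc s s01; rewrite innerBl -/G => h2.
  have h3 : M^-1 * inner (gradient f (x + s *: e)) e <= M^-1 * (s * c + G).
    by rewrite ler_pM2l ?invr_gt0 //; lra.
  have E : f x + s * G + c * j.+1%:R * (j.+1%:R + 1) / (2 * M ^+ 2) =
     (f x + s' * G + c * j%:R * (j%:R + 1) / (2 * M ^+ 2)) + M^-1 * (s * c + G).
    by rewrite /s /s' -addn1 natrD; field; rewrite gt_eqF.
  by rewrite E; apply: le_trans (lerD IH h3); rewrite -lerBlDr.
have {}key N : f (x + e) <= f x + G + c / 2 + (c / 2) * N.+1%:R^-1.
  have := key N N.+1 (leqnn _); rewrite divff ?pnatr_eq0 // scale1r.
  move=> /le_trans; apply; rewrite mul1r le_eqVlt; apply/orP; left.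
  have : (N.+1%:R : R) != 0 by rewrite pnatr_eq0.
  by move: N.+1%:R => M M0; apply/eqP; field.
apply/ler_addgt0Pr => e1 e10.
have d0 : 0 < e1 / (`|c| + 1) by rewrite divr_gt0 // ltr_wpDl.
have [N _ NP] := near_infty_natSinv_lt (PosNum d0).
have {}NP : N.+1%:R^-1 < e1 / (`|c| + 1) := NP N (leqnn N).
apply: le_trans (key N) _; rewrite lerD2l.
move: NP; rewrite ltr_pdivlMr ?ltr_wpDl //.
have i0 : 0 < N.+1%:R^-1 :> R by rewrite invr_gt0.
move: (N.+1%:R^-1) i0 => u u0 h.
apply: le_trans (_ : `|c| * u <= _); last by nra.
rewrite ler_wpM2r ?(ltW u0) //; have := ler_norm c; have := normr_ge0 c; lra.
Qed.

Lemma sqr_sum_le (m : nat) (a : nat -> R) :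
  (\sum_(j < m) a j) ^+ 2 <= m%:R * \sum_(j < m) a j ^+ 2.
Proof.
elim: m => [|m IH]; first by rewrite !big_ord0 expr0n mul0r.
rewrite !big_ord_recr /= -natr1.
set S := \sum_(_ < _) _ in IH *; set T := \sum_(_ < _) _ in IH *.
have [m0|m0] := posnP m.
  by rewrite /S /T; rewrite m0 !big_ord0; lra.
have m1 : (0 : R) < m%:R by rewrite ltr0n.
have h : 0 <= (S - m%:R * a m) ^+ 2 by exact: sqr_ge0.
rewrite -subr_ge0 -(pmulr_rge0 _ m1).
have : 0 <= (1 + m%:R) * (m%:R * T - S ^+ 2) + (S - m%:R * a m) ^+ 2.
  by rewrite addr_ge0 // mulr_ge0 ?subr_ge0 // addr_ge0.
by congr (_ <= _); ring.
Qed.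

(** The linearisation is always taken at the first point of the chain. Each
    move costs its own quadratic term and the product of its length with the
    drift of the gradient accumulated so far; together these complete the
    square of the sum. *)
Lemma gradient_chain f (y : nat -> V) (eps : nat -> R) (Lr : R) (m : nat) :
  0 <= Lr ->
  (forall j, (j < m)%N -> `|y j.+1 - y j| <= eps j) ->
  (forall j, (j < m)%N ->
     `|gradient f (y j.+1) - gradient f (y j)| <= Lr * eps j) ->
  (forall j, (j < m)%N -> f (y j.+1) <=
     f (y j) + inner (gradient f (y j)) (y j.+1 - y j) + Lr / 2 * eps j ^+ 2) ->
  `|gradient f (y m) - gradient f (y 0)| <= Lr * \sum_(j < m) eps j /\
  f (y m) <= f (y 0) + inner (gradient f (y 0)) (y m - y 0)
             + Lr / 2 * (\sum_(j < m) eps j) ^+ 2.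
Proof.
move=> Lr0; elim: m => [|m IH] h1 h2 h3.
  by rewrite !big_ord0 !subrr normr0 inner0r expr0n /= !mulr0 !addr0.
have [|||I1 I2] := IH; first by move=> j jm; apply: h1; exact: ltnW.
- by move=> j jm; apply: h2; exact: ltnW.
- by move=> j jm; apply: h3; exact: ltnW.
have {}h1 := h1 m (ltnSn m); have {}h2 := h2 m (ltnSn m); have {}h3 := h3 m (ltnSn m).
rewrite !big_ord_recr /=; set S := \sum_(_ < _) _ in I1 I2 *; split.
  rewrite -(subrKA (gradient f (y m))); apply: le_trans (ler_normD _ _) _.
  by rewrite mulrDr addrC lerD.
have e0 : 0 <= eps m := le_trans (normr_ge0 _) h1.
have h4 : inner (gradient f (y m) - gradient f (y 0)) (y m.+1 - y m) <= Lr * S * eps m.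
  by apply: le_trans (inner_le_norm _ _) _; apply: ler_pM.
rewrite innerBl in h4.
rewrite -(subrKA (y m)) innerDr; move: h3 I2 h4.
move: (f (y m.+1)) (f (y m)) (f (y 0)) (inner _ _) (inner _ _) (inner _ _).
by clear => *; lra.
Qed.

End gradient.

(** * Single-block moves in a direct sum *)

Section max_min_ord.
Context (R : realType) (n : nat).
Implicit Types a : 'I_n.+1 -> R.

Lemma le_max_ord a i : a i <= max_ord a.
Proof. exact: le_bigmax. Qed.

Lemma min_ord_le a i : min_ord a <= a i.
Proof. exact: bigmin_le. Qed.

Lemma min_ord_gt0 a : (forall i, 0 < a i) -> 0 < min_ord a.
Proof. by move=> a0; rewrite /min_ord; elim/big_rec: _ => // i x _ x0; rewrite lt_min a0. Qed.

End max_min_ord.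

Section prox_step.
Context (R : realType) (V : hilbertType R) (g : V -> \bar R) (gamma : R).
Hypotheses (g_proper : proper_function g) (g_convex : econvex g)
  (g_lsc : lower_semicontinuous g) (gamma0 : 0 < gamma).

Let phi := fun u => (gamma%:E * g u)%E.

Let phi_proper : proper_function phi.
Proof.
split=> [x|].
  move: (g_proper.1 x); rewrite /phi; case: (g x) => [r _| _|//].
    by rewrite -EFinM ltNyr.
  by rewrite gt0_muley ?lte_fin.
have [x xoo] := g_proper.2; exists x; rewrite /phi.
by move: (g_proper.1 x) xoo; case: (g x) => // r _ _; rewrite -EFinM ltry.
Qed.

Let phi_convex : econvex phi.
Proof.
move=> x y t t01; rewrite /phi.
apply: le_trans (lee_wpmul2l _ (g_convex x y t01)) _; first by rewrite lee_fin ltW.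
rewrite muleDr ?muleA ?fin_numM //.
  by rewrite !(muleC gamma%:E).
have N a : (0 <= a)%R -> forall u, (-oo < a%:E * g u)%E.
  move=> a0 u; move: (g_proper.1 u); case: (g u) => [r _| _|//].
    by rewrite -EFinM ltNyr.
  move: a0; rewrite le_eqVlt => /predU1P[<-|a0]; first by rewrite mul0e.
  by rewrite gt0_muley ?lte_fin.
case/andP: t01 => t0 t1; have t1' : 0 <= 1 - t by lra.
by move: (N _ t0 x) (N _ t1' y); case: (t%:E * _)%E; case: ((1 - t)%:E * _)%E.
Qed.

Let phi_lsc : lower_semicontinuous phi.
Proof.
move=> x a ha.
have [|U Ux hU] := g_lsc (x := x) (a := gamma^-1 * a).
  move: ha; rewrite /phi; move: (g_proper.1 x); case: (g x) => [r _| _ _|//]; last exact: ltry.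
  by rewrite -EFinM !lte_fin ltr_pdivrMl.
exists U => // y /hU; rewrite /phi; move: (g_proper.1 y); case: (g y) => [r _| _ _|//].
  by rewrite -EFinM !lte_fin ltr_pdivrMl.
by rewrite gt0_muley ?lte_fin // ltry.
Qed.

Lemma prox_step_fin_num x : g (prox phi x) \is a fin_num.
Proof.
have := prox_fin_num x phi_proper phi_convex phi_lsc.
rewrite /phi; case: (g _) (g_proper.1 (prox phi x)) => // _.
by rewrite gt0_muley ?lte_fin.
Qed.

(** The optimality condition of the proximal step for gamma g, taken at the
    forward point x - gamma v and divided by gamma. *)
Lemma prox_step_le x v z : g z \is a fin_num ->
  let q := prox phi (x - gamma *: v) in
  fine (g q) + gamma^-1 * inner (x - q) (z - q) - inner v (z - q) <= fine (g z).
Proof.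
move=> gz; cbv zeta; set q := prox phi _.
have := prox_subgradient (x - gamma *: v) z phi_proper phi_convex phi_lsc.
have := prox_step_fin_num (x - gamma *: v); rewrite -/q /phi.
move: gz; case: (g z) => // b _; case: (g q) => // a _.
rewrite -!EFinM -EFinD lee_fin /= addrAC innerBl innerZl => h.
rewrite -(ler_pM2l gamma0); apply: le_trans h.
by rewrite mulrBr mulrDr mulrA divff ?gt_eqF // mul1r; lra.
Qed.

End prox_step.

Section blocks.
Context (R : realType) (n : nat) (H : 'I_n.+1 -> hilbertType R).
Implicit Types (x y z v : dsum H).

Lemma dsum_innerE x y : inner x y = \sum_i inner (x i) (y i).
Proof. by []. Qed.

Lemma dsum_sqnormE x : `|x| ^+ 2 = \sum_i `|x i| ^+ 2.
Proof. by rewrite -inner_normE dsum_innerE; apply: eq_bigr => i _; rewrite inner_normE. Qed.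

Lemma dsumD x y i : (x + y) i = x i + y i. Proof. by []. Qed.
Lemma dsumB x y i : (x - y) i = x i - y i. Proof. by []. Qed.
Lemma dsumZ (a : R) x i : (a *: x) i = a *: x i. Proof. by []. Qed.

Lemma set_block_in x i (u : H i) : set_block x i u i = u.
Proof. exact: dfwithin. Qed.

Lemma set_block_out x i (u : H i) j : j != i -> set_block x i u j = x j.
Proof. by move=> ji; apply: dfwithout; rewrite eq_sym. Qed.

Lemma dsum_ext x y : (forall i, x i = y i) -> x = y.
Proof. by move=> xy; apply: functional_extensionality_dep. Qed.

Lemma set_block_id x i : set_block x i (x i) = x.
Proof.
apply: dsum_ext => j; have [->|ji] := eqVneq j i; first by rewrite set_block_in.
by rewrite set_block_out.
Qed.

Lemma sum_set_block (h : forall j, H j -> R) x i (u : H i) :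
  \sum_j h j (set_block x i u j) = \sum_j h j (x j) + (h i u - h i (x i)).
Proof.
rewrite (bigD1 i) //= [in RHS](bigD1 i) //= set_block_in.
rewrite (eq_bigr (fun j => h j (x j))); first by ring.
by move=> j ji; rewrite set_block_out.
Qed.

Lemma inner_set_block v x i (u : H i) :
  inner v (set_block x i u - x) = inner (v i) (u - x i).
Proof.
rewrite dsum_innerE (sum_set_block (fun j w => inner (v j) (w - x j))).
by rewrite subrr inner0r subr0 big1 ?add0r // => j _; rewrite subrr inner0r.
Qed.

Lemma norm_set_block x i (u : H i) : `|set_block x i u - x| = `|u - x i|.
Proof.
apply/eqP; rewrite -(@eqrXn2 _ 2) // -!inner_normE inner_set_block.
by rewrite [X in inner X _](_ : _ = u - x i) // -[in RHS](set_block_in x u).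
Qed.

Variable f : dsum H -> R.
Hypotheses (f_convex : convex_function [set: dsum H] f)
  (f_diff : forall x : dsum H, differentiable f x).

(** Only the modulus of continuity of the i-th partial gradient in the i-th
    variable matters, because the move is supported in that block. *)
Lemma block_descent i (L : R) x (u : H i) :
  (forall w : H i, `|gradient f (set_block x i w) i - gradient f x i| <= L * `|w - x i|) ->
  f (set_block x i u) <= f x + inner (gradient f x i) (u - x i) + L / 2 * `|u - x i| ^+ 2.
Proof.
move=> hL; rewrite -inner_set_block -[X in f X](subrK x) addrC.
rewrite (_ : L / 2 * _ = L * `|u - x i| ^+ 2 / 2); last by rewrite mulrAC.
apply: convex_descent => // s /andP[s0 s1].
have -> : x + s *: (set_block x i u - x) = set_block x i (x i + s *: (u - x i)).
  apply: dsum_ext => j; rewrite dsumD dsumZ dsumB.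
  have [->|ji] := eqVneq j i; first by rewrite 2!(set_block_in x).
  by rewrite 2!(set_block_out x _ ji) subrr scaler0 addr0.
rewrite inner_set_block; apply: le_trans (inner_le_norm _ _) _.
have := hL (x i + s *: (u - x i)); rewrite [x i + _ *: _]addrC addrK normrZ ger0_norm // => h.
rewrite expr2 mulrA mulrA -[s * L]mulrC -[L * s * _]mulrA; exact: ler_wpM2r.
Qed.

End blocks.

(** * One step of the algorithm, averaged over the selected block *)

Section objective.
Context (R : realType) (n : nat) (H : 'I_n.+1 -> hilbertType R).
Variables (f : dsum H -> R) (g : forall i, H i -> \bar R).
Arguments g : clear implicits.

Definition domg (x : dsum H) : Prop := forall i, g i (x i) \is a fin_num.

(** Real counterpart of the objective, meaningful on [domg] only. *)
Definition objr (x : dsum H) : R := f x + \sum_i fine (g i (x i)).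

Lemma objectiveE x : domg x -> objective f g x = (objr x)%:E.
Proof.
move=> dx; rewrite /objective /objr EFinD -sumEFin; congr (_ + _)%E.
by apply: eq_bigr => i _; rewrite fineK.
Qed.

End objective.

Section weighted_norm.
Context (R : realType) (n : nat) (H : 'I_n.+1 -> hilbertType R) (gamma p : 'I_n.+1 -> R).
Hypotheses (gamma_gt0 : forall i, 0 < gamma i) (p_gt0 : forall i, 0 < p i).

Lemma sqr_normWE (x : dsum H) :
  normW gamma p x ^+ 2 = \sum_i (gamma i * p i)^-1 * `|x i| ^+ 2.
Proof.
by rewrite sqr_sqrtr // sumr_ge0 // => i _; rewrite mulr_ge0 ?exprn_ge0 // invr_ge0 mulr_ge0 // ltW.
Qed.

End weighted_norm.

Section one_step.
Context (R : realType) (n : nat) (H : 'I_n.+1 -> hilbertType R).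
Variables (f : dsum H -> R) (g : forall i, H i -> \bar R).
Arguments g : clear implicits.
Hypotheses (f_convex : convex_function [set: dsum H] f)
  (f_diff : forall x : dsum H, differentiable f x)
  (g_proper : forall i, proper_function (g i))
  (g_convex : forall i, econvex (g i))
  (g_lsc : forall i, lower_semicontinuous (g i)).
Variables (Lres : R) (L gamma p : 'I_n.+1 -> R) (tau : nat).
Hypotheses (Lres_gt0 : 0 < Lres)
  (grad_coord_lip : forall (x : dsum H) (i : 'I_n.+1),
     (L i).-lipschitz (fun u => gradient f (set_block x i u) i))
  (gamma_gt0 : forall i, 0 < gamma i) (p_gt0 : forall i, 0 < p i)
  (p_sum : \sum_i p i = 1).

Let pmax := max_ord p.
Let pmin := min_ord p.
Let Q := Lres * (pmax / Num.sqrt pmin).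
Let delta := max_ord (fun j => L j * gamma j
    + 2 * gamma j * tau%:R * Lres * (pmax / Num.sqrt pmin)).

Let pmin_gt0 : 0 < pmin. Proof. exact: min_ord_gt0. Qed.
Let pmax_gt0 : 0 < pmax. Proof. exact: lt_le_trans (p_gt0 ord0) (le_max_ord p ord0). Qed.
Let pmin_le_pmax : pmin <= pmax.
Proof. exact: le_trans (min_ord_le p ord0) (le_max_ord p ord0). Qed.
Let sqrt_gt0 : 0 < Num.sqrt pmin. Proof. by rewrite sqrtr_gt0. Qed.
Let Q_gt0 : 0 < Q. Proof. by rewrite mulr_gt0 // divr_gt0. Qed.

Variables (x xh : dsum H) (eps : nat -> R).
Hypotheses (x_dom : domg g x)
  (chain1 : `|gradient f x - gradient f xh| <= Lres * \sum_(t < tau) eps t)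
  (chain2 : f x <= f xh + inner (gradient f xh) (x - xh)
              + Lres / 2 * (\sum_(t < tau) eps t) ^+ 2).

Definition fb_step (y v : dsum H) (i : 'I_n.+1) : H i :=
  prox (fun u => ((gamma i)%:E * g i u)%E) (y i - gamma i *: v i).

Let v := gradient f xh.
Let xb i := fb_step x v i.
Let D i := x i - xb i.
Let x' i := set_block x i (xb i).
Let T i := fine (g i (x i)) - fine (g i (xb i)) + inner (v i) (D i).
Let d i := (gamma i)^-1 * `|D i| ^+ 2.
Let E2 := \sum_(t < tau) eps t ^+ 2.
Let N := \sum_i p i * `|D i| ^+ 2.
Let S := \sum_i p i * d i.
Let EF := \sum_i p i * objr f g (x' i).

Lemma fb_step_fin_num i : g i (xb i) \is a fin_num.
Proof. exact: prox_step_fin_num. Qed.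

Lemma fb_step_dom i : domg g (x' i).
Proof.
move=> j; rewrite /x'; have [ji|ji] := eqVneq j i.
  by rewrite ji set_block_in fb_step_fin_num.
by rewrite set_block_out.
Qed.

(** T i is the decrease of the i-th nonsmooth term corrected by the delayed
    linear term; the optimality condition at the current point bounds it from
    below. *)
Let T_ge i : d i <= T i.
Proof.
have := prox_step_le (g_proper i) (@g_convex i) (@g_lsc i) (gamma_gt0 i) (x i) (v i) (x_dom i).
by cbv zeta; rewrite -/(fb_step x v i) -/(xb i) -/(D i) inner_normE -/(d i) /T; lra.
Qed.

Let grad_coord i (w : H i) :
  `|gradient f (set_block x i w) i - gradient f x i| <= L i * `|w - x i|.
Proof. by have := @grad_coord_lip x i (w, x i) (conj I I); rewrite /= set_block_id. Qed.

Let F_block i : objr f g (x' i) <=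
  objr f g x - T i + inner ((v - gradient f x) i) (D i) + L i / 2 * `|D i| ^+ 2.
Proof.
rewrite /objr /x' (sum_set_block (fun j u => fine (g j u))).
have := block_descent f_convex f_diff (xb i) (@grad_coord i).
rewrite -(distrC (x i)) -/(D i) -(opprB (x i)) -/(D i) innerNr dsumB innerBl /T.
move: (f _) (f x) (\sum_j _) (fine _) (fine _) (inner _ _) (inner _ _) (L i / 2 * _).
by move=> *; lra.
Qed.

Let sq_eps : (\sum_(t < tau) eps t) ^+ 2 <= tau%:R * E2.
Proof. exact: sqr_sum_le. Qed.

Let N_ge0 : 0 <= N.
Proof. by apply: sumr_ge0 => i _; rewrite mulr_ge0 ?exprn_ge0 // ltW. Qed.
Let d_ge0 i : 0 <= d i.
Proof. by rewrite mulr_ge0 ?exprn_ge0 // invr_ge0 ltW. Qed.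
Let S_ge0 : 0 <= S.
Proof. by apply: sumr_ge0 => i _; rewrite mulr_ge0 // ltW. Qed.
Let E2_ge0 : 0 <= E2.
Proof. by apply: sumr_ge0 => i _; exact: sqr_ge0. Qed.

(** This is where the factor pmax / sqrt pmin of the stepsize condition is
    used, through pmin <= pmax. *)
Let QE : Lres ^+ 2 * pmax <= Q ^+ 2.
Proof.
rewrite /Q exprMn ler_wpM2l ?sqr_ge0 // expr_div_n sqr_sqrtr ?(ltW pmin_gt0) //.
by rewrite ler_pdivlMr // expr2 ler_wpM2l // ltW.
Qed.

(** Error due to the delayed gradient. Young's inequality is applied block by
    block, with weights such that the squared gradient error and the squared
    displacements come with the same factor Q / 2. *)
Let cross : \sum_i p i * inner ((v - gradient f x) i) (D i) <= Q / 2 * (E2 + tau%:R * N).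
Proof.
set a := v - gradient f x.
have a_le : `|a| <= Lres * \sum_(t < tau) eps t by rewrite /a distrC.
have [t0|t0] := posnP tau.
  have a0 : a = 0 by apply/eqP; rewrite -normr_le0 (le_trans a_le) // t0 big_ord0 mulr0.
  rewrite big1 => [|i _]; last by rewrite a0 [X in inner X _](_ : _ = 0) // inner0l mulr0.
  by rewrite mulr_ge0 ?divr_ge0 ?(ltW Q_gt0) // addr_ge0 // mulr_ge0.
have tR : (0 : R) < tau%:R by rewrite ltr0n.
(* Young's parameter: r pmax / 2 = tau Q / 2 is the wanted factor of N, and QE
   bounds the other one by Q / 2. *)
pose r := tau%:R * Q / pmax.
have r0 : 0 < r by rewrite divr_gt0 // mulr_gt0.
apply: (@le_trans _ _ (\sum_i ((2 * r)^-1 * `|a i| ^+ 2 + tau%:R * Q / 2 * (p i * `|D i| ^+ 2)))).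
  apply: ler_sum => i _.
  have h1 : p i * inner (a i) (D i) <= `|a i| * (p i * `|D i|).
    by rewrite mulrCA ler_pM2l //; exact: inner_le_norm.
  apply: le_trans h1 _.
  have h2 : 0 <= (2 * r)^-1 * (`|a i| - r * (p i * `|D i|)) ^+ 2.
    by rewrite mulr_ge0 ?sqr_ge0 // invr_ge0 mulr_ge0 // ltW.
  have h3 : (2 * r)^-1 * (`|a i| - r * (p i * `|D i|)) ^+ 2 =
    (2 * r)^-1 * `|a i| ^+ 2 - `|a i| * (p i * `|D i|) + r / 2 * p i * (p i * `|D i| ^+ 2).
    by field; rewrite gt_eqF.
  have h4 : r / 2 * p i * (p i * `|D i| ^+ 2) <= tau%:R * Q / 2 * (p i * `|D i| ^+ 2).
    apply: ler_wpM2r; first by rewrite mulr_ge0 ?exprn_ge0 // ltW.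
    rewrite [leRHS](_ : _ = r / 2 * pmax); last by rewrite /r; field; rewrite gt_eqF.
    by rewrite ler_pM2l ?(divr_gt0 r0) //; exact: le_max_ord.
  by rewrite h3 in h2; move: h2 h4; set u := (2 * r)^-1 * _; lra.
rewrite big_split /= -!mulr_sumr -dsum_sqnormE -/N.
have h1 : `|a| ^+ 2 <= Lres ^+ 2 * (tau%:R * E2).
  apply: (@le_trans _ _ ((Lres * \sum_(t < tau) eps t) ^+ 2)).
    by apply: lerXn2r; rewrite ?nnegrE ?(le_trans (normr_ge0 a) a_le).
  by rewrite exprMn ler_wpM2l ?sqr_ge0.
have h2 : (2 * r)^-1 * `|a| ^+ 2 <= Q / 2 * E2.
  rewrite ler_pdivrMl ?(mulr_gt0 _ r0) //; apply: le_trans h1 _.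
  rewrite [leRHS](_ : _ = (Q ^+ 2 * (tau%:R * E2)) / pmax); last first.
    by rewrite /r; field; rewrite gt_eqF.
  by rewrite ler_pdivlMr // mulrAC ler_wpM2r // mulr_ge0 // ltW.
by rewrite mulrDr mulrA; move: h2; set u := (2 * r)^-1 * _; lra.
Qed.

Let delta_le i : L i * gamma i + 2 * gamma i * (tau%:R * Q) <= delta.
Proof.
have := le_max_ord (fun j => L j * gamma j
    + 2 * gamma j * tau%:R * Lres * (pmax / Num.sqrt pmin)) i.
by rewrite -/delta /= /Q !mulrA.
Qed.

Let gam_d i : `|D i| ^+ 2 = gamma i * d i.
Proof. by rewrite /d mulrA divff ?mul1r // gt_eqF. Qed.

Let descentA : EF <= objr f g x - \sum_i p i * T i
  + Q / 2 * (E2 - tau%:R * N) + delta / 2 * S.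
Proof.
have h : EF <= \sum_i (p i * objr f g x - p i * T i
    + p i * inner ((v - gradient f x) i) (D i)
    + (delta / 2 * (p i * d i) - tau%:R * Q * (p i * `|D i| ^+ 2))).
  apply: ler_sum => i _; rewrite -[X in _ <= X](_ : p i * (objr f g x - T i
    + inner ((v - gradient f x) i) (D i) + (delta / 2 * d i - tau%:R * Q * `|D i| ^+ 2)) = _); last by ring.
  rewrite ler_pM2l //; apply: le_trans (F_block i) _; rewrite lerD2l gam_d.
  have := ler_wpM2r (d_ge0 i) (delta_le i); lra.
move: h; rewrite !big_split /= -mulr_suml p_sum mul1r !sumrN -!mulr_sumr -/S -/N.
move: cross; lra.
Qed.

(** Mean decrease of the objective. The term in the past increments and the
    term in the new one are those that the lag turns into a telescoping sum. *)
Lemma step_objective :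
  (2 - delta) / 2 * S <= objr f g x - EF + Q / 2 * E2 - Q / 2 * (tau%:R * N).
Proof.
have h : S <= \sum_i p i * T i by apply: ler_sum => i _; rewrite ler_pM2l.
by move: descentA; lra.
Qed.

(** If the displacement of a block is nonzero then its Lipschitz constant is
    nonnegative, so that the delay part of delta alone is at most delta. In a
    trivial block the constant may be negative, but then there is no
    displacement. *)
Lemma step_increment : 2 * (tau%:R * Q) * N <= delta * S.
Proof.
rewrite !mulr_sumr; apply: ler_sum => i _.
rewrite !(mulrCA _ (p i)) ler_pM2l //.
have [D0|D0] := eqVneq (D i) 0; first by rewrite /d D0 normr0 expr0n /= !mulr0.
have Li : 0 <= L i.
  have := le_trans (normr_ge0 _) (@grad_coord i (xb i)).
  by rewrite -normrN opprB pmulr_lge0 // normr_gt0.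
rewrite gam_d [_ * (gamma i * _)]mulrA; apply: ler_wpM2r => //.
apply: le_trans (delta_le i).
have : 0 <= L i * gamma i by rewrite mulr_ge0 // ltW.
lra.
Qed.

Hypothesis delta_lt2 : delta < 2.

Let M := Num.max 1 (2 - delta)^-1.

Let Dp := objr f g x - EF + Q / 2 * E2 - Q / 2 * (tau%:R * N).

Let Dp_ge0 : 0 <= Dp.
Proof. by apply: le_trans step_objective; rewrite mulr_ge0 // divr_ge0 // subr_ge0 ltW. Qed.

(** The mean only controls a sum weighted by p_i. Dividing by pmin removes the
    weights since each term is nonnegative. The maximum with 1 comes from the
    sign of delta - 1. *)
Let sumT : \sum_i (2 * T i - d i) <= 2 * (M / pmin) * Dp.
Proof.
have e0 : 0 < 2 - delta by rewrite subr_gt0.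
rewrite -(ler_pM2l pmin_gt0).
rewrite [leRHS](_ : _ = 2 * (M * Dp)); last by field; rewrite gt_eqF.
apply: (@le_trans _ _ (\sum_i p i * (2 * T i - d i))).
  rewrite mulr_sumr; apply: ler_sum => i _; apply: ler_wpM2r; last exact: min_ord_le.
  by have := T_ge i; have := d_ge0 i; lra.
rewrite (eq_bigr (fun i => 2 * (p i * T i) - p i * d i)); last by move=> i _; ring.
rewrite big_split /= sumrN -mulr_sumr -/S.
have A1 := descentA; have A2 := step_objective; rewrite -/Dp in A2.
have A3 : \sum_i p i * T i <= Dp + delta / 2 * S by rewrite /Dp; lra.
have [d1|d1] := leP delta 1.
  have : Dp <= M * Dp by rewrite ler_peMl // le_max lexx.
  have : 0 <= (1 - delta) * S by rewrite mulr_ge0 //; lra.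
  lra.
have M1 : (2 - delta)^-1 * Dp <= M * Dp by rewrite ler_wpM2r // le_max lexx orbT.
have M2 : S <= 2 * ((2 - delta)^-1 * Dp).
  by rewrite mulrCA mulrA -mulrA ler_pdivlMl //; lra.
have M3 : Dp = (2 - delta) * ((2 - delta)^-1 * Dp) by rewrite mulrA divff ?mul1r // gt_eqF.
move: M1 M2 M3; set w := (2 - delta)^-1 * Dp => M1 M2 M3.
have := ler_wpM2l (_ : 0 <= delta - 1) M2 => /(_ (ltac:(lra))).
lra.
Qed.

(** The weights 1 / (gamma_i p_i) turn the mean over the selected block into a
    plain sum over all blocks. The sum of the delayed linear terms is compared
    with f z - f x by convexity at the delayed point and by the chain estimate
    from there to x. *)
Lemma step_distance z : domg g z ->
  \sum_i p i * normW gamma p (x' i - z) ^+ 2 <=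
  normW gamma p (x - z) ^+ 2 + 2 * (objr f g z - objr f g x)
  + 2 * (M / pmin) * Dp + tau%:R * Lres * E2.
Proof.
move=> z_dom.
have E i : p i * normW gamma p (x' i - z) ^+ 2 =
    p i * normW gamma p (x - z) ^+ 2 +
    (gamma i)^-1 * (`|xb i - z i| ^+ 2 - `|x i - z i| ^+ 2).
  rewrite !sqr_normWE // (sum_set_block (fun j u => (gamma j * p j)^-1 * `|u - z j| ^+ 2)).
  by rewrite mulrDr; congr (_ + _); field; rewrite !gt_eqF.
have B i : (gamma i)^-1 * (`|xb i - z i| ^+ 2 - `|x i - z i| ^+ 2) <=
    (2 * T i - d i) + 2 * (fine (g i (z i)) - fine (g i (x i))) + 2 * inner (v i) (z i - x i).
  have -> : x i - z i = D i + (xb i - z i) by rewrite /D subrKA.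
  rewrite (sqr_normD (D i)).
  have := prox_step_le (g_proper i) (@g_convex i) (@g_lsc i) (gamma_gt0 i) (x i) (v i) (z_dom i).
  cbv zeta; rewrite -/(fb_step x v i) -/(xb i) -/(D i).
  rewrite -(opprB (xb i) (z i)) !innerNr /T -/(d i).
  have -> : z i - x i = - (D i + (xb i - z i)) by rewrite /D subrKA opprB.
  rewrite innerNr (innerDr (v i) (D i)).
  have -> : (gamma i)^-1 * (`|xb i - z i| ^+ 2 - (`|D i| ^+ 2 + 2 * inner (D i) (xb i - z i) + `|xb i - z i| ^+ 2)) = - d i - 2 * ((gamma i)^-1 * inner (D i) (xb i - z i)).
    by rewrite /d; ring.
  rewrite mulrN; set w := (gamma i)^-1 * _; lra.
rewrite (eq_bigr _ (fun i _ => E i)) big_split /= -mulr_suml p_sum mul1r.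
rewrite -!addrA lerD2l; apply: le_trans (ler_sum _ (fun i _ => B i)) _.
rewrite big_split big_split /= -!mulr_sumr.
rewrite [\sum_i (fine (g i (z i)) - _)]sumrB.
have -> : \sum_i inner (v i) (z i - x i) = inner v (z - x) by [].
have h1 := gradient_le z f_convex (f_diff xh); rewrite -/v in h1.
have h2 := chain2; rewrite -/v in h2.
have h3 : inner v (z - x) = inner v (z - xh) - inner v (x - xh).
  by rewrite -innerBr opprB addrA subrK.
have h4 : Lres / 2 * (\sum_(t < tau) eps t) ^+ 2 <= Lres / 2 * (tau%:R * E2).
  by rewrite ler_wpM2l // divr_ge0 // ltW.
have := sumT; rewrite /objr; move: (\sum_i (2 * T i - _)) => sT.
move: (_ * _ * Dp) => r; lra.
Qed.

End one_step.

(** * Delays and the potential that absorbs them *)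

Section lag.
Context (R : realType) (n : nat) (H : 'I_n.+1 -> hilbertType R).
Implicit Types (xs : nat -> dsum H).

(** Length of the t-th most recent increment before time k. Truncated
    subtraction makes it vanish when there is no such increment. *)
Definition past_step xs (k t : nat) : R := `|xs (k - t)%N - xs (k - t.+1)%N|.

(** The weights make the passage from k to k+1 subtract exactly the sum of the
    past squared increments, see lagS. *)
Definition lag (tau : nat) xs (k : nat) : R :=
  \sum_(t < tau) (tau - t)%:R * past_step xs k t ^+ 2.

Lemma lag_ge0 tau xs k : 0 <= lag tau xs k.
Proof. by apply: sumr_ge0 => t _; rewrite mulr_ge0 ?sqr_ge0. Qed.

Lemma lag_le tau xs k : lag tau xs k <= tau%:R * \sum_(t < tau) past_step xs k t ^+ 2.
Proof.
rewrite mulr_sumr; apply: ler_sum => t _.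
by rewrite ler_wpM2r ?sqr_ge0 // ler_nat leq_subr.
Qed.

Lemma lagS tau xs k : lag tau xs k.+1 =
  lag tau xs k - \sum_(t < tau) past_step xs k t ^+ 2
  + tau%:R * `|xs k.+1 - xs k| ^+ 2.
Proof.
rewrite /lag; case: tau => [|m]; first by rewrite !big_ord0 mul0r subrr addr0.
rewrite big_ord_recl /= subn0 {1}/past_step subn0 subn1 /= addrC; congr (_ + _).
rewrite [X in X - _]big_ord_recr [X in _ - X]big_ord_recr /=.
rewrite subSnn mul1r opprD addrACA subrr addr0 -sumrB.
apply: eq_bigr => t _; rewrite /bump /= add1n /past_step !subSS.
by rewrite subSn ?(ltnW (ltn_ord t)) // -natr1; ring.
Qed.

Lemma lag0 tau xs : lag tau xs 0 = 0.
Proof.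
by rewrite /lag big1 // => t _; rewrite /past_step !sub0n subrr normr0 expr0n mulr0.
Qed.

Variable f : dsum H -> R.
Hypotheses (f_convex : convex_function [set: dsum H] f)
  (f_diff : forall x : dsum H, differentiable f x).
Variable Lres : R.
Hypotheses (Lres_gt0 : 0 < Lres)
  (grad_lip : forall (x : dsum H) (i : 'I_n.+1),
     Lres.-lipschitz (fun u => gradient f (set_block x i u))).

Let grad_block x i (w : H i) :
  `|gradient f (set_block x i w) - gradient f x| <= Lres * `|w - x i|.
Proof. by have := @grad_lip x i (w, x i) (conj I I); rewrite /= set_block_id. Qed.

(** Bring the coordinates of the delayed point up to date one time step after
    the other. Each time step moves only the block selected at that time, and
    moves it by no more than the increment of the trajectory. *)
Lemma delayed_chain xs (ik : nat -> 'I_n.+1) (k tau : nat) (dl : 'I_n.+1 -> nat) :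
  (forall h j, j != ik h -> xs h.+1 j = xs h j) -> (forall j, (dl j <= tau)%N) ->
  `|gradient f (xs k) - gradient f (delayed xs k dl)|
    <= Lres * \sum_(t < tau) past_step xs k t /\
  f (xs k) <= f (delayed xs k dl)
    + inner (gradient f (delayed xs k dl)) (xs k - delayed xs k dl)
    + Lres / 2 * (\sum_(t < tau) past_step xs k t) ^+ 2.
Proof.
move=> xsE dl_tau.
(* mid t has the same delays as the delayed point, capped at t. *)
pose mid t : dsum H := fun j => xs (maxn (k - dl j) (k - t)) j.
have mid0 : mid 0%N = xs k.
  by apply: dsum_ext => j; rewrite /mid subn0 (maxn_idPr (leq_subr _ _)).
have midtau : mid tau = delayed xs k dl.
  by apply: dsum_ext => j; rewrite /mid (maxn_idPl (leq_sub2l _ (dl_tau j))).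
have midS t : exists i, exists2 u : H i,
    mid t = set_block (mid t.+1) i u & `|u - mid t.+1 i| <= past_step xs k t.
  exists (ik (k - t.+1)%N), (mid t (ik (k - t.+1)%N)).
    apply: dsum_ext => j; have [->|ji] := eqVneq j (ik (k - t.+1)%N).
      by rewrite set_block_in.
    rewrite (set_block_out _ _ ji) /mid.
    have [kt|tk] := leqP k t.
      have k1 : (k - t.+1 = 0)%N by apply/eqP; rewrite subn_eq0 leqW.
      have k0 : (k - t = 0)%N by apply/eqP; rewrite subn_eq0.
      by rewrite k0 k1.
    rewrite -(subnSK tk); set h := (k - t.+1)%N in ji *.
    have [ah|ah] := leqP (k - dl j) h.
      by rewrite (maxn_idPr (leqW ah)) xsE.
    by rewrite (maxn_idPl ah).
  rewrite /past_step /mid.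
  have [kt|tk] := leqP k t.
    have k1 : (k - t.+1 = 0)%N by apply/eqP; rewrite subn_eq0 leqW.
    have k0 : (k - t = 0)%N by apply/eqP; rewrite subn_eq0.
    by rewrite k0 k1 !subrr !normr0.
  set i := ik _; rewrite -(subnSK tk); set h := (k - t.+1)%N.
  have [ah|ah] := leqP (k - dl i) h.
    rewrite (maxn_idPr (leqW ah)).
    exact: (normr_coord_le (xs h.+1 - xs h)).
  by rewrite (maxn_idPl ah) subrr normr0.
pose y s := mid (tau - s)%N; pose ey s := past_step xs k (tau - s.+1)%N.
have ys s : (s < tau)%N -> exists i, exists2 u : H i,
    y s.+1 = set_block (y s) i u & `|u - y s i| <= ey s.
  move=> st; have [i [u h1 h2]] := midS (tau - s.+1)%N.
  by exists i, u; rewrite /y -(subnSK st).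
have sumE : \sum_(t < tau) past_step xs k t = \sum_(s < tau) ey s.
  by rewrite (reindex_inj rev_ord_inj).
have [|s st|s st|s st|] := @gradient_chain R (dsum H) f y ey Lres tau.
- exact: ltW.
- have [i [u -> h]] := ys s st; by rewrite norm_set_block.
- have [i [u -> h]] := ys s st; apply: le_trans (@grad_block _ _ _) _.
  by rewrite ler_wpM2l // ltW.
- have [i [u -> h]] := ys s st.
  apply: le_trans (block_descent f_convex f_diff u (L := Lres) _) _.
    move=> w; apply: le_trans (@grad_block (y s) i w).
    exact: (normr_coord_le (gradient f (set_block (y s) i w) - gradient f (y s))).
  rewrite inner_set_block lerD2l ler_wpM2l ?divr_ge0 ?(ltW Lres_gt0) //.
  by rewrite lerXn2r // nnegrE ?(le_trans _ h).
by rewrite /y subnn subn0 mid0 midtau sumE.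
Qed.

End lag.

(** The multiple 2 (C + 1) of the decrease of the corrected objective splits
    in two: 2 M / pmin pays for the term of that form in the distance
    inequality, and the rest pays for the new increment that enters the lag
    with weight tau. *)
Lemma potential_arith (R : realType) (Lres pmax pmin delta tau M Q C X : R)
  (Fx Fz EF E2 N S lagk B EB : R) :
  0 < Lres -> 0 < pmin -> pmin <= pmax -> 0 <= tau -> delta < 2 ->
  Q = Lres * (pmax / Num.sqrt pmin) ->
  X = tau * (Num.sqrt pmin * (2 - delta))^-1 * (1 + pmax / Num.sqrt pmin) ->
  C = M / pmin - 1 + X ->
  0 <= S -> lagk <= tau * E2 ->
  (2 - delta) / 2 * S <= Fx - EF + Q / 2 * E2 - Q / 2 * (tau * N) ->
  2 * (tau * Q) * N <= delta * S ->
  EB <= B + 2 * (Fz - Fx)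
    + 2 * (M / pmin) * (Fx - EF + Q / 2 * E2 - Q / 2 * (tau * N)) + tau * Lres * E2 ->
  EB + 2 * (C + 1) * (EF + Q / 2 * (lagk - E2 + tau * N) - Fz)
     + (tau * Lres + Q * tau) * (lagk - E2 + tau * N)
  <= B + 2 * (C + 1) * (Fx + Q / 2 * lagk - Fz) + (tau * Lres + Q * tau) * lagk
     - 2 * (Fx + Q / 2 * lagk - Fz).
Proof.
move=> L0 pm0 pmM tau0 d2 QE XE CE S0 lE h1 h2 h3.
have sq0 : 0 < Num.sqrt pmin by rewrite sqrtr_gt0.
have pM0 : 0 < pmax := lt_le_trans pm0 pmM.
have Q0 : 0 < Q by rewrite QE mulr_gt0 // divr_gt0.
set Dp := Fx - EF + _ - _ in h1 h3.
suff key : (tau * Lres + Q * tau) * (tau * N) <= 2 * X * Dp.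
  have h4 : Q * lagk <= Q * (tau * E2) by rewrite ler_pM2l.
  have C1 : 2 * (C + 1) = 2 * (M / pmin) + 2 * X by rewrite CE; ring.
  rewrite C1; move: h3; set MM := M / pmin => h3.
  have E : (2 * MM + 2 * X) * (EF + Q / 2 * (lagk - E2 + tau * N) - Fz) =
      (2 * MM + 2 * X) * (Fx + Q / 2 * lagk - Fz) - 2 * MM * Dp - 2 * X * Dp.
    by rewrite /Dp; ring.
  rewrite E; lra.
have d0 : 0 < 2 - delta by rewrite subr_gt0.
have a1 : tau * Q * N <= S.
  have : delta * S <= 2 * S by rewrite ler_wpM2r // ltW.
  lra.
have a2 : S <= 2 * ((2 - delta)^-1 * Dp).
  by rewrite mulrCA mulrA -mulrA ler_pdivlMl //; lra.
pose s := Num.sqrt pmin.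
have s2 : s ^+ 2 = pmin by rewrite sqr_sqrtr // ltW.
have LQ : Lres = Q * (s / pmax).
  by rewrite QE -/s; field; rewrite !gt_eqF.
have b1 : s / pmax + 1 <= s^-1 + pmax / pmin.
  apply: lerD; last by rewrite ler_pdivlMr // mul1r.
  by rewrite ler_pdivrMr // ler_pdivlMl // -expr2 s2.
have Dp0 : 0 <= (2 - delta)^-1 * Dp.
  by move: a2; set u := _ * Dp; lra.
have XD : X * Dp = tau * (s^-1 + pmax / pmin) * ((2 - delta)^-1 * Dp).
  by rewrite XE -/s -s2; field; rewrite !gt_eqF.
rewrite -mulrA XD.
have -> : (tau * Lres + Q * tau) * (tau * N) = tau * (s / pmax + 1) * (tau * Q * N).
  by rewrite LQ; ring.
apply: (@le_trans _ _ (tau * (s / pmax + 1) * (2 * ((2 - delta)^-1 * Dp)))).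
  rewrite ler_wpM2l ?(le_trans a1 a2) // mulr_ge0 // addr_ge0 // divr_ge0 ?(ltW pM0) //.
  exact: ltW.
rewrite mulrCA; rewrite ler_pM2l // ler_wpM2r // ler_wpM2l //.
Qed.

(** * Functions of the selection history *)

Lemma Ex_sum d (Omega : measurableType d) (R : realType) (P : probability Omega R)
  (I : Type) (r : seq I) (F : I -> Omega -> R) :
  (forall i, P.-integrable setT (EFin \o F i)) ->
  \int[P]_w (\sum_(i <- r) F i w) = \sum_(i <- r) \int[P]_w F i w.
Proof.
move=> iF; elim: r => [|i r IH].
  rewrite big_nil; under eq_Rintegral do rewrite big_nil.
  by rewrite Rintegral_cst // mul0r.
rewrite big_cons -IH; under eq_Rintegral do rewrite big_cons.
rewrite RintegralD //.
have := @integrable_sum _ _ _ P setT measurableT _ r xpredT (fun i => EFin \o F i) (fun i _ => iF i).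
by congr (_.-integrable _ _); apply/funext => w /=; rewrite sumEFin.
Qed.

Section history.
Context (d : measure_display) (Omega : measurableType d) (R : realType)
  (P : probability Omega R) (n : nat) (p : 'I_n.+1 -> R)
  (ik : nat -> {RV P >-> 'I_n.+1}).

(** Dependence on the first k selections, stated pointwise rather than through
    a sigma-algebra: any pointwise combination of adapted functions is
    adapted, and a real adapted function takes finitely many values, so that
    it is measurable and bounded. *)
Definition adapted (T : Type) (k : nat) (Y : Omega -> T) : Prop :=
  forall w w', (forall j, (j < k)%N -> ik j w = ik j w') -> Y w = Y w'.

Lemma adaptedS T k l (Y : Omega -> T) : (k <= l)%N -> adapted k Y -> adapted l Y.
Proof. by move=> kl aY w w' h; apply: aY => j jk; apply: h; exact: leq_trans kl. Qed.

Lemma adapted_comp T U k (h : T -> U) (Y : Omega -> T) :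
  adapted k Y -> adapted k (fun w => h (Y w)).
Proof. by move=> aY w w' ww'; congr h; exact: aY. Qed.

Lemma adapted_comp2 T1 T2 U k (h : T1 -> T2 -> U) (Y1 : Omega -> T1) (Y2 : Omega -> T2) :
  adapted k Y1 -> adapted k Y2 -> adapted k (fun w => h (Y1 w) (Y2 w)).
Proof. by move=> a1 a2 w w' ww'; rewrite (a1 _ _ ww') (a2 _ _ ww'). Qed.

Definition cyl k (a : nat -> 'I_n.+1) : set Omega :=
  \bigcap_(j in [set` iota 0 k]) (ik j @^-1` [set a j]).

Lemma cylP k a w : cyl k a w <-> forall j, (j < k)%N -> ik j w = a j.
Proof.
split=> [h j jk|h j /=]; first by apply: h; rewrite /= mem_iota.
by rewrite mem_iota; exact: h.
Qed.

Lemma measurable_cyl k a : measurable (cyl k a).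
Proof.
apply: fin_bigcap_measurable; first exact: finite_seq.
by move=> j _; rewrite -[X in measurable X]setTI; exact: measurable_funPT.
Qed.

(** The cylinders of length k form a finite partition on whose cells an
    adapted function is constant. Cells may be empty, whence the arbitrary
    value in phi. *)
Lemma adaptedE k (Y : Omega -> R) : adapted k Y ->
  exists phi : k.-tuple 'I_n.+1 -> R, forall w,
    Y w = \sum_(t : k.-tuple 'I_n.+1) phi t * \1_(cyl k (nth ord0 t)) w.
Proof.
move=> aY.
have /choice[phi phiP] : forall t : k.-tuple 'I_n.+1, exists r : R,
    forall w, cyl k (nth ord0 t) w -> Y w = r.
  move=> t; have [[w0 w0t]|no] := pselect (exists w, cyl k (nth ord0 t) w).
    exists (Y w0) => w /cylP wt; apply: aY => j jk.
    by rewrite wt //; move/cylP : w0t => ->.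
  by exists 0 => w wt; exfalso; apply: no; exists w.
exists phi => w.
pose t0 : k.-tuple 'I_n.+1 := [tuple ik (val j) w | j < k].
have wt0 : cyl k (nth ord0 t0) w.
  by apply/cylP => j jk; rewrite (nth_mktuple _ _ (Ordinal jk)).
rewrite (bigD1 t0) //= indicE mem_set // mulr1 big1 ?addr0 ?(phiP _ _ wt0) // => t tt0.
rewrite indicE memNset ?mulr0 // => /cylP wt.
case/eqP: tt0; apply: eq_from_tnth => j; rewrite !(tnth_nth ord0).
by rewrite -(wt j (ltn_ord j)) (nth_mktuple _ _ j).
Qed.

Lemma adapted_measurable k (Y : Omega -> R) : adapted k Y -> measurable_fun setT Y.
Proof.
move=> /adaptedE[phi /funext ->]; apply: measurable_sum => t.
by apply: measurable_funM => //; apply: measurable_indic; exact: measurable_cyl.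
Qed.

Lemma adapted_integrable k (Y : Omega -> R) : adapted k Y ->
  P.-integrable setT (EFin \o Y).
Proof.
move=> aY; apply: measurable_bounded_integrable => //.
- by rewrite [X in (X < _)%E]probability_setT ltry.
- exact: adapted_measurable aY.
have [phi YE] := adaptedE aY.
exists (\sum_t `|phi t|); split; first exact: num_real.
move=> M hM w _; apply: le_trans (ltW hM); rewrite YE.
apply: le_trans (ler_norm_sum _ _ _) _; apply: ler_sum => t _.
by rewrite normrM ler_piMr // indicE; case: (_ \in _); rewrite ?normr1 ?normr0.
Qed.

Lemma le_Ex k (Y Z : Omega -> R) : adapted k Y -> adapted k Z ->
  (forall w, Y w <= Z w) -> \int[P]_w Y w <= \int[P]_w Z w.
Proof. by move=> aY aZ YZ; apply: le_Rintegral => //; [exact: adapted_integrable aY|exact: adapted_integrable aZ]. Qed.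

Hypotheses (ik_indep : mutually_independent ik)
  (ik_distr : forall k j, P (ik k @^-1` [set j]) = (p j)%:E).

Lemma cyl_prob k a : P (cyl k a) = (\prod_(j <- iota 0 k) p (a j))%:E.
Proof.
rewrite (ik_indep (A := fun j => [set a j])) ?iota_uniq //.
by rewrite -prodEFin; apply: eq_bigr => j _.
Qed.

(** On a cylinder of length k, independence is the product rule for the
    cylinders of length k+1. *)
Lemma Ex_indep k i (Y : Omega -> R) : adapted k Y ->
  \int[P]_w (\1_(ik k @^-1` [set i]) w * Y w) = p i * \int[P]_w Y w.
Proof.
move=> aY; have [phi YE] := adaptedE aY.
pose a' (t : k.-tuple 'I_n.+1) j := if (j < k)%N then nth ord0 t j else i.
have I1 t : P.-integrable setT (EFin \o (\1_(cyl k (nth ord0 t)) : Omega -> R)).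
  by apply: integrable_indic; exact: measurable_cyl.
have I2 t : P.-integrable setT (EFin \o (\1_(cyl k.+1 (a' t)) : Omega -> R)).
  by apply: integrable_indic; exact: measurable_cyl.
have IZ (c : R) (A : set Omega) : measurable A ->
    P.-integrable setT (EFin \o (fun w => c * \1_A w : R)).
  move=> mA; rewrite (_ : _ \o _ = fun w => (c%:E * (\1_A w)%:E)%E) //.
    by apply: integrableZl => //; exact: integrable_indic.
have E1 w : \1_(ik k @^-1` [set i]) w * Y w = \sum_t phi t * \1_(cyl k.+1 (a' t)) w.
  rewrite YE mulr_sumr; apply: eq_bigr => t _; rewrite mulrCA; congr (_ * _).
  rewrite !indicE -natrM mulnb; congr (_ %:R); congr (nat_of_bool _).
  apply/andP/idP => [[/set_mem /= wi /set_mem /cylP wt]|/set_mem /cylP wt].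
    apply/mem_set/cylP => j; rewrite ltnS leq_eqVlt /a' => /predU1P[->|jk].
      by rewrite ltnn.
    by rewrite jk wt.
  split; apply/mem_set; first by have := wt k (ltnSn k); rewrite /a' ltnn.
  by apply/cylP => j jk; rewrite (wt j (ltnW jk)) /a' jk.
under eq_Rintegral do rewrite E1.
rewrite Ex_sum; last by move=> t; apply: IZ; exact: measurable_cyl.
under [X in _ * X]eq_Rintegral do rewrite YE.
rewrite Ex_sum; last by move=> t; apply: IZ; exact: measurable_cyl.
rewrite mulr_sumr; apply: eq_bigr => t _.
rewrite !RintegralZl // mulrCA; congr (_ * _).
have EI (A : set Omega) : measurable A -> \int[P]_w (\1_A w : R) = fine (P A).
  by move=> mA; rewrite /Rintegral integral_indic // setIT.
rewrite !EI; [|exact: measurable_cyl..].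
have iE : iota 0 k.+1 = iota 0 k ++ [:: k] by rewrite -addn1 iotaD.
rewrite !cyl_prob iE big_cat /= big_seq1 {2}/a' ltnn mulrC.
congr (_ * _); apply: eq_big_seq => j; rewrite mem_iota add0n => /andP[_ jk].
by rewrite /a' jk.
Qed.

(** Averaging over the k-th selection given the previous ones: the tower
    property of conditional expectation. *)
Lemma Ex_select k (Z : 'I_n.+1 -> Omega -> R) : (forall i, adapted k (Z i)) ->
  \int[P]_w Z (ik k w) w = \int[P]_w (\sum_i p i * Z i w).
Proof.
move=> aZ; have aI i : adapted k.+1 (fun w => \1_(ik k @^-1` [set i]) w : R).
  move=> w w' /(_ k (ltnSn k)) h; rewrite !indicE; congr (nat_of_bool _)%:R.
  by apply/idP/idP => /set_mem /= wi; apply/mem_set; rewrite /= ?h // -h.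
have -> : (fun w => Z (ik k w) w) = fun w => \sum_i \1_(ik k @^-1` [set i]) w * Z i w.
  apply/funext => w; rewrite (bigD1 (ik k w)) //= big1 ?addr0 => [|i ik_i].
    by rewrite indicE mem_set // mul1r.
  rewrite indicE memNset ?mul0r //= => ik_i'; by rewrite ik_i' eqxx in ik_i.
rewrite Ex_sum; last first.
  by move=> i; apply: (@adapted_integrable k.+1); apply: adapted_comp2 => //; exact: adaptedS (aZ i).
rewrite Ex_sum; last first.
  by move=> i; apply: (@adapted_integrable k); exact: adapted_comp.
apply: eq_bigr => i _; by rewrite (Ex_indep _ (aZ i)) RintegralZl //; exact: adapted_integrable (aZ i).
Qed.

(** Averaging the constant 1. *)
Lemma sum_distr : \sum_i p i = 1.
Proof.
have := @Ex_select 0 (fun _ _ => 1) (fun _ _ _ _ => erefl).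
have PT : fine (P setT) = 1 := congr1 fine (probability_setT P).
rewrite !Rintegral_cst // ![fine _]PT !mulr1 => ->.
by apply: eq_bigr => i _; rewrite mulr1.
Qed.

End history.

(** * Convergence of nonnegative supermartingales *)

Section often_bounded.
Context d (Omega : measurableType d) (R : realType) (P : probability Omega R).

(** By Fatou's lemma the lower limit has finite integral, hence is finite
    almost surely. *)
Lemma ae_often_bounded (U : nat -> Omega -> R) (M : R) :
  (forall k, measurable_fun setT (U k)) -> (forall k w, 0 <= U k w) ->
  (forall k, (\int[P]_w (U k w)%:E <= M%:E)%E) ->
  {ae P, forall w, exists B, forall N, exists k, (N <= k)%N /\ U k w <= B}.
Proof.
move=> mU U0 UM.
have mU' k : measurable_fun setT (EFin \o U k) by apply/measurable_EFinP.
pose h w := limn_einf (fun k => (U k w)%:E).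
have hE w : h w = ereal_sup (range (einfs (fun k => (U k w)%:E))).
  by rewrite /h limn_einf_lim; apply/cvg_lim => //; exact: cvg_einfs_sup.
have h0 w : (0 <= h w)%E.
  rewrite hE; apply: ereal_sup_ge; exists (einfs (fun k => (U k w)%:E) 0%N); first by exists 0%N.
  by apply: le_ereal_inf_tmp => _ [k _ <-]; rewrite lee_fin.
have mh : measurable_fun setT h.
  apply: (emeasurable_fun_cvg (fun k w => einfs (fun k => (U k w)%:E) k)).
    by move=> k; exact: (measurable_fun_einfs mU').
  by move=> w _; rewrite hE; exact: cvg_einfs_sup.
have hM : (\int[P]_w h w <= M%:E)%E.
  apply: le_trans (fatou P measurableT mU' _) _; first by move=> k w _; rewrite lee_fin.
  rewrite limn_einf_lim; apply: lime_le; first exact: is_cvg_einfs.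
  apply: nearW => k; apply: le_trans (UM k).
  by apply: ereal_inf_lbound; exists k => /=.
have ih : P.-integrable setT h.
  apply/integrableP; split => //; apply: le_lt_trans (ltry M).
  by rewrite (eq_integral h) // => w _; rewrite gee0_abs.
apply: filterS (integrable_ae measurableT ih) => w /(_ I) hw.
exists (fine (h w) + 1) => N; apply/not_existsP => no.
have : (h w < (fine (h w) + 1)%:E)%E.
  by rewrite -{1}(fineK hw) lte_fin ltrDl.
rewrite ltNge => /negP; apply; rewrite {2}hE.
apply: ereal_sup_ge; exists (einfs (fun k => (U k w)%:E) N); first by exists N.
apply: le_ereal_inf_tmp => _ [k /= Nk <-]; rewrite lee_fin.
by have := no k; move=> /not_andP[//|/negP]; rewrite -ltNge => /ltW.
Qed.

Lemma ae_bounded (U : nat -> Omega -> R) (M : R) :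
  (forall k, measurable_fun setT (U k)) -> (forall k w, 0 <= U k w) ->
  (forall k w, U k w <= U k.+1 w) ->
  (forall k, (\int[P]_w (U k w)%:E <= M%:E)%E) ->
  {ae P, forall w, exists B, forall k, U k w <= B}.
Proof.
move=> mU U0 Und UM; apply: filterS (ae_often_bounded mU U0 UM) => w [B BP].
exists B => k; have [l [kl lB]] := BP k; apply: le_trans lB.
exact: (@homo_leq _ (U ^~ w) _ (@lexx _ _) (@le_trans _ _) (Und^~ w)).
Qed.

End often_bounded.

Section upcrossing.
Context (R : realType) (a b : R) (v : nat -> R).
Hypotheses (ab : a < b) (v0 : forall k, 0 <= v k) (a0 : 0 <= a).

(** State of the strategy that buys below a and sells above b: whether a
    position is held, and how many upcrossings are complete. *)
Fixpoint crossing (k : nat) : bool * nat :=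
  if k is k'.+1 then
    let: (hold, u) := crossing k' in
    if hold then (if b <= v k then (false, u.+1) else (true, u))
    else (v k <= a, u)
  else (v 0%N <= a, 0%N).

Definition holding k : bool := (crossing k).1.
Definition upcrossings k : nat := (crossing k).2.

Definition gain k : R := \sum_(j < k) (holding j)%:R * (v j.+1 - v j).

(** Each upcrossing earns b - a, and the position held at the end has lost at
    most a because the sequence is nonnegative. *)
Lemma upcrossings_gain k : (b - a) * (upcrossings k)%:R - a <= gain k.
Proof.
suff : (b - a) * (upcrossings k)%:R + (if holding k then v k - a else 0) <= gain k.
  by have := v0 k; case: (holding k); have := a0; lra.
elim: k => [|k IH].
  by rewrite /gain big_ord0 /upcrossings /holding /= mulr0 add0r; case: ifPn => //; rewrite subr_le0.
rewrite /gain big_ord_recr /= -/(gain k); move: IH; rewrite /upcrossings /holding /=.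
case: (crossing k) => [[] u] /= IH.
  by case: ifPn => /= bv; rewrite -?natr1; lra.
by case: ifPn => /= av; lra.
Qed.

Lemma upcrossings_le k : (upcrossings k <= upcrossings k.+1)%N.
Proof. by rewrite /upcrossings /=; case: (crossing k) => [[] u] //=; case: ifP. Qed.

(** Once the number of upcrossings has stopped growing, the strategy either
    holds forever or waits forever. *)
Lemma upcrossings_bounded (B : nat) : (forall k, (upcrossings k <= B)%N) ->
  (exists N, forall k, (N <= k)%N -> a < v k) \/ (exists N, forall k, (N <= k)%N -> v k < b).
Proof.
move=> ub.
have [N0 N0P] : exists N, forall k, (N <= k)%N -> upcrossings k = upcrossings N.
  have nd := @homo_leq _ upcrossings leq leqnn leq_trans upcrossings_le.
  have : exists m, exists N, upcrossings N = m by exists (upcrossings 0), 0%N.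
  pose Pm m := `[< exists N, upcrossings N = m >].
  move=> exm; have exP : exists m, Pm m by have [m mP] := exm; exists m; apply/asboolP.
  have ubP m : Pm m -> (m <= B)%N by move=> /asboolP[N <-].
  case: (ex_maxnP exP ubP) => m /asboolP[N Nm] mP.
  exists N => k Nk; apply/eqP; rewrite eqn_leq (nd _ _ Nk) andbT Nm.
  by apply: mP; apply/asboolP; exists k.
have hN k : (N0 <= k)%N -> holding k -> holding k.+1 /\ v k.+1 < b.
  move=> Nk; have := N0P k.+1 (leqW Nk); rewrite -(N0P k Nk).
  rewrite /upcrossings /holding /=; case: (crossing k) => [[] u] //=.
  by case: (leP b (v k.+1)) => //= _ /eqP; rewrite gtn_eqF.
have [[N1 [N01 hN1]]|no] := pselect (exists N, (N0 <= N)%N /\ holding N).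
  right; exists N1.+1 => k; elim: k => [//|k IH].
  have hk : forall k, (N1 <= k)%N -> holding k.
    move=> j; elim: j => [|j IHj]; first by rewrite leqn0 => /eqP <-.
    rewrite leq_eqVlt => /predU1P[<- //|]; rewrite ltnS => Nj.
    by have [] := hN j (leq_trans N01 Nj) (IHj Nj).
  by rewrite ltnS => Nk; have [] := hN k (leq_trans N01 Nk) (hk k Nk).
left; exists N0.+1 => -[//|k]; rewrite ltnS => Nk.
have nk j : (N0 <= j)%N -> holding j = false.
  by move=> Nj; apply/negP => hj; apply: no; exists j.
have := nk _ (leqW Nk); have := nk _ Nk; rewrite /holding /=.
by case: (crossing k) => [[] u] //= _ /negbT; rewrite -ltNge.
Qed.

End upcrossing.

(** Look at the grid of mesh 1 / (j+1). The smallest grid point that is not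
    eventually exceeded traps the sequence in an interval of two cells; it
    exists because the sequence does not tend to infinity. *)
Lemma cvg_of_crossings (R : realType) (v : nat -> R) :
  (forall k, 0 <= v k) -> (exists B, forall N, exists k, (N <= k)%N /\ v k <= B) ->
  (forall i j : nat,
    (exists N, forall k, (N <= k)%N -> i%:R / j.+1%:R < v k) \/
    (exists N, forall k, (N <= k)%N -> v k < i.+1%:R / j.+1%:R)) ->
  cvgn v.
Proof.
move=> v0 [B BP] cr; apply: cauchy_cvg; apply: cauchy_exP => e e0.
have [j _ jP] := near_infty_natSinv_lt (PosNum (divr_gt0 e0 (ltr0n R 2))).
have {}jP : j.+1%:R^-1 < e / 2 := jP j (leqnn j).
set m := j.+1%:R^-1 in jP; have m0 : 0 < m by rewrite invr_gt0.
pose above i := `[< exists N, forall k, (N <= k)%N -> i%:R / j.+1%:R < v k >].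
have exi : exists i, ~~ above i.
  have [i iB] : exists i : nat, B < i%:R * m.
    exists (Num.bound `|B / m|); rewrite -ltr_pdivrMr //.
    by apply: le_lt_trans (ler_norm _) _; exact: archi_boundP.
  exists i; apply/asboolPn => -[N NP]; have [k [Nk kB]] := BP N.
  by have := NP k Nk; rewrite ltNge (le_trans kB) // ltW.
case: (ex_minnP exi) => i /asboolPn nai imin.
have [N1 N1P] : exists N, forall k, (N <= k)%N -> v k < i.+1%:R / j.+1%:R.
  by have [] := cr i j.
have [N2 N2P] : exists N, forall k, (N <= k)%N -> i%:R * m - m <= v k.
  case: i imin {nai N1P} => [|i] imin; first by exists 0%N => k _; have := v0 k; lra.
  have : above i by apply: contraT => /imin; rewrite ltnn.
  move=> /asboolP[N NP]; exists N => k /NP/ltW; rewrite -/m -natr1; lra.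
exists (i%:R * m); exists (maxn N1 N2) => // k /=; rewrite geq_max => /andP[k1 k2].
rewrite -ball_normE /= ltr_norml.
have := N1P k k1; rewrite -/m -natr1; have := N2P k k2.
by move=> h1 h2; apply/andP; split; lra.
Qed.

Section supermartingale.
Context (d : measure_display) (Omega : measurableType d) (R : realType)
  (P : probability Omega R) (n : nat) (ik : nat -> {RV P >-> 'I_n.+1}).

(** The supermartingale property is stated by testing against nonnegative
    functions of the past, which applies to the indicator of the event that
    the strategy holds. The mean gain is then nonpositive, so the mean number
    of upcrossings of each grid cell is bounded. *)
Lemma supermartingale_cvg (K : nat) (V : nat -> Omega -> R) :
  (forall k, adapted ik (K + k) (V k)) -> (forall k w, 0 <= V k w) ->
  (forall k (h : Omega -> R), adapted ik (K + k) h -> (forall w, 0 <= h w) ->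
     \int[P]_w (h w * V k.+1 w) <= \int[P]_w (h w * V k w)) ->
  {ae P, forall w, cvgn (V ^~ w)}.
Proof.
move=> aV V0 sV.
have iV k (Y : Omega -> R) : adapted ik k Y -> P.-integrable setT (EFin \o Y).
  exact: adapted_integrable.
have EV k : \int[P]_w V k w <= \int[P]_w V 0%N w.
  elim: k => [//|k IH]; apply: le_trans IH.
  have := sV k (fun=> 1) (fun _ _ _ => erefl) (fun=> ler01).
  by congr (_ <= _); apply: eq_Rintegral => w _; rewrite mul1r.
have liminf := @ae_often_bounded _ _ _ P V (\int[P]_w V 0%N w)
  (fun k => adapted_measurable (aV k)) V0.
have {}liminf : {ae P, forall w, exists B, forall N, exists k, (N <= k)%N /\ V k w <= B}.
  apply: liminf => k; rewrite -(fineK (integrable_fin_num measurableT (iV _ _ (aV k)))) lee_fin.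
  exact: EV.
have ucr i j : {ae P, forall w,
    (exists N, forall k, (N <= k)%N -> i%:R / j.+1%:R < V k w) \/
    (exists N, forall k, (N <= k)%N -> V k w < i.+1%:R / j.+1%:R)}.
  set a : R := i%:R / j.+1%:R; set b : R := i.+1%:R / j.+1%:R.
  have ab : a < b by rewrite ltr_pM2r ?invr_gt0 ?ltr_nat.
  have a0 : 0 <= a by rewrite divr_ge0.
  have acr k : adapted ik (K + k) (fun w => crossing a b (V ^~ w) k).
    elim: k => [|k IH] /=; first exact: (adapted_comp (fun x : R => (x <= a, 0%N)) (aV 0%N)).
    move=> w w' ww'; rewrite (aV k.+1 w w' ww').
    have -> // : crossing a b (V ^~ w) k = crossing a b (V ^~ w') k.
    by apply: IH => l lk; apply: ww'; rewrite addnS ltnW.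
  have ah k : adapted ik (K + k) (fun w => (holding a b (V ^~ w) k)%:R : R).
    exact: (adapted_comp (fun q : bool * nat => q.1%:R : R) (acr k)).
  have au k : adapted ik (K + k) (fun w => (upcrossings a b (V ^~ w) k)%:R : R).
    exact: (adapted_comp (fun q : bool * nat => q.2%:R : R) (acr k)).
  have ahV k l : (l <= k.+1)%N -> adapted ik (K + k.+1) (fun w => (holding a b (V ^~ w) k)%:R * V l w).
    move=> lk; apply: adapted_comp2; first by apply: adaptedS (ah k); rewrite addnS.
    by apply: adaptedS (aV l); rewrite leq_add2l.
  have aterm k : adapted ik (K + k.+1) (fun w => (holding a b (V ^~ w) k)%:R * (V k.+1 w - V k w)).
    have := adapted_comp2 (fun x y : R => x - y) (ahV k k.+1 (leqnn _)) (ahV k k (leqnSn k)).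
    by move=> h w w' /h; rewrite -!mulrBr.
  have Eg k : \int[P]_w gain a b (V ^~ w) k <= 0.
    rewrite /gain Ex_sum => [|l]; last exact: iV (aterm l).
    apply: sumr_le0 => l _; under eq_Rintegral do rewrite mulrBr.
    rewrite RintegralB //; [|exact: iV (ahV _ _ _)..].
    by rewrite subr_le0; apply: sV.
  have ag k : adapted ik (K + k) (fun w => gain a b (V ^~ w) k).
    move=> w w' ww'; apply: eq_bigr => l _; apply: aterm => m ml; apply: ww'.
    by apply: leq_trans ml _; rewrite leq_add2l.
  have ub := @ae_bounded _ _ _ P (fun k w => (upcrossings a b (V ^~ w) k)%:R) (a / (b - a))
    (fun k => adapted_measurable (au k)) (fun _ _ => ler0n _ _)
    (fun k w => _).
  have {}ub : {ae P, forall w, exists B, forall k, (upcrossings a b (V ^~ w) k)%:R <= B :> R}.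
    apply: ub => [k w|k]; first by rewrite ler_nat upcrossings_le.
    rewrite -(fineK (integrable_fin_num measurableT (iV _ _ (au k)))) lee_fin.
    rewrite ler_pdivlMr ?subr_gt0 // mulrC -RintegralZl //; last exact: iV (au k).
    rewrite -subr_le0; apply: le_trans (Eg k).
    rewrite [X in _ - X <= _](_ : a = \int[P]_w a); last first.
      by rewrite Rintegral_cst // [fine _](congr1 fine (probability_setT P)) mulr1.
    rewrite -RintegralB //; last 2 first.
      exact: (iV _ _ (adapted_comp (fun x : R => (b - a) * x) (au k))).
      exact: (iV 0%N).
    apply: (@le_Ex _ _ _ P _ ik (K + k)) => //.
      exact: (adapted_comp (fun x : R => (b - a) * x - a) (au k)).
    by move=> w; apply: upcrossings_gain.
  apply: filterS ub => w [B BP].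
  apply: (@upcrossings_bounded _ a b (V ^~ w) (Num.bound `|B|)) => k.
  rewrite -(ler_nat R); apply: le_trans (BP k) _.
  apply: le_trans (ler_norm B) _; apply: ltW; exact: archi_boundP.
have {}ucr := ae_foralln (fun i => ae_foralln (ucr i)).
apply: filterS2 liminf ucr => w lw uw.
by apply: cvg_of_crossings.
Qed.

End supermartingale.

(** * Weak convergence through nested convex hulls *)

Section weak_limit.
Context (R : realType) (V : hilbertType R).
Implicit Types (u : nat -> V) (A : set V) (v w x y z : V).

Definition cvx A : Prop := forall x y (t : R), 0 <= t <= 1 -> A x -> A y ->
  A (t *: x + (1 - t) *: y).

(** Defined from outside, as an intersection, so that closedness and convexity
    come for free. *)
Definition tail_hull u (j : nat) : set V :=
  \bigcap_(A in [set A | [/\ closed A, cvx A & forall k, (j <= k)%N -> A (u k)]]) A.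

Lemma tail_hull_sub u j A : closed A -> cvx A ->
  (forall k, (j <= k)%N -> A (u k)) -> tail_hull u j `<=` A.
Proof. by move=> clA cA uA y; apply. Qed.

Lemma cvx_le_inner v (c : R) : cvx [set y | inner v y <= c].
Proof.
move=> x y t /andP[t0 t1] /= hx hy; rewrite innerDr !innerZr.
have := ler_wpM2l t0 hx; have := ler_wpM2l (_ : 0 <= 1 - t) hy; rewrite subr_ge0 => /(_ t1); lra.
Qed.

Lemma closed_le_inner v (c : R) : closed [set y | inner v y <= c].
Proof.
apply: (@preimage_closed V R (fun y => inner v y) [set r | r <= c]); last exact: closed_le.
by move=> y _; exact: inner_continuous.
Qed.

Lemma closed_le_norm (r : R) : closed [set x : V | `|x| <= r].
Proof.
apply: (@preimage_closed V R (fun x => `|x|) [set s | s <= r]); last exact: closed_le.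
by move=> y _; exact: norm_continuous.
Qed.

Lemma cvx_le_norm (r : R) : cvx [set x : V | `|x| <= r].
Proof.
move=> x y t /andP[t0 t1] /= hx hy; apply: le_trans (ler_normD _ _) _.
rewrite !normrZ !ger0_norm ?subr_ge0 //.
have := ler_wpM2l t0 hx; have := ler_wpM2l (_ : 0 <= 1 - t) hy; rewrite subr_ge0 => /(_ t1); lra.
Qed.

Lemma tail_hull_inter u (r : R) : (forall k, `|u k| <= r) ->
  exists y, forall j, tail_hull u j y.
Proof.
move=> ur; apply: (@nested_closed_convex_inter _ _ (tail_hull u) r).
- by move=> k; exists (u k) => A [_ _]; apply.
- by move=> k; apply: closed_bigI => A [].
- move=> k x y hx hy A AP; have [_ cA _] := AP.
  have := cA _ _ 2^-1 (ltac:(lra)) (hx A AP) (hy A AP).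
  by rewrite scalerDr (_ : 1 - 2^-1 = 2^-1 :> R) //; lra.
- by move=> k l kl y hy A [clA cA uA]; apply: hy; split => // m lm; apply: uA; exact: leq_trans lm.
- by move=> y; apply: (tail_hull_sub (closed_le_norm (r := r)) (@cvx_le_norm r) (fun k _ => ur k)).
Qed.

(** The closed half-spaces around the limit value contain a tail. *)
Lemma tail_hull_inner u y w (l : R) : (forall j, tail_hull u j y) ->
  inner (u k) w @[k --> \oo] --> l -> inner y w = l.
Proof.
move=> hy ul; apply/eqP; rewrite eq_le; apply/andP; split; apply/ler_addgt0Pr => e e0.
- move/cvgrPdist_lt : ul => /(_ e e0)[N _ NP]; rewrite innerC.
  have hs := tail_hull_sub (closed_le_inner (v := w) (c := l + e)) (@cvx_le_inner w (l + e)).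
  apply: (hs u N _ y (hy N)) => k /NP /=.
  by rewrite innerC ltr_norml => /andP[h _]; lra.
- move/cvgrPdist_lt : ul => /(_ e e0)[N _ NP]; rewrite -lerBlDr -lerN2 innerC -innerNl.
  have hs := tail_hull_sub (closed_le_inner (v := - w) (c := - (l - e))) (@cvx_le_inner (- w) (- (l - e))).
  apply: (hs u N _ y (hy N)) => k /NP /=.
  by rewrite innerNl innerC ltr_norml => /andP[_ h]; lra.
Qed.

(** A common point z1 of the hulls is the weak limit. Otherwise some
    functional separates a subsequence from z1, and the hulls of that
    subsequence have a common point z2, which is different from z1. Both lie
    in the hulls of the whole sequence, so the convergent functional T (z2 -
    z1) takes the same value at z1 and z2, and T detects their difference. T
    plays the role of the operator defining a weighted inner product. *)
Lemma weak_limit_of_unique_hull u (r : R) (T : V -> V) (S : set V) :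
  (forall k, `|u k| <= r) -> (forall x, inner x (T x) = 0 -> x = 0) ->
  (forall y, (forall j, tail_hull u j y) -> S y) ->
  (forall y1 y2, S y1 -> S y2 -> cvgn (fun k => inner (u k) (T (y1 - y2)))) ->
  exists2 l, S l & weakly_cvg u l.
Proof.
move=> ur T0 hS hcv; have [z1 z1P] := tail_hull_inter ur.
exists z1; first exact: hS.
move=> v; apply: contrapT => nv.
have [s [e [e0 se]]] : exists s e : R, 0 < e /\
    forall N, exists2 k, (N <= k)%N & e <= inner (u k - z1) (s *: v).
  have [e [e0 eP]] : exists e : R, 0 < e /\ forall N, exists2 k, (N <= k)%N &
      e <= `|inner (u k - z1) v|.
    apply: contrapT => h; apply: nv; apply/cvgrPdist_lt => e e0.
    have : ~ forall N, exists2 k, (N <= k)%N & e <= `|inner (u k - z1) v|.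
      by move=> h'; apply: h; exists e.
    move=> /existsNP[N hN]; exists N => // k Nk /=; rewrite ltNge; apply/negP => h'.
    by apply: hN; exists k => //; rewrite -normrN -innerNl opprB innerBl.
  have [p1|/existsNP[N1 p1]] := pselect (forall N, exists2 k, (N <= k)%N & e <= inner (u k - z1) v).
    by exists 1, e; split => // N; have [k] := p1 N; exists k => //; rewrite scale1r.
  exists (-1), e; split => // N; have [k Nk ek] := eP (maxn N N1).
  move: Nk; rewrite geq_max => /andP[Nk N1k]; exists k => //.
  rewrite scaleN1r innerNr; move: ek; have [h|h] := leP 0 (inner (u k - z1) v).
    by rewrite ger0_norm // => h'; exfalso; apply: p1; exists k.
  by rewrite ltr0_norm.
have /choice[phi phiP] : forall N, exists k, (N <= k)%N /\ e <= inner (u k - z1) (s *: v).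
  by move=> N; have [k] := se N; exists k.
have [z2 z2P] := tail_hull_inter (fun k => ur (phi k)).
have z2P' j : tail_hull u j z2.
  move=> A [clA cA uA]; apply: (z2P j); split => // k jk; apply: uA.
  exact: leq_trans jk (phiP k).1.
have z2v : inner (- (s *: v)) z2 <= - (e + inner z1 (s *: v)).
  have hs := tail_hull_sub (closed_le_inner (v := - (s *: v)) (c := - (e + inner z1 (s *: v)))) (@cvx_le_inner _ _).
  apply: (hs _ _ _ _ (z2P 0%N)) => k _ /=.
  by have := (phiP k).2; rewrite innerBl innerNl (innerC (s *: v)); lra.
have [l lP] : exists l : R, inner (u k) (T (z2 - z1)) @[k --> \oo] --> l.
  by apply/cvg_ex; apply: hcv; exact: hS.
have z12 : z2 - z1 = 0.
  by apply: T0; rewrite innerBl (tail_hull_inner z2P' lP) (tail_hull_inner z1P lP) subrr.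
move: z2v; rewrite innerNl innerC -(subrK z1 z2) z12 add0r; lra.
Qed.

End weak_limit.

Section cvg_approx.
Context (R : realType).

Lemma cvgn_approx (a : nat -> R) :
  (forall e, 0 < e -> exists2 b : nat -> R, cvgn b & forall k, `|a k - b k| <= e) -> cvgn a.
Proof.
move=> ha; apply: cauchy_cvg; apply: cauchy_exP => e e0.
have e4 : 0 < e / 4 by rewrite divr_gt0.
have [b /cvg_ex[/= l bl] ab] := ha _ e4; exists l.
move/cvgrPdist_lt : bl => /(_ _ e4)[N _ NP]; exists N => // k /NP /= h.
rewrite -ball_normE /=; rewrite -(subrKA (b k)); apply: le_lt_trans (ler_normD _ _) _.
by have := ab k; rewrite distrC; lra.
Qed.

End cvg_approx.

Section dense_sequences.
Context (R : realType).

Lemma separable_seq (V : normedModType R) : separable V ->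
  exists q : nat -> V, forall x (e : R), 0 < e -> exists m, `|x - q m| < e.
Proof.
move=> [D /pcard_surjP[q qD] dD]; exists q => x e e0.
have [y [xy Dy]] := dD (ball x e) (ex_intro _ x (ballxx x e0)) (ball_open x e).
by have [m _ qm] := qD _ Dy; exists m; move: xy; rewrite -ball_normE /= qm.
Qed.

(** Families of terms of dense sequences, one for each block, are indexed by
    finite functions with values in nat, hence countable. *)
Lemma dsum_separable_seq n (H : 'I_n.+1 -> hilbertType R) : (forall i, separable (H i)) ->
  exists q : nat -> dsum H, forall x (e : R), 0 < e -> exists m, `|x - q m| < e.
Proof.
move=> hs; pose Q i := projT1 (cid (separable_seq (hs i))).
have QP i := projT2 (cid (separable_seq (hs i))).
pose q m : dsum H := if @unpickle {ffun 'I_n.+1 -> nat} m is Some t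
  then fun i => Q i (t i) else 0.
exists q => x e e0.
have e1 : 0 < e / n.+1%:R by rewrite divr_gt0.
have /choice[t tP] : forall i, exists m, `|x i - Q i m| < e / n.+1%:R by move=> i; exact: QP.
exists (pickle [ffun i => t i]); rewrite /q pickleK.
apply: le_lt_trans (normr_le_sum_coord _) _.
apply: (@lt_le_trans _ _ (\sum_(i < n.+1) e / n.+1%:R)).
  apply: ltr_sum; last by move=> i _; rewrite dsumB ffunE.
  by apply/hasP; exists ord0; rewrite // mem_index_enum.
by rewrite sumr_const card_ord -[leLHS]mulr_natr divfK // pnatr_eq0.
Qed.

(** For each q m and each radius choose a point of S within that radius of q
    m, if there is one. *)
Lemma dense_seq_in (V : normedModType R) (q : nat -> V) (S : set V) :
  (forall x (e : R), 0 < e -> exists m, `|x - q m| < e) -> S !=set0 ->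
  exists2 Z : nat -> V, (forall m, S (Z m)) &
    forall x (e : R), S x -> 0 < e -> exists m, `|x - Z m| < e.
Proof.
move=> qP [s0 Ss0].
have /choice[Z ZP] : forall l : nat, exists z, S z /\
    forall m j : nat, l = pickle (m, j) -> (exists z', S z' /\ `|z' - q m| < j.+1%:R^-1) ->
      `|z - q m| < j.+1%:R^-1.
  move=> l; have [[m [j [lE [z' [Sz' z'q]]]]]|no] := pselect (exists m j, l = pickle (m, j) /\
      exists z', S z' /\ `|z' - q m| < j.+1%:R^-1).
    exists z'; split => // m' j' lE'; move: lE; rewrite lE' => /(pcan_inj (@pickleK _))[-> ->].
    by [].
  by exists s0; split => // m j lE ex; exfalso; apply: no; exists m, j.
exists Z => [m|x e Sx e0]; first exact: (ZP m).1.
have e2 : 0 < e / 2 by rewrite divr_gt0.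
have [j _ jP] := near_infty_natSinv_lt (PosNum e2).
have {}jP : j.+1%:R^-1 < e / 2 := jP j (leqnn j).
have [m mP] := qP x j.+1%:R^-1 (ltac:(by rewrite invr_gt0)).
exists (pickle (m, j)).
have := (ZP (pickle (m, j))).2 m j erefl (ex_intro _ x (conj Sx mP)).
move=> h; rewrite -(subrKA (q m)); apply: le_lt_trans (ler_normD _ _) _.
rewrite (distrC (q m)); move: h mP jP; set w := j.+1%:R^-1; lra.
Qed.

End dense_sequences.

(** * Measurability of weak limits *)

Section borel.
Context (R : realType) (V : hilbertType R) (q : nat -> V).
Hypothesis q_dense : forall x (e : R), 0 < e -> exists m, `|x - q m| < e.

(** Let q l approach y in |y|^2 = inner y (q l) + inner y (y - q l). *)
Lemma norm_le_dense (y : V) (r : R) : 0 <= r ->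
  `|y| <= r <-> forall l, inner y (q l) <= r * `|q l|.
Proof.
move=> r0; split=> [yr l|h].
  by apply: le_trans (inner_le_norm _ _) _; rewrite ler_wpM2r.
have key e : 0 < e -> `|y| ^+ 2 <= r * `|y| + (r + `|y|) * e.
  move=> e0; have [l lP] := q_dense y e0.
  rewrite -inner_normE -{2}(subrK (q l) y) innerDr.
  have h1 := inner_le_norm y (y - q l).
  have h2 : `|y| * `|y - q l| <= `|y| * e by rewrite ler_wpM2l // ltW.
  have h3 := h l.
  have h4 : r * `|q l| <= r * (`|y| + e).
    rewrite ler_wpM2l //; have := ler_normD y (q l - y); rewrite subrKC distrC; lra.
  lra.
have [y0|y0] := eqVneq `|y| 0; first by rewrite y0.
have yp : 0 < `|y| by rewrite lt_neqAle eq_sym y0 normr_ge0.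
rewrite -(ler_pM2r yp) -expr2; apply/ler_addgt0Pr => e e0.
have c0 : 0 < r + `|y| by rewrite ltr_wpDl.
have := key (e / (r + `|y|)) (divr_gt0 e0 c0).
by rewrite mulrC mulrCA divff ?mulr1 ?gt_eqF // [_ * r]mulrC.
Qed.

Context (d : measure_display) (Omega : measurableType d).

(** Pettis: closed balls are countable intersections of half-spaces, and open
    sets are countable unions of closed balls. *)
Lemma weakly_measurable_borel (X : Omega -> V) :
  (forall v, measurable_fun setT (fun w => inner (X w) v)) ->
  measurable_fun setT (X : Omega -> borelType V).
Proof.
move=> mX; apply: (@measurability _ _ _ (borelType V) setT X (@open V)) => //.
move=> _ [U oU <-]; rewrite setTI.
pose ballq m j : set V := [set y | `|y - q m| <= j.+1%:R^-1].
have mball m j : measurable (X @^-1` ballq m j).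
  rewrite (_ : _ @^-1` _ = \bigcap_l [set w | inner (X w) (q l) <=
      inner (q m) (q l) + j.+1%:R^-1 * `|q l|]).
    apply: bigcapT_measurable => l.
    rewrite -[X in measurable X]setTI.
    exact: (mX (q l) measurableT _ (measurable_itv `]-oo, _])).
  have j0 : 0 <= j.+1%:R^-1 :> R by rewrite invr_ge0.
  apply/seteqP; split => w.
    move=> /(norm_le_dense _ j0) h l _ /=.
    by have := h l; rewrite innerBl lerBlDl.
  move=> h; apply/(norm_le_dense _ j0) => l.
  by have := h l I; rewrite /= innerBl lerBlDl.
rewrite (_ : X @^-1` U = \bigcup_m \bigcup_(j in [set j | ballq m j `<=` U]) (X @^-1` ballq m j)).
  by apply: bigcupT_measurable => m; apply: bigcup_measurable.
apply/seteqP; split => w; last by move=> [m _ [j /= sub h]]; exact: sub.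
move=> /= Uw; have [e /= e0 eU] := (nbhs_ballP _ _).1 (open_nbhs_nbhs (conj oU Uw)).
have e2 : 0 < e / 2 by rewrite divr_gt0.
have [j _ jP] := near_infty_natSinv_lt (PosNum e2).
have {}jP : j.+1%:R^-1 < e / 2 := jP j (leqnn j).
have j0 : 0 < j.+1%:R^-1 :> R by rewrite invr_gt0.
have [m mP] := q_dense (X w) j0.
exists m => //; exists j; last exact: ltW.
move=> y /= hy; apply: eU; rewrite -ball_normE /= -(subrKA (q m)).
apply: le_lt_trans (ler_normD _ _) _; rewrite (distrC (q m)).
move: hy mP jP; rewrite /ballq /=; set s := j.+1%:R^-1; lra.
Qed.

Lemma borel_RV (P : probability Omega R) (X : Omega -> V) :
  (forall v, measurable_fun setT (fun w => inner (X w) v)) ->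
  exists X' : {RV P >-> borelType V}, forall w, X' w = X w.
Proof.
move=> mX; have mX' := weakly_measurable_borel mX.
pose m := isMeasurableFun.Build _ _ _ _ _ mX'.
by exists (MeasurableFun.Pack (MeasurableFun.Class m)).
Qed.

End borel.

(** * The objective and its minimisers *)

Section objective_facts.
Context (R : realType) (n : nat) (H : 'I_n.+1 -> hilbertType R).
Variables (f : dsum H -> R) (g : forall i, H i -> \bar R).
Arguments g : clear implicits.
Hypotheses (f_convex : convex_function [set: dsum H] f)
  (f_diff : forall x : dsum H, differentiable f x)
  (g_proper : forall i, proper_function (g i))
  (g_convex : forall i, econvex (g i))
  (g_lsc : forall i, lower_semicontinuous (g i)).

Let F := objective f g.

Lemma sum_ltNy (I : Type) (r : seq I) (Pr : pred I) (h : I -> \bar R) :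
  (forall i, -oo < h i)%E -> (-oo < \sum_(i <- r | Pr i) h i)%E.
Proof.
move=> hN; elim/big_rec: _ => // i y _; move: (hN i).
by case: (h i); case: y => // *; exact: ltNyr.
Qed.

(** No term of the sum is -oo, so that a single infinite term would make it
    infinite. *)
Lemma objective_dom x : (F x < +oo)%E -> domg g x.
Proof.
move=> Fx i; rewrite fin_numElt (g_proper i).1 /=.
move: Fx; rewrite /F /objective (bigD1 i) //=.
have := sum_ltNy (index_enum 'I_n.+1) (fun j => j != i) (fun j => (g_proper j).1 (x j)).
by move: ((g_proper i).1 (x i)); case: (g i (x i)); case: (\sum_(_ | _) _)%E => // *; exact: ltry.
Qed.

Lemma coord_continuous i : continuous (fun x : dsum H => x i : H i).
Proof.
move=> x A /nbhs_ballP[e /= e0 eA].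
apply: (filterS _ (nbhsx_ballx (x : dsum H) e e0)) => y xy; apply: eA.
move: xy; rewrite -!ball_normE /=.
by apply: le_lt_trans; exact: (normr_coord_le (x - y) i).
Qed.

Lemma objective_lsc : lower_semicontinuous F.
Proof.
apply: lscD => [x|x||].
- exact: ltNyr.
- by apply: sum_ltNy => i; exact: (g_proper i).1.
- by apply: lsc_continuous => x; exact: differentiable_continuous.
apply: lsc_sum => [i x|i]; first exact: (g_proper i).1.
exact: (@lsc_comp R (dsum H) (H i) (g i) (fun x => x i) (@coord_continuous i) (@g_lsc i)).
Qed.

Lemma objective_sublevel_cvx (a : R) : cvx [set x | (F x <= a%:E)%E].
Proof.
move=> x y t t01 /= hx hy.
have dx : domg g x by apply: objective_dom; exact: le_lt_trans hx (ltry _).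
have dy : domg g y by apply: objective_dom; exact: le_lt_trans hy (ltry _).
have gt i := @g_convex i (x i) (y i) t t01.
have dt : domg g (t *: x + (1 - t) *: y).
  move=> i; rewrite fin_numElt (g_proper i).1 /=.
  apply: le_lt_trans (gt i) _; rewrite -(fineK (dx i)) -(fineK (dy i)).
  by rewrite -!EFinM -EFinD ltry.
move: hx hy; rewrite /F !objectiveE // !lee_fin /objr => hx hy.
have h1 := convex_functionP f_convex x y t01.
have h2 : \sum_i fine (g i ((t *: x + (1 - t) *: y) i)) <=
   t * \sum_i fine (g i (x i)) + (1 - t) * \sum_i fine (g i (y i)).
  rewrite !mulr_sumr -big_split /=; apply: ler_sum => i _.
  have := gt i; rewrite -(fineK (dx i)) -(fineK (dy i)) -(fineK (dt i)).
  by rewrite -!EFinM -EFinD lee_fin.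
case/andP: t01 => t0 t1.
have := ler_wpM2l t0 hx; have := ler_wpM2l (_ : 0 <= 1 - t) hy; rewrite subr_ge0 => /(_ t1).
move: h1 h2; lra.
Qed.

Lemma argmin_dom z : argmin F z -> domg g z.
Proof.
move=> zmin; apply: objective_dom.
have [x xP] : exists x : dsum H, forall i, (g i (x i) < +oo)%E.
  by exists (fun i => projT1 (cid (g_proper i).2)) => i; exact: projT2 (cid (g_proper i).2).
apply: le_lt_trans (zmin x) _; rewrite /F objectiveE ?ltry // => i.
by rewrite fin_numElt (g_proper i).1 xP.
Qed.

Lemma argmin_inf z : argmin F z -> ereal_inf (range F) = (objr f g z)%:E.
Proof.
move=> zmin; rewrite -objectiveE; last exact: argmin_dom.
apply/eqP; rewrite eq_le; apply/andP; split; first by apply: ereal_inf_lbound; exists z.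
by apply: le_ereal_inf_tmp => _ [x _ <-]; exact: zmin.
Qed.

Lemma argmin_objr z x : argmin F z -> domg g x -> objr f g z <= objr f g x.
Proof.
move=> zmin dx; have := zmin x.
by rewrite /F !objectiveE ?lee_fin //; exact: argmin_dom.
Qed.

Variable c : 'I_n.+1 -> R.
Hypothesis c_gt0 : forall i, 0 < c i.

(** The operator of the weighted inner product with respect to the usual one. *)
Definition wscale (x : dsum H) : dsum H := fun i => c i *: x i.

Definition wnorm2 (x : dsum H) : R := \sum_i c i * `|x i| ^+ 2.

Lemma wnorm2E x : wnorm2 x = inner x (wscale x).
Proof. by rewrite dsum_innerE; apply: eq_bigr => i _; rewrite innerZr inner_normE. Qed.

Lemma wnorm2B x y : wnorm2 (x - y) = wnorm2 x - 2 * inner x (wscale y) + wnorm2 y.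
Proof.
rewrite dsum_innerE /wnorm2 mulr_sumr -sumrB -big_split /=; apply: eq_bigr => i _.
by rewrite sqr_normB innerZr; ring.
Qed.

Lemma wscaleB x y : wscale (x - y) = wscale x - wscale y.
Proof. by apply: dsum_ext => i; rewrite /wscale dsumB scalerBr. Qed.

Lemma wnorm2_eq0 x : wnorm2 x = 0 -> x = 0.
Proof.
move=> /eqP; rewrite psumr_eq0 => [|i _]; last by rewrite mulr_ge0 ?exprn_ge0 // ltW.
move=> /allP h; apply: dsum_ext => i; apply/eqP.
have := h i (mem_index_enum i); rewrite /= mulf_eq0 gt_eqF //= sqrf_eq0 normr_eq0.
by [].
Qed.

Lemma wscale_bound x y : `|inner x (wscale y)| <= (\sum_i c i) * (`|x| * `|y|).
Proof.
rewrite dsum_innerE mulr_suml; apply: le_trans (ler_norm_sum _ _ _) _.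
apply: ler_sum => i _; rewrite innerZr normrM gtr0_norm // ler_pM2l //.
apply: le_trans (cauchy_schwarz _ _) _.
by apply: ler_pM => //; exact: normr_coord_le.
Qed.

Lemma wnorm2_ge x : min_ord c * `|x| ^+ 2 <= wnorm2 x.
Proof.
rewrite dsum_sqnormE mulr_sumr; apply: ler_sum => i _.
by rewrite ler_wpM2r ?exprn_ge0 //; exact: min_ord_le.
Qed.

(** Opial's lemma for the weighted norm. Differences of squared distances to
    two minimisers are affine in the iterate, which is how convergence of
    distances becomes convergence of inner products; density extends it to all
    pairs of minimisers. *)
Lemma weak_cvg_to_argmin (xs : nat -> dsum H) (Z : nat -> dsum H) (zs : dsum H) :
  argmin F zs ->
  (forall x (e : R), argmin F x -> 0 < e -> exists m, `|x - Z m| < e) ->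
  (exists N, forall k, (N <= k)%N -> domg g (xs k)) ->
  objr f g (xs k) @[k --> \oo] --> objr f g zs ->
  (forall m, cvgn (fun k => wnorm2 (xs k - Z m))) ->
  exists2 l, argmin F l & weakly_cvg xs l.
Proof.
move=> zmin Zd [N Ndom] Fcv Zcv.
have c0 := min_ord_gt0 c_gt0.
have [r r0 xr] : exists2 r, 0 <= r & forall k, `|xs k| <= r.
  have [B nB] : exists B : R, forall k, wnorm2 (xs k - Z 0%N) <= B.
    have [B BP] := cvg_has_ub (Zcv 0%N); exists B => k.
    by apply: le_trans (ler_norm _) _; apply: BP; exists k.
  have h k : `|xs k| <= `|Z 0%N| + (1 + `|B| / min_ord c).
    rewrite -(subrK (Z 0%N) (xs k)) addrC; apply: le_trans (ler_normD _ _) _.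
    rewrite lerD2l; set u := `|xs k - _|.
    have : u ^+ 2 <= `|B| / min_ord c.
      rewrite ler_pdivlMr // mulrC; apply: le_trans (wnorm2_ge _) _.
      exact: le_trans (nB k) (ler_norm B).
    have := sqr_ge0 (u - 2^-1); rewrite sqrrB; set q := `|B| / _; lra.
  by exists (`|Z 0%N| + (1 + `|B| / min_ord c)) => //; exact: le_trans (normr_ge0 _) (h 0%N).
apply: (weak_limit_of_unique_hull (T := wscale) xr).
- by move=> x; rewrite -wnorm2E; exact: wnorm2_eq0.
- move=> y hy x; apply: (@le_trans _ _ (objr f g zs)%:E); last first.
    by rewrite -objectiveE ?zmin //; exact: argmin_dom.
  apply/lee_addgt0Pr => e e0; rewrite -EFinD.
  move/cvgrPdist_lt : Fcv => /(_ e e0)[N' _ N'P].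
  have hs := tail_hull_sub (lsc_sublevel_closed (a := objr f g zs + e) objective_lsc)
    (@objective_sublevel_cvx (objr f g zs + e)).
  apply: (hs xs (maxn N N') _ y (hy _)) => k; rewrite geq_max => /andP[Nk N'k] /=.
  rewrite /F objectiveE ?lee_fin; last exact: Ndom.
  by have := N'P k N'k; rewrite /= ltr_norml => /andP[h _]; lra.
move=> y1 y2 min1 min2; apply: cvgn_approx => e e0.
have cvZ m m' : cvgn (fun k => inner (xs k) (wscale (Z m - Z m'))).
  have -> : (fun k => inner (xs k) (wscale (Z m - Z m'))) = fun k =>
      2^-1 * ((wnorm2 (xs k - Z m') - wnorm2 (xs k - Z m)) + (wnorm2 (Z m) - wnorm2 (Z m'))).
    by apply/funext => k; rewrite !wnorm2B wscaleB innerBr; field.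
  by apply: is_cvgMr; apply: is_cvgD; [exact: is_cvgB|exact: is_cvg_cst].
pose K := (\sum_i c i) * (r * 2) + 1.
have S0 : 0 <= \sum_i c i by apply: sumr_ge0 => i _; exact: ltW.
have K0 : 0 < K by rewrite ltr_wpDl // mulr_ge0 // mulr_ge0.
have eK : 0 < e / K by rewrite divr_gt0.
have [m1 h1] := Zd y1 _ min1 eK; have [m2 h2] := Zd y2 _ min2 eK.
exists (fun k => inner (xs k) (wscale (Z m1 - Z m2))) => // k.
rewrite -innerBr -wscaleB; apply: le_trans (wscale_bound _ _) _.
have h3 : `|y1 - y2 - (Z m1 - Z m2)| <= 2 * (e / K).
  have -> : y1 - y2 - (Z m1 - Z m2) = (y1 - Z m1) - (y2 - Z m2).
    by rewrite !opprD !opprK addrACA.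
  apply: le_trans (ler_normB _ _) _; move: h1 h2; set q := e / K; lra.
apply: (@le_trans _ _ ((\sum_i c i) * (r * (2 * (e / K))))).
  by rewrite ler_wpM2l // ler_pM.
rewrite [leLHS](_ : _ = ((\sum_i c i) * (r * 2)) * (e / K)); last by ring.
rewrite mulrA ler_pdivrMr // mulrC ler_pM2l // /K lerDl //.
Qed.

End objective_facts.

(** * The stochastic process generated by the algorithm *)

Lemma bounded_series_cvg (R : realType) (a : nat -> R) (B : R) :
  (forall k, 0 <= a k) -> (forall m, \sum_(k < m) a k <= B) -> cvgn (series a).
Proof.
move=> a0 aB; apply: nondecreasing_is_cvgn.
  exact: nondecreasing_series.
by exists B => _ [m _ <-]; rewrite seriesEord; exact: aB.
Qed.

(** For k >= 2 N, at least k / 2 terms of the tail after N are no smaller than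
    a k. *)
Lemma antitone_summable_rate (R : realType) (a : nat -> R) (B : R) :
  (forall k, 0 <= a k) -> (forall k, a k.+1 <= a k) -> (forall m, \sum_(k < m) a k <= B) ->
  forall e, 0 < e -> exists N, forall k, (N <= k)%N -> k%:R * a k <= e.
Proof.
move=> a0 ad aB e e0; have /cvg_ex[/= l sl] := bounded_series_cvg a0 aB.
have a_le i j : (i <= j)%N -> a j <= a i.
  by move=> /subnK <-; elim: (j - i)%N => [//|m]; rewrite addSn; exact: le_trans.
have e4 : 0 < e / 4 by rewrite divr_gt0.
move/cvgrPdist_lt : sl => /(_ _ e4)[N _ NP].
exists N.*2 => k Nk.
have Nk' : (N <= k)%N by apply: leq_trans Nk; rewrite -addnn leq_addr.
have h1 : (k - N)%:R * a k <= series a k - series a N.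
  rewrite sub_series_geq // mulr_natl -sumr_const_nat.
  rewrite big_nat [leRHS]big_nat; apply: ler_sum => i /andP[_ ik].
  by apply: a_le; exact: ltnW.
(* Both partial sums are within e / 4 of the limit, so the tail is below e /
   2. *)
have h2 := NP _ Nk'; have h3 := NP _ (leqnn N).
rewrite /= in h2 h3; rewrite ltr_norml in h2; rewrite ltr_norml in h3.
have h4 : k%:R <= 2 * (k - N)%:R :> R.
  by rewrite -natrM ler_nat mulnBr !mul2n -[k.*2]addnn -addnBA // leq_addr.
have := ler_wpM2r (a0 k) h4; case/andP: h2 => ? ?; case/andP: h3 => ? ?; lra.
Qed.

Lemma le_sqr_inf (R : realType) (T : Type) (S : set T) (N : T -> R) (b : R) :
  S !=set0 -> (forall z, 0 <= N z) -> (forall z, S z -> b <= N z ^+ 2) ->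
  b <= inf [set N z | z in S] ^+ 2.
Proof.
move=> [z0 Sz0] N0 bN; have [b0|b0] := leP b 0; first exact: le_trans b0 (sqr_ge0 _).
rewrite -(sqr_sqrtr (ltW b0)) lerXn2r ?nnegrE ?sqrtr_ge0 //.
  by apply: lb_le_inf; [exists (N z0), z0|move=> _ [z _ <-]].
apply: lb_le_inf; first by exists (N z0), z0.
move=> _ [z Sz <-]; rewrite -(@ler_pXn2r _ 2) ?nnegrE ?sqrtr_ge0 //.
by rewrite sqr_sqrtr ?(ltW b0) //; exact: bN.
Qed.

Section algorithm.
Context (R : realType) (n : nat) (H : 'I_n.+1 -> hilbertType R).
Variables (f : dsum H -> R) (g : forall i, H i -> \bar R).
Arguments g : clear implicits.
Hypotheses (f_convex : convex_function [set: dsum H] f)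
  (f_diff : forall x : dsum H, differentiable f x)
  (g_proper : forall i, proper_function (g i))
  (g_convex : forall i, econvex (g i))
  (g_lsc : forall i, lower_semicontinuous (g i)).
Variables (Lres : R) (L gamma p : 'I_n.+1 -> R) (tau : nat).
Hypotheses (Lres_gt0 : 0 < Lres)
  (grad_lip : forall (x : dsum H) (i : 'I_n.+1),
     Lres.-lipschitz (fun u => gradient f (set_block x i u)))
  (grad_coord_lip : forall (x : dsum H) (i : 'I_n.+1),
     (L i).-lipschitz (fun u => gradient f (set_block x i u) i))
  (gamma_gt0 : forall i, 0 < gamma i) (p_gt0 : forall i, 0 < p i).
Variables (d : measure_display) (Omega : measurableType d) (P : probability Omega R)
  (ik : nat -> {RV P >-> 'I_n.+1}).
Hypotheses (ik_indep : mutually_independent ik)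
  (ik_distr : forall k j, P (ik k @^-1` [set j]) = (p j)%:E).
Variables (delay : nat -> 'I_n.+1 -> nat)
  (delay_le : forall k j, (delay k j <= minn k tau)%N)
  (x0 : dsum H) (x : nat -> Omega -> dsum H).

Let grad_delayed k w := gradient f (delayed (x ^~ w) k (delay k)).

(** The next iterate if block i were selected; only the selection itself is
    random given the past. *)
Definition candidate (k : nat) (i : 'I_n.+1) (w : Omega) : dsum H :=
  set_block (x k w) i (fb_step g gamma (x k w) (grad_delayed k w) i).

Hypotheses (x_init : forall w, x 0%N w = x0)
  (x_next : forall k w, x k.+1 w = candidate k (ik k w) w).

Let pmax := max_ord p.
Let pmin := min_ord p.
Let delta := max_ord (fun j => L j * gamma j
    + 2 * gamma j * tau%:R * Lres * (pmax / Num.sqrt pmin)).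
Let C := Num.max 1 (2 - delta)^-1 / pmin - 1
    + tau%:R * (Num.sqrt pmin * (2 - delta))^-1 * (1 + pmax / Num.sqrt pmin).
Hypothesis delta_lt2 : delta < 2.

Let Q := Lres * (pmax / Num.sqrt pmin).
Let c2 := tau%:R * Lres + Q * tau%:R.
Let F := objective f g.
Let lagw k w := lag tau (x ^~ w) k.

Definition Phi k w : R := objr f g (x k w) + Q / 2 * lagw k w.

(** The constants are those for which the energy decreases in mean by twice
    the corrected gap, see energy_step; C is the constant of the rate. *)
Definition energy (z : dsum H) k w : R :=
  normW gamma p (x k w - z) ^+ 2 + 2 * (C + 1) * (Phi k w - objr f g z) + c2 * lagw k w.

Let next_lag k i w := lagw k w - \sum_(t < tau) past_step (x ^~ w) k t ^+ 2
  + tau%:R * `|candidate k i w - x k w| ^+ 2.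
Let next_Phi k i w := objr f g (candidate k i w) + Q / 2 * next_lag k i w.
Let next_energy z k i w := normW gamma p (candidate k i w - z) ^+ 2
  + 2 * (C + 1) * (next_Phi k i w - objr f g z) + c2 * next_lag k i w.

Let next_lagE k w : lagw k.+1 w = next_lag k (ik k w) w.
Proof. by rewrite /lagw lagS x_next. Qed.

Let next_PhiE k w : Phi k.+1 w = next_Phi k (ik k w) w.
Proof. by rewrite /Phi next_lagE x_next. Qed.

Let next_energyE z k w : energy z k.+1 w = next_energy z k (ik k w) w.
Proof. by rewrite /energy next_PhiE next_lagE x_next. Qed.

Let p_sum : \sum_i p i = 1. Proof. exact: sum_distr ik_indep ik_distr. Qed.
Let pmin_gt0 : 0 < pmin. Proof. exact: min_ord_gt0. Qed.
Let pmin_le_pmax : pmin <= pmax.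
Proof. exact: le_trans (min_ord_le p ord0) (le_max_ord p ord0). Qed.
Let pmax_gt0 : 0 < pmax. Proof. exact: lt_le_trans pmin_gt0 pmin_le_pmax. Qed.
Let pmin_le1 : pmin <= 1.
Proof.
apply: le_trans (min_ord_le p ord0) _; rewrite -p_sum (bigD1 ord0) //= lerDl.
by apply: sumr_ge0 => i _; exact: ltW.
Qed.
Let Q_gt0 : 0 < Q. Proof. by rewrite mulr_gt0 // divr_gt0 // sqrtr_gt0. Qed.
Let c2_ge0 : 0 <= c2. Proof. by rewrite addr_ge0 // mulr_ge0 // ltW. Qed.
(** A minimum of probabilities is at most 1. *)
Let C1_ge1 : 1 <= C + 1.
Proof.
have d0 : 0 < 2 - delta by rewrite subr_gt0.
have X0 : 0 <= tau%:R * (Num.sqrt pmin * (2 - delta))^-1 * (1 + pmax / Num.sqrt pmin).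
  apply: mulr_ge0; first by rewrite mulr_ge0 // invr_ge0 mulr_ge0 ?sqrtr_ge0 // ltW.
  by rewrite addr_ge0 // divr_ge0 ?sqrtr_ge0 // ltW.
have : 1 <= Num.max 1 (2 - delta)^-1 / pmin.
  by rewrite ler_pdivlMr // mul1r le_max pmin_le1.
rewrite /C; set M := _ / pmin; set X := _ * (1 + _) in X0 *; lra.
Qed.

Let xE k w j : j != ik k w -> x k.+1 w j = x k w j.
Proof. by move=> jik; rewrite x_next /candidate set_block_out. Qed.

Let chain k w := delayed_chain f_convex f_diff Lres_gt0 grad_lip (xs := x ^~ w)
  (ik := fun h => ik h w) k (tau := tau) (dl := delay k) (fun h j => @xE h w j)
  (fun j => leq_trans (delay_le k j) (geq_minr _ _)).

Lemma candidate_dom k i w : domg g (x k w) -> domg g (candidate k i w).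
Proof. by move=> dx; exact: (fb_step_dom f g_proper g_convex g_lsc gamma_gt0 _ dx). Qed.

(** A proximal step lands in the domain of its block, and leaves the other
    blocks unchanged. *)
Lemma iterate_dom k l w : (k <= l)%N -> domg g (x k w) -> domg g (x l w).
Proof.
move=> /subnK <- dx; elim: (l - k)%N => [//|m IH].
by rewrite addSn x_next; exact: candidate_dom.
Qed.

Let increment_sum k w :
  \sum_i p i * `|candidate k i w - x k w| ^+ 2 =
  \sum_i p i * `|x k w i - fb_step g gamma (x k w) (grad_delayed k w) i| ^+ 2.
Proof. by apply: eq_bigr => i _; rewrite norm_set_block distrC. Qed.

Let mean_next_lag k w : \sum_i p i * next_lag k i w =
  lagw k w - \sum_(t < tau) past_step (x ^~ w) k t ^+ 2 +
  tau%:R * \sum_i p i * `|candidate k i w - x k w| ^+ 2.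
Proof.
set c := lagw k w - _.
rewrite (eq_bigr (fun i => p i * c + tau%:R * (p i * `|candidate k i w - x k w| ^+ 2))).
  by rewrite big_split /= -mulr_suml p_sum mul1r -mulr_sumr.
by move=> i _; rewrite /next_lag -/c; ring.
Qed.

Let mean_next_Phi k w : \sum_i p i * next_Phi k i w =
  \sum_i p i * objr f g (candidate k i w) + Q / 2 * \sum_i p i * next_lag k i w.
Proof. by rewrite mulr_sumr -big_split /=; apply: eq_bigr => i _; rewrite /next_Phi; ring. Qed.

Let mean_next_energy z k w : \sum_i p i * next_energy z k i w =
  \sum_i p i * normW gamma p (candidate k i w - z) ^+ 2 +
  2 * (C + 1) * (\sum_i p i * next_Phi k i w - objr f g z) + c2 * \sum_i p i * next_lag k i w.
Proof.
rewrite (eq_bigr (fun i => p i * normW gamma p (candidate k i w - z) ^+ 2 +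
  2 * (C + 1) * (p i * next_Phi k i w) + c2 * (p i * next_lag k i w)
  - p i * (2 * (C + 1) * objr f g z))); last by move=> i _; rewrite /next_energy; ring.
by rewrite sumrB !big_split /= -!mulr_sumr -mulr_suml p_sum; ring.
Qed.

Let step_S k w : R := \sum_i p i * ((gamma i)^-1 *
  `|x k w i - fb_step g gamma (x k w) (grad_delayed k w) i| ^+ 2).

Let step_S_ge0 k w : 0 <= step_S k w.
Proof.
by apply: sumr_ge0 => i _; rewrite !mulr_ge0 ?exprn_ge0 ?invr_ge0 // ltW.
Qed.

Let sobj k w (dx : domg g (x k w)) :
  (2 - delta) / 2 * step_S k w <=
  objr f g (x k w) - \sum_i p i * objr f g (candidate k i w)
  + Q / 2 * \sum_(t < tau) past_step (x ^~ w) k t ^+ 2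
  - Q / 2 * (tau%:R * \sum_i p i * `|candidate k i w - x k w| ^+ 2).
Proof.
rewrite increment_sum.
exact: (step_objective f_convex f_diff g_proper g_convex g_lsc Lres_gt0 grad_coord_lip
  gamma_gt0 p_gt0 p_sum dx (chain k w).1).
Qed.

Lemma Phi_step k w : domg g (x k w) -> \sum_i p i * next_Phi k i w <= Phi k w.
Proof.
move=> dx; have h1 := sobj dx; rewrite mean_next_Phi mean_next_lag /Phi.
have : 0 <= (2 - delta) / 2 * step_S k w.
  by rewrite mulr_ge0 // divr_ge0 // subr_ge0 ltW.
lra.
Qed.

Lemma energy_step z k w : domg g (x k w) -> domg g z ->
  \sum_i p i * next_energy z k i w <= energy z k w - 2 * (Phi k w - objr f g z).
Proof.
move=> dx dz.
have h2 := step_increment g Lres tau grad_coord_lip gamma_gt0 p_gt0 (x k w) (delayed (x ^~ w) k (delay k)).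
rewrite /= -increment_sum in h2.
have h3 := step_distance f_convex f_diff g_proper g_convex g_lsc Lres_gt0 grad_coord_lip
  gamma_gt0 p_gt0 p_sum dx (chain k w).1 (chain k w).2 delta_lt2 dz.
rewrite /= -increment_sum in h3.
rewrite mean_next_energy mean_next_Phi mean_next_lag /energy /Phi.
exact: (potential_arith Lres_gt0 pmin_gt0 pmin_le_pmax (ler0n R tau) delta_lt2
  erefl erefl erefl (step_S_ge0 k w) (lag_le tau (x ^~ w) k) (sobj dx) h2 h3).
Qed.

(** The delays are deterministic, so an iterate is determined by the past
    selections. *)
Lemma iterate_eq k w w' : (forall j, (j < k)%N -> ik j w = ik j w') ->
  forall l, (l <= k)%N -> x l w = x l w'.
Proof.
move=> h l; elim/ltn_ind: l => -[|l] IH lk; first by rewrite !x_init.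
have gE : grad_delayed l w = grad_delayed l w'.
  congr (gradient f _); apply: dsum_ext => j.
  have ld : (l - delay l j < l.+1)%N by rewrite ltnS leq_subr.
  by rewrite /delayed (IH _ ld) // (leq_trans (leq_subr _ _)) // ltnW.
rewrite (x_next l w) (x_next l w') (h l lk) /candidate gE.
by rewrite (IH l (ltnSn l) (ltnW lk)).
Qed.

Let past_eq k w w' : (forall j, (j < k)%N -> ik j w = ik j w') ->
  past_step (x ^~ w) k =1 past_step (x ^~ w') k.
Proof.
by move=> h t; rewrite /past_step (iterate_eq h (leq_subr t k)) (iterate_eq h (leq_subr t.+1 k)).
Qed.

Let lag_adapted k : adapted ik k (lagw k).
Proof. by move=> w w' /past_eq h; apply: eq_bigr => t _; rewrite h. Qed.

Let iterate_adapted k : adapted ik k (x k).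
Proof. by move=> w w' h; exact: iterate_eq h k (leqnn k). Qed.

Let candidate_adapted k i : adapted ik k (candidate k i).
Proof.
move=> w w' h; have gE : grad_delayed k w = grad_delayed k w'.
  congr (gradient f _); apply: dsum_ext => j.
  by rewrite /delayed (iterate_eq h (leq_subr _ _)).
by rewrite /candidate gE (iterate_eq h (leqnn k)).
Qed.

Let next_lag_adapted k i : adapted ik k (next_lag k i).
Proof.
move=> w w' h; rewrite /next_lag (lag_adapted h) (candidate_adapted i h) (iterate_adapted h).
by congr (_ - _ + _); apply: eq_bigr => t _; rewrite (past_eq h).
Qed.

Lemma Phi_adapted k : adapted ik k (Phi k).
Proof. by move=> w w' h; rewrite /Phi (lag_adapted h) (iterate_adapted h). Qed.

Lemma energy_adapted z k : adapted ik k (energy z k).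
Proof. by move=> w w' h; rewrite /energy (Phi_adapted h) (lag_adapted h) (iterate_adapted h). Qed.

Let next_Phi_adapted k i : adapted ik k (next_Phi k i).
Proof. by move=> w w' h; rewrite /next_Phi (next_lag_adapted i h) (candidate_adapted i h). Qed.

Let next_energy_adapted z k i : adapted ik k (next_energy z k i).
Proof.
by move=> w w' h; rewrite /next_energy (next_Phi_adapted i h) (next_lag_adapted i h) (candidate_adapted i h).
Qed.

Let mulA k (Y Z : Omega -> R) (aY : adapted ik k Y) (aZ : adapted ik k Z) :
  adapted ik k (fun w => Y w * Z w).
Proof. exact: (adapted_comp2 (fun a b : R => a * b)). Qed.

(** Apply the pathwise inequality between the mean over the next selection and
    B wherever the weight h does not vanish. *)
Let Ex_next k (h : Omega -> R) (Y : Omega -> R) (N : 'I_n.+1 -> Omega -> R) (B : Omega -> R) :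
  adapted ik k h -> (forall w, 0 <= h w) -> (forall w, h w != 0 -> domg g (x k w)) ->
  (forall w, Y w = N (ik k w) w) -> (forall i, adapted ik k (N i)) -> adapted ik k B ->
  (forall w, domg g (x k w) -> \sum_i p i * N i w <= B w) ->
  \int[P]_w (h w * Y w) <= \int[P]_w (h w * B w).
Proof.
move=> ah h0 hd YN aN aB NB.
have E := Ex_select ik_indep ik_distr (fun i => mulA ah (aN i)).
have -> : \int[P]_w (h w * Y w) = \int[P]_w (\sum_i p i * (h w * N i w)).
  by rewrite -E; apply: eq_Rintegral => w _; rewrite YN.
apply: (@le_Ex _ _ _ P _ ik k).
- move=> w w' ww'; apply: eq_bigr => i _; congr (_ * _).
  exact: (mulA ah (aN i)) ww'.
- exact: mulA.
move=> w; rewrite (eq_bigr (fun i => h w * (p i * N i w))); last by move=> i _; ring.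
rewrite -mulr_sumr; have [->|hw] := eqVneq (h w) 0; first by rewrite !mul0r.
by rewrite ler_wpM2l // NB //; exact: hd.
Qed.

Lemma Ex_Phi_step k h : adapted ik k h -> (forall w, 0 <= h w) ->
  (forall w, h w != 0 -> domg g (x k w)) ->
  \int[P]_w (h w * Phi k.+1 w) <= \int[P]_w (h w * Phi k w).
Proof.
move=> ah h0 hd; apply: (Ex_next ah h0 hd (next_PhiE k) (@next_Phi_adapted k) (@Phi_adapted k)).
by move=> w; exact: Phi_step.
Qed.

Lemma Ex_energy_step z k h : domg g z -> adapted ik k h -> (forall w, 0 <= h w) ->
  (forall w, h w != 0 -> domg g (x k w)) ->
  \int[P]_w (h w * energy z k.+1 w) <=
  \int[P]_w (h w * (energy z k w - 2 * (Phi k w - objr f g z))).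
Proof.
move=> dz ah h0 hd.
apply: (Ex_next ah h0 hd (next_energyE z k) (@next_energy_adapted z k)).
  apply: (adapted_comp2 (fun a b : R => a - 2 * (b - objr f g z)));
    [exact: energy_adapted|exact: Phi_adapted].
by move=> w dx; exact: energy_step.
Qed.

Lemma Phi_ge z k w : argmin F z -> domg g (x k w) ->
  objr f g z <= objr f g (x k w) <= Phi k w.
Proof.
move=> zmin dx; rewrite (argmin_objr g_proper zmin dx) /= lerDl.
by rewrite mulr_ge0 ?lag_ge0 // divr_ge0 // ltW.
Qed.

Lemma energy_ge0 z k w : argmin F z -> domg g (x k w) -> 0 <= energy z k w.
Proof.
move=> zmin dx; have /andP[h1 h2] := Phi_ge zmin dx.
rewrite /energy addr_ge0 ?addr_ge0 ?sqr_ge0 //; last by rewrite mulr_ge0 // lag_ge0.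
by rewrite mulr_ge0 ?mulr_ge0 ?subr_ge0 ?(le_trans h1) // (le_trans ler01).
Qed.

(** Indicator of an event of the past of time K, used as a weight to discard
    the paths along which the objective is still infinite. *)
Definition started K w : R := (`[< domg g (x K w) >])%:R.

Lemma started_ge0 K w : 0 <= started K w. Proof. exact: ler0n. Qed.

Lemma started_neq0 K w : started K w != 0 -> domg g (x K w).
Proof. by rewrite /started; case: asboolP => //; rewrite eqxx. Qed.

Lemma started1 K w : domg g (x K w) -> started K w = 1.
Proof. by move=> dx; rewrite /started; case: asboolP. Qed.

Let started_adapted K k : adapted ik (K + k) (started K).
Proof.
apply: (adaptedS (leq_addr k K)) => w w' h.
by rewrite /started (iterate_adapted h).
Qed.

Let gap_adapted z k : adapted ik k (fun w => Phi k w - objr f g z).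
Proof. exact: (adapted_comp (fun a : R => a - objr f g z) (@Phi_adapted k)). Qed.

Let intP k (Y : Omega -> R) : adapted ik k Y -> P.-integrable setT (EFin \o Y).
Proof. exact: adapted_integrable. Qed.

(** Telescoping sum of the mean energy inequality from time K on. *)
Lemma Ex_energy_sum K z m : argmin F z ->
  \int[P]_w (started K w * energy z (K + m) w)
    + 2 * \sum_(k < m) \int[P]_w (started K w * (Phi (K + k) w - objr f g z))
  <= \int[P]_w (started K w * energy z K w).
Proof.
move=> zmin; have dz := argmin_dom g_proper zmin.
elim: m => [|m IH]; first by rewrite big_ord0 mulr0 addr0 addn0.
apply: le_trans IH; rewrite big_ord_recr /= mulrDr addrA addrAC lerD2r addnS.
have := @Ex_energy_step z (K + m) (started K) dz (@started_adapted K m) (started_ge0 K)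
  (fun w sw => iterate_dom (leq_addr m K) (started_neq0 sw)).
have -> : \int[P]_w (started K w * (energy z (K + m) w - 2 * (Phi (K + m) w - objr f g z))) =
    \int[P]_w (started K w * energy z (K + m) w)
    - 2 * \int[P]_w (started K w * (Phi (K + m) w - objr f g z)).
  rewrite -RintegralZl //; last exact: intP (mulA (@started_adapted K m) (@gap_adapted z (K + m))).
  rewrite -RintegralB //.
  - by apply: eq_Rintegral => w _; ring.
  - exact: intP (mulA (@started_adapted K m) (@energy_adapted z (K + m))).
  - apply: (intP (k := (K + m)%N)); apply: (adapted_comp (fun a : R => 2 * a)).
    exact: (mulA (@started_adapted K m) (@gap_adapted z (K + m))).
by move=> h; rewrite -lerBrDr.
Qed.

Section rate.
Hypothesis x0_dom : domg g x0.

Let dom k w : domg g (x k w).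
Proof. by apply: (@iterate_dom 0) => //; rewrite x_init. Qed.

Let Ex_started Y : \int[P]_w (started 0 w * Y w) = \int[P]_w Y w.
Proof. by apply: eq_Rintegral => w _; rewrite started1 ?mul1r. Qed.

Let Ex_cst (c : R) : \int[P]_w c = c.
Proof. by rewrite Rintegral_cst // [fine _](congr1 fine (probability_setT P)) mulr1. Qed.

Let gap z k := \int[P]_w (Phi k w - objr f g z).

Let gapE z k : gap z k = \int[P]_w Phi k w - objr f g z.
Proof.
rewrite /gap RintegralB ?Ex_cst //; first exact: intP (@Phi_adapted k).
exact: (intP (k := 0%N)).
Qed.

Let gap0 z : gap z 0 = objr f g x0 - objr f g z.
Proof.
rewrite -[RHS]Ex_cst; apply: eq_Rintegral => w _.
by rewrite /Phi /lagw lag0 mulr0 addr0 x_init.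
Qed.

Let gap_ge0 z k : argmin F z -> 0 <= gap z k.
Proof.
move=> zmin; apply: Rintegral_ge0 => w _; rewrite subr_ge0.
by have /andP[h1 h2] := Phi_ge zmin (dom k w); exact: le_trans h2.
Qed.

Let gap_le z k : gap z k.+1 <= gap z k.
Proof.
rewrite !gapE lerD2r; have := @Ex_Phi_step k (started 0) (@started_adapted 0 k) (started_ge0 0) (fun w _ => dom k w).
by rewrite !Ex_started.
Qed.

Let gap_sum z m : argmin F z ->
  2 * \sum_(k < m) gap z k + 2 * (C + 1) * gap z m <=
  normW gamma p (x0 - z) ^+ 2 + 2 * (C + 1) * gap z 0.
Proof.
move=> zmin; have := @Ex_energy_sum 0 z m zmin; rewrite !Ex_started add0n.
rewrite (eq_bigr (fun k : 'I_m => gap z k)) => [h|k _]; last by rewrite Ex_started add0n.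
have e0 : \int[P]_w energy z 0 w = normW gamma p (x0 - z) ^+ 2 + 2 * (C + 1) * gap z 0.
  rewrite gap0 -[RHS]Ex_cst; apply: eq_Rintegral => w _.
  by rewrite /energy /Phi /lagw lag0 !mulr0 !addr0 x_init.
have em : 2 * (C + 1) * gap z m <= \int[P]_w energy z m w.
  rewrite /gap -RintegralZl //; last exact: intP (@gap_adapted z m).
  apply: (@le_Ex _ _ _ P _ ik m).
  - exact: (adapted_comp (fun a : R => 2 * (C + 1) * a) (@gap_adapted z m)).
  - exact: energy_adapted.
  move=> w; rewrite /energy; set u := 2 * (C + 1) * _.
  have := sqr_ge0 (normW gamma p (x m w - z)).
  have := mulr_ge0 c2_ge0 (lag_ge0 tau (x ^~ w) m); rewrite /lagw; lra.
rewrite -e0; move: h em; lra.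
Qed.

Let objr_gap z k : argmin F z ->
  0 <= \int[P]_w objr f g (x k w) - objr f g z <= gap z k.
Proof.
move=> zmin; have ao : adapted ik k (fun w => objr f g (x k w)).
  exact: (adapted_comp (objr f g) (@iterate_adapted k)).
rewrite gapE lerD2r subr_ge0 -[objr f g z]Ex_cst; apply/andP; split.
  by apply: (le_Ex (k := k) _ ao) => // w; have /andP[] := Phi_ge zmin (dom k w).
by apply: (le_Ex ao (@Phi_adapted k)) => w; have /andP[] := Phi_ge zmin (dom k w).
Qed.

(** The gap at time k is at most the mean of the gaps at times 1 to k. Leaving
    the initial one out of this mean is what replaces C + 1 by C. *)
Lemma rate_bound z k : argmin F z -> (1 <= k)%N ->
  k%:R * (\int[P]_w objr f g (x k w) - objr f g z) <=
  normW gamma p (x0 - z) ^+ 2 / 2 + C * (objr f g x0 - objr f g z).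
Proof.
move=> zmin k1; have /andP[_ h] := objr_gap k zmin.
apply: le_trans (ler_wpM2l (ler0n _ _) h) _.
have gmono i : (i <= k)%N -> gap z k <= gap z i.
  by move=> /subnK <-; elim: (k - i)%N => [//|m IH]; rewrite addSn; apply: le_trans IH.
have ks : k%:R * gap z k <= \sum_(j < k) gap z j.+1.
  rewrite mulr_natl -[X in _ *+ X]card_ord -sumr_const; apply: ler_sum => j _.
  by rewrite gmono.
have := gap_sum k zmin; rewrite -gap0.
have : \sum_(j < k) gap z j.+1 + gap z 0 = \sum_(j < k) gap z j + gap z k.
  have <- : \sum_(j < k.+1) gap z j = \sum_(j < k) gap z j + gap z k by rewrite big_ord_recr.
  by rewrite big_ord_recl addrC.
have : gap z k <= (C + 1) * gap z k by rewrite ler_peMl // gap_ge0.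
move: ks; lra.
Qed.

Lemma rate_little_o z : argmin F z -> forall e, 0 < e -> exists N, forall k, (N <= k)%N ->
  k%:R * (\int[P]_w objr f g (x k w) - objr f g z) <= e.
Proof.
move=> zmin e e0.
have gs m : \sum_(k < m) gap z k <=
    (normW gamma p (x0 - z) ^+ 2 + 2 * (C + 1) * gap z 0) / 2.
  have : 0 <= (C + 1) * gap z m by rewrite mulr_ge0 ?gap_ge0 // (le_trans ler01).
  by have := gap_sum m zmin; lra.
have [N NP] := antitone_summable_rate (fun k => gap_ge0 k zmin) (gap_le z) gs e0.
exists N => k /NP; apply: le_trans; apply: ler_wpM2l => //.
by have /andP[] := objr_gap k zmin.
Qed.

End rate.

(** After the objective has become finite the energy is a nonnegative
    supermartingale. *)
Lemma ae_energy_cvg K z : argmin F z ->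
  {ae P, forall w, cvgn (fun k => started K w * energy z (K + k) w)}.
Proof.
move=> zmin; have dz := argmin_dom g_proper zmin.
have aV k : adapted ik (K + k) (fun w => started K w * energy z (K + k) w).
  exact: (mulA (@started_adapted K k) (@energy_adapted z (K + k))).
apply: (supermartingale_cvg (V := fun k w => started K w * energy z (K + k) w) aV).
  move=> k w; have [->|/started_neq0 dx] := eqVneq (started K w) 0; first by rewrite mul0r.
  by rewrite mulr_ge0 ?started_ge0 // energy_ge0 //; exact: iterate_dom (leq_addr k K) dx.
move=> k h ah h0.
have ahs : adapted ik (K + k) (fun w => h w * started K w) := mulA ah (@started_adapted K k).
have hs0 w : 0 <= h w * started K w by rewrite mulr_ge0 ?started_ge0.
have hsd w : h w * started K w != 0 -> domg g (x (K + k)%N w).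
  rewrite mulf_eq0 negb_or => /andP[_ /started_neq0]; exact: iterate_dom (leq_addr k K).
have := Ex_energy_step dz ahs hs0 hsd; rewrite -addnS => step.
rewrite [leLHS](_ : _ = \int[P]_w (h w * started K w * energy z (K + k.+1) w)); last first.
  by apply: eq_Rintegral => w _; rewrite mulrA.
apply: le_trans step _.
rewrite [leRHS](_ : _ = \int[P]_w (h w * started K w * energy z (K + k) w)); last first.
  by apply: eq_Rintegral => w _; rewrite mulrA.
have aE := @energy_adapted z (K + k)%N; have aG := @gap_adapted z (K + k)%N.
apply: (le_Ex (k := (K + k)%N)).
- apply: (mulA ahs); exact: (adapted_comp2 (fun a b : R => a - 2 * b) aE aG).
- exact: (mulA ahs aE).
move=> w; have [->|hw] := eqVneq (h w * started K w) 0; first by rewrite !mul0r.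
rewrite ler_wpM2l // gerBl mulr_ge0 // subr_ge0.
by have /andP[h1] := Phi_ge zmin (hsd w hw); exact: le_trans.
Qed.

(** The mean of the series is bounded by the energy inequality, so the series
    converges almost surely. *)
Lemma ae_gap_cvg0 K z : argmin F z ->
  {ae P, forall w, (started K w * (Phi (K + k)%N w - objr f g z)) @[k --> \oo] --> (0 : R)}.
Proof.
move=> zmin; pose a k w := started K w * (Phi (K + k)%N w - objr f g z).
have a0 k w : 0 <= a k w.
  rewrite /a; have [->|/started_neq0 dx] := eqVneq (started K w) 0; first by rewrite mul0r.
  rewrite mulr_ge0 ?started_ge0 // subr_ge0.
  by have /andP[h1] := Phi_ge zmin (iterate_dom (leq_addr k K) dx); exact: le_trans.
have aA k : adapted ik (K + k) (a k) := mulA (@started_adapted K k) (@gap_adapted z (K + k)%N).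
pose U m w := \sum_(k < m) a k w.
have aU m : adapted ik (K + m) (U m).
  move=> w w' ww'; apply: eq_bigr => k _; apply: aA => j jk; apply: ww'.
  by apply: leq_trans jk _; rewrite leq_add2l ltnW.
have eK m : 0 <= \int[P]_w (started K w * energy z (K + m)%N w).
  apply: Rintegral_ge0 => w _.
  have [->|/started_neq0 dx] := eqVneq (started K w) 0; first by rewrite mul0r.
  by rewrite mulr_ge0 ?started_ge0 // energy_ge0 //; exact: iterate_dom (leq_addr m K) dx.
have bU := @ae_bounded _ _ _ P U (\int[P]_w (started K w * energy z K w) / 2)
  (fun m => adapted_measurable (@aU m)).
have {}bU : {ae P, forall w, exists B, forall m, U m w <= B}.
  apply: bU => [m w|m w|m].
  - by apply: sumr_ge0 => k _; exact: a0.
  - by rewrite /U big_ord_recr /= lerDl a0.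
  rewrite -(fineK (integrable_fin_num measurableT (intP (@aU m)))) lee_fin.
  rewrite -[fine _]/(\int[P]_w U m w) /U Ex_sum => [|k]; last exact: intP (@aA k).
  have := @Ex_energy_sum K z m zmin; have := eK m.
  by rewrite /a; lra.
apply: filterS bU => w [B BP].
by apply: cvg_series_cvg_0; apply: (bounded_series_cvg (B := B)) => // k; exact: a0.
Qed.

(** The probability of avoiding j for N steps is the N-th power of 1 - p j,
    whose series converges. Hence the number of steps during which j is
    avoided is almost surely finite. *)
Lemma ae_selected j : {ae P, forall w, exists k, ik k w = j}.
Proof.
pose Y N w : R := (`[< forall k, (k < N)%N -> ik k w <> j >])%:R.
have Y0 N w : 0 <= Y N w by exact: ler0n.
have Y1 N w : Y N w <= 1 by rewrite /Y; case: asboolP.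
have aY N : adapted ik N (Y N).
  move=> w w' h; rewrite /Y; congr (nat_of_bool _)%:R; apply: asbool_equiv_eq.
  by split=> hj k kN; have := hj k kN; rewrite h.
have YS N w : Y N.+1 w = Y N w * (ik N w != j)%:R.
  rewrite /Y; have [E|/eqP ne] := eqVneq (ik N w) j; last first.
    rewrite mulr1; congr (nat_of_bool _)%:R; apply: asbool_equiv_eq.
    split=> hj k; first by move=> kN; apply: hj; exact: leqW.
    by rewrite ltnS leq_eqVlt => /predU1P[->//|]; exact: hj.
  by rewrite mulr0; case: asboolP => // hj; case: (hj N (ltnSn N)).
have pj : 1 - p j = \sum_(i | i != j) p i.
  by rewrite -p_sum (bigD1 j) //= [_ + \sum_(_ | _) _]addrC addrK.
pose e N := \int[P]_w Y N w.
have eS N : p j * e N = e N - e N.+1.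
  have -> : e N.+1 = \int[P]_w ((1 - p j) * Y N w).
    have aZ i : adapted ik N (fun w => Y N w * (i != j)%:R).
      exact: (adapted_comp (fun a : R => a * (i != j)%:R) (aY N)).
    rewrite /e (_ : Y N.+1 = fun w => Y N w * (ik N w != j)%:R); last exact/funext/YS.
    have := Ex_select ik_indep ik_distr aZ => /= ->; apply: eq_Rintegral => w _.
    rewrite (bigD1 j) //= eqxx mulr0 mulr0 add0r pj mulr_suml.
    by apply: eq_bigr => i ->; rewrite mulr1.
  by rewrite RintegralZl // -/(e N); [ring|exact: intP (aY N)].
have eb N : 0 <= e N <= 1.
  apply/andP; split; first by apply: Rintegral_ge0.
  rewrite -[leRHS](_ : \int[P]_w 1 = 1).
    by apply: (le_Ex (aY N)).
  by rewrite Rintegral_cst // [fine _](congr1 fine (probability_setT P)) mulr1.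
pose U m w := \sum_(N < m) Y N w.
have aU m : adapted ik m (U m).
  move=> w w' ww'; apply: eq_bigr => N _; apply: (aY N) => k kN; apply: ww'.
  by apply: ltn_trans kN _.
have bU := @ae_bounded _ _ _ P U (p j)^-1 (fun m => adapted_measurable (@aU m)).
have {}bU : {ae P, forall w, exists B, forall m, U m w <= B}.
  apply: bU => [m w|m w|m].
  - by apply: sumr_ge0 => N _.
  - by rewrite /U big_ord_recr /= lerDl.
  rewrite -(fineK (integrable_fin_num measurableT (intP (@aU m)))) lee_fin.
  rewrite -[fine _]/(\int[P]_w U m w) /U Ex_sum => [|N]; last exact: intP (aY N).
  rewrite -[leRHS]mul1r ler_pdivlMr // mulrC mulr_sumr.
  have : \sum_(N < m) p j * e N = e 0%N - e m.
    elim: m => [|m IH]; first by rewrite big_ord0 subrr.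
    by rewrite big_ord_recr /= IH eS addrA subrK.
  by move=> ->; have := eb 0%N; have := eb m; lra.
apply: filterS bU => w [B BP]; apply: contrapT => no.
have Yw N : Y N w = 1 by rewrite /Y; case: asboolP => // -[] k _ kj; apply: no; exists k.
have := BP (Num.bound `|B|); rewrite /U (eq_bigr (fun=> 1)) // sumr_const card_ord.
by rewrite leNgt (le_lt_trans (ler_norm B)) // archi_boundP.
Qed.

(** Take K past the first selection of each block: a block that has been
    updated once stays in the domain. *)
Lemma ae_started : {ae P, forall w, exists K, domg g (x K w)}.
Proof.
have sel : {ae P, forall w, forall j, exists k, ik k w = j}.
  exact: (filter_forall (f := fun j => [set w | exists k, ik k w = j]) _ ae_selected).
apply: filterS sel => w /choice[k kP]; exists (\max_(j < n.+1) (k j).+1)%N => j.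
have keep l : g j (x l w j) \is a fin_num -> g j (x l.+1 w j) \is a fin_num.
  move=> fl; have [jl|jl] := eqVneq j (ik l w); last by rewrite xE.
  rewrite x_next -jl /candidate set_block_in.
  exact: (fb_step_fin_num f g_proper g_convex g_lsc gamma_gt0).
have fk : g j (x (k j).+1 w j) \is a fin_num.
  rewrite x_next kP /candidate set_block_in.
  exact: (fb_step_fin_num f g_proper g_convex g_lsc gamma_gt0).
have le_k : ((k j).+1 <= \max_(j < n.+1) (k j).+1)%N by exact: (leq_bigmax (F := fun j => (k j).+1)).
by rewrite -(subnK le_k); elim: (_ - _)%N => [//|m]; rewrite addSn; exact: keep.
Qed.

Hypothesis hsep : forall i, separable (H i).

(** The exceptional set is a countable union over the starting times and over
    a dense sequence of minimisers. *)
Lemma ae_weak_cvg zs : argmin F zs ->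
  {ae P, forall w, exists2 l, argmin F l & weakly_cvg (x ^~ w) l}.
Proof.
move=> zmin; have [q qP] := dsum_separable_seq hsep.
have [Z Zmin Zd] := @dense_seq_in R (dsum H) q (argmin F) qP (ex_intro _ zs zmin).
have ae1 := ae_foralln (fun K => ae_foralln (fun m => ae_energy_cvg K (Zmin m))).
have ae2 := ae_foralln (fun K => ae_gap_cvg0 K zmin).
apply: filterS3 ae1 ae2 ae_started => w ecv gcv [K dK].
have {}ecv m : cvgn (fun k => energy (Z m) (K + k) w).
  have := ecv K m; rewrite (started1 dK).
  by rewrite [X in cvgn X](_ : _ = fun k => energy (Z m) (K + k) w) //; apply/funext => k; rewrite mul1r.
have {}gcv : (Phi (K + k)%N w - objr f g zs) @[k --> \oo] --> (0 : R).
  have := gcv K; rewrite (started1 dK).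
  by rewrite (_ : (fun k => _) = fun k => Phi (K + k)%N w - objr f g zs) //; apply/funext => k; rewrite mul1r.
have dom k : domg g (x (K + k)%N w) := iterate_dom (leq_addr k K) dK.
have shift (u : nat -> R) (l : R) : u (K + k)%N @[k --> \oo] --> l -> u @ \oo --> l.
  move=> h; rewrite -(cvg_shiftn K).
  by under eq_fun do rewrite addnC.
have Fcv : (objr f g (x (K + k)%N w) - objr f g zs) @[k --> \oo] --> (0 : R).
  apply: (squeeze_cvgr _ (cvg_cst (0 : R)) gcv); apply: nearW => k.
  have /andP[h1 h2] := Phi_ge zmin (dom k).
  by rewrite subr_ge0 h1 lerD2r.
have lcv : (lagw (K + k)%N w) @[k --> \oo] --> (0 : R).
  have -> : (fun k => lagw (K + k)%N w) = fun k => (Q / 2)^-1 *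
      ((Phi (K + k)%N w - objr f g zs) - (objr f g (x (K + k)%N w) - objr f g zs)).
    by apply/funext => k; rewrite /Phi; field; rewrite gt_eqF.
  rewrite [X in _ --> X](_ : 0 = (Q / 2)^-1 * (0 - 0)); last by rewrite subr0 mulr0.
  by apply: cvgMr; exact: cvgB.
have c_gt0 i : 0 < (gamma i * p i)^-1 by rewrite invr_gt0 mulr_gt0.
apply: (weak_cvg_to_argmin f_convex f_diff g_proper g_convex g_lsc c_gt0 zmin Zd).
- by exists K => k /subnKC <-; exact: dom.
- apply: shift; rewrite -[X in _ --> X]add0r.
  rewrite [X in X @ _](_ : _ = fun k => (objr f g (x (K + k)%N w) - objr f g zs) + objr f g zs).
    by apply: cvgD => //; exact: cvg_cst.
  by apply/funext => k; rewrite subrK.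
move=> m; have /cvg_ex[/= l el] := ecv m; apply/cvg_ex; exists (l - 2 * (C + 1) * 0 - c2 * 0).
apply: (shift (fun k => wnorm2 (fun i => (gamma i * p i)^-1) (x k w - Z m))).
have Zs : objr f g (Z m) = objr f g zs.
  have [d1 d2] := (argmin_dom g_proper zmin, argmin_dom g_proper (Zmin m)).
  by apply/eqP; rewrite eq_le (argmin_objr g_proper (Zmin m) d1) (argmin_objr g_proper zmin d2).
rewrite [X in X @ _](_ : _ = fun k => energy (Z m) (K + k)%N w
   - 2 * (C + 1) * (Phi (K + k)%N w - objr f g zs) - c2 * lagw (K + k)%N w).
  apply: cvgB; last by apply: cvgMr.
  apply: cvgB; first exact: el.
  apply: cvgMr; exact: gcv.
apply/funext => k; by rewrite /energy sqr_normWE // /wnorm2 Zs; ring.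
Qed.

(** On a measurable null set containing the exceptional one the limit is
    replaced by a fixed minimiser. Its inner products are then limits of
    measurable functions. *)
Lemma weak_limit_RV zs : argmin F zs ->
  exists X : {RV P >-> borelType (dsum H)},
    (forall w, argmin F (X w)) /\
    {ae P, forall w, @weakly_cvg R (dsum H) (x ^~ w) (X w)}.
Proof.
move=> zmin; have [q qP] := dsum_separable_seq hsep.
have [N [mN PN0 subN]] := ae_weak_cvg zmin.
have /choice[X0 X0P] : forall w, exists l, argmin F l /\
    (~ N w -> weakly_cvg (x ^~ w) l) /\ (N w -> l = zs).
  move=> w; have [Nw|nNw] := pselect (N w); first by exists zs; split => //; split.
  have [l lmin lw] : exists2 l, argmin F l & weakly_cvg (x ^~ w) l.
    by apply: contrapT => h; apply: nNw; apply: subN.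
  by exists l; split => //; split.
have mX v : measurable_fun setT (fun w => inner (X0 w) v).
  apply: (@measurable_fun_cvg _ _ _ _
    (fun k w => \1_N w * inner zs v + \1_(~` N) w * inner (x k w) v)) => [k|w _].
    have m1 : measurable_fun setT (\1_N : Omega -> R) by exact: measurable_indic.
    have m2 : measurable_fun setT (\1_(~` N) : Omega -> R).
      by apply: measurable_indic; exact: measurableC.
    have m3 : measurable_fun setT (fun w => inner (x k w) v : R).
      apply: (@adapted_measurable _ _ _ P _ ik k).
      exact: (adapted_comp (fun y : dsum H => inner y v) (@iterate_adapted k)).
    apply: measurable_funD; last exact: measurable_funM.
    by apply: measurable_funM => //; exact: measurable_cst.
  have [_ [lim_w Nz]] := X0P w; rewrite !indicE.
  have [Nw|nNw] := pselect (N w).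
    rewrite (Nz Nw) mem_set // memNset; last by move=> /(_ Nw).
    under eq_fun do rewrite mul1r mul0r addr0.
    exact: cvg_cst.
  rewrite memNset // mem_set //.
  under eq_fun do rewrite mul0r mul1r add0r.
  exact: lim_w.
have [X XE] := borel_RV qP P mX.
exists X; split=> [w|]; first by rewrite XE; exact: (X0P w).1.
exists N; split => // w /= nw; apply: contrapT => nNw; apply: nw.
by rewrite XE; exact: (X0P w).2.1.
Qed.

End algorithm.

(** * Weak convergence and rate *)

Theorem theorem3p1
  (R : realType) (n : nat) (H : 'I_n.+1 -> hilbertType R)
  (hsep : forall i, separable (H i))
  (f : dsum H -> R) (g : forall i, H i -> \bar R)
  (f_convex : convex_function [set: dsum H] f)
  (f_diff : forall x : dsum H, differentiable f x)
  (g_proper : forall i, proper_function (g i))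
  (g_convex : forall i, econvex (g i))
  (g_lsc : forall i, lower_semicontinuous (g i))
  (Lres : R) (L : 'I_n.+1 -> R)
  (Lres_gt0 : 0 < Lres)
  (grad_lip : forall (x : dsum H) (i : 'I_n.+1),
     Lres.-lipschitz (fun u => gradient f (set_block x i u)))
  (grad_coord_lip : forall (x : dsum H) (i : 'I_n.+1),
     (L i).-lipschitz (fun u => gradient f (set_block x i u) i))
  (L_le : max_ord L <= Lres)
  (F_argmin : argmin (objective f g) !=set0)
  (d : measure_display) (Omega : measurableType d) (P : probability Omega R)
  (p : 'I_n.+1 -> R) (ik : nat -> {RV P >-> 'I_n.+1})
  (ik_indep : mutually_independent ik)
  (ik_distr : forall k j, P (ik k @^-1` [set j]) = (p j)%:E)
  (p_gt0 : forall j, 0 < p j)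
  (tau : nat) (delay : nat -> 'I_n.+1 -> nat)
  (delay_le : forall k j, (delay k j <= minn k tau)%N)
  (gamma : 'I_n.+1 -> R) (gamma_gt0 : forall j, 0 < gamma j)
  (x0 : dsum H) (x : nat -> Omega -> dsum H)
  (x_init : forall w, x 0%N w = x0)
  (x_step : forall k w j,
     x k.+1 w j =
     if j == ik k w then
       prox (fun u => ((gamma j)%:E * g j u)%E)
            (x k w j
             - gamma j *: gradient f (delayed (x ^~ w) k (delay k)) j)
     else x k w j) :
  let F := objective f g in
  let Fmin := ereal_inf (range F) in
  let EF k := (\int[P]_w F (x k w))%E in
  let pmax := max_ord p in
  let pmin := min_ord p in
  let delta := max_ord (fun j => L j * gamma j
    + 2 * gamma j * tau%:R * Lres * (pmax / Num.sqrt pmin)) in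
  let C := Num.max 1 (2 - delta)^-1 / pmin - 1
    + tau%:R * (Num.sqrt pmin * (2 - delta))^-1 * (1 + pmax / Num.sqrt pmin) in
  delta < 2 ->
  (exists X : {RV P >-> borelType (dsum H)},
     (forall w, argmin F (X w)) /\
     {ae P, forall w, @weakly_cvg R (dsum H) (x ^~ w) (X w)})
  /\
  ((F x0 < +oo)%E ->
     ((forall k, EF k - Fmin \is a fin_num)%E /\
      (fun k => fine (EF k - Fmin)%E) =o_\oo (fun k => k%:R^-1 : R)) /\
     forall k : nat, (1 <= k)%N ->
       (EF k - Fmin <= (k%:R^-1)%:E *
          ((distW gamma p x0 (argmin F) ^+ 2 / 2)%:E
           + C%:E * (F x0 - Fmin)))%E).

Proof.
move=> F Fmin EF pmax pmin delta C delta_lt2.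
have [z zmin] := F_argmin.
have x_next k w : x k.+1 w = candidate f g gamma delay x k (ik k w) w.
  apply: dsum_ext => j; rewrite x_step /candidate.
  have [->|jik] := eqVneq j (ik k w); first by rewrite set_block_in.
  by rewrite set_block_out.
split.
  exact: (weak_limit_RV f_convex f_diff g_proper g_convex g_lsc Lres_gt0 grad_lip
    grad_coord_lip gamma_gt0 p_gt0 ik_indep ik_distr delay_le x_init x_next delta_lt2 hsep zmin).
move=> Fx0.
have x0_dom : domg g x0 := objective_dom g_proper Fx0.
have dom k w : domg g (x k w).
  by apply: (iterate_dom g_proper g_convex g_lsc gamma_gt0 x_next (leq0n k)); rewrite x_init.
have FminE : Fmin = (objr f g z)%:E := argmin_inf g_proper zmin.
pose b k := \int[P]_w objr f g (x k w) - objr f g z.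
have ao k : adapted ik k (fun w => objr f g (x k w)).
  apply: (adapted_comp (objr f g)) => w w' h.
  exact: (iterate_eq x_init x_next h (leqnn k)).
have EFE k : (EF k - Fmin)%E = (b k)%:E.
  rewrite FminE /EF (eq_integral (fun w => (objr f g (x k w))%:E)); last first.
    by move=> w _; rewrite /F objectiveE.
  by rewrite -(fineK (integrable_fin_num measurableT (adapted_integrable (ao k)))).
have b_ge0 k : 0 <= b k.
  rewrite subr_ge0 -[leLHS](_ : \int[P]_w (objr f g z) = _).
    apply: (le_Ex (k := k) _ (ao k)) => // w.
    exact: (argmin_objr g_proper zmin (dom k w)).
  by rewrite Rintegral_cst // [fine _](congr1 fine (probability_setT P)) mulr1.
split; [split=> [k|]|move=> k k1].
- by rewrite EFE.
- rewrite (_ : (fun k => _) = b); last by apply/funext => k; rewrite EFE.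
  apply/eqoP => e e0.
  have [N NP] := rate_little_o f_convex f_diff g_proper g_convex g_lsc Lres_gt0 grad_lip
    grad_coord_lip gamma_gt0 p_gt0 ik_indep ik_distr delay_le x_init x_next delta_lt2 x0_dom zmin e0.
  exists N.+1 => // k /= Nk; have k0 : (0 : R) < k%:R by rewrite ltr0n (leq_trans _ Nk).
  rewrite ger0_norm // gtr0_norm ?invr_gt0 // ler_pdivlMr // mulrC.
  exact: NP (ltnW Nk).
have k0 : (0 : R) < k%:R by rewrite ltr0n.
rewrite EFE FminE /F objectiveE // -EFinB. rewrite -[(C%:E * _)%E]EFinM -EFinD -EFinM lee_fin.
rewrite ler_pdivlMl // -lerBlDr ler_pdivlMr //.
apply: le_sqr_inf => [//|y|y ymin]; first exact: sqrtr_ge0.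
have yz : objr f g y = objr f g z.
  have [d1 d2] := (argmin_dom g_proper zmin, argmin_dom g_proper ymin).
  by apply/eqP; rewrite eq_le (argmin_objr g_proper ymin d1) (argmin_objr g_proper zmin d2).
have := rate_bound f_convex f_diff g_proper g_convex g_lsc Lres_gt0 grad_lip
    grad_coord_lip gamma_gt0 p_gt0 ik_indep ik_distr delay_le x_init x_next delta_lt2 x0_dom ymin k1.
by rewrite yz -lerBlDr -ler_pdivlMr.
Qed.
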